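(* Let $k,l\ge2$ be even and let $(Q,\sigma)$ be the symmetric quiver of type $\widetilde A$ defined as follows. Vertices: $x_0,x_1,\dots,x_{l/2-1}$, $y_1,\dots,y_{k/2-1}$, their $\sigma$-images (all distinct), and two $\sigma$-fixed vertices $X,Y$; put $y_0:=x_0$, $x_{l/2}:=X$, $y_{k/2}:=Y$. Arrows: $v_i:x_{i-1}\to x_i$ ($1\le i\le l/2$), $u_j:y_{j-1}\to y_j$ ($1\le j\le k/2$), and $\sigma(v_i):\sigma(x_i)\to\sigma(x_{i-1})$, $\sigma(u_j):\sigma(y_j)\to\sigma(y_{j-1})$ (with $\sigma(X)=X$, $\sigma(Y)=Y$). Let $p\ge1$ and $ph$ the dimension vector equal to $p$ at every vertex. Put $\bar a=\sigma(v_1)\cdots\sigma(v_{l/2})v_{l/2}\cdots v_1$ and $\bar b=\sigma(u_1)\cdots\sigma(u_{k/2})u_{k/2}\cdots u_1$ (paths from $x_0$ to $\sigma(x_0)$). Then: (O) $OSI(Q,ph)$ is generated by $\det V(u_j)$ ($1\le j\le k/2$), $\det V(v_j)$ ($1\le j\le l/2$) and the coefficients $c_0,\dots,c_p$ defined by $\det(\psi V(\bar a)+\varphi V(\bar b))=\sum_{i=0}^pc_i\varphi^{p-i}\psi^i$. (Sp) If $p$ is even, $SpSI(Q,ph)$ is generated by $\det V(u_j)$, $\det V(v_j)$ and the coefficients $c_0,\dots,c_{p/2}$ defined by $\mathrm{pf}(\psi V(\bar a)+\varphi V(\bar b))=\sum_{i=0}^{p/2}c_i\varphi^{p/2-i}\psi^i$;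 if $p$ is odd, $SpSI(Q,ph)=\mathbb{K}$.
   Context: $\mathbb{K}$ algebraically closed of characteristic 0; $\varphi,\psi$ indeterminates. Here there are no $\sigma$-fixed arrows; $Q_0^\sigma=\{X,Y\}$, $Q_0^+=\{x_0,\dots,x_{l/2-1},y_1,\dots,y_{k/2-1}\}$, $Q_1^+=\{u_j,v_i\}$. $ORep(Q,\beta)=SpRep(Q,\beta)=\bigoplus_{c\in Q_1^+}\mathrm{Hom}(\mathbb{K}^{\beta(tc)},\mathbb{K}^{\beta(hc)})$, with $SO(Q,\beta)=\prod_{Q_0^+}SL\times SO(\beta(X))\times SO(\beta(Y))$ (resp. $SSp(Q,\beta)=\prod_{Q_0^+}SL\times Sp(\beta(X))\times Sp(\beta(Y))$, requiring $\beta(X),\beta(Y)$ even) acting by $g\cdot V=(g_{hc}V(c)g_{tc}^{-1})$ with $g_{\sigma(x)}:=(g_x^{-1})^t$; in the corresponding orthogonal (resp. symplectic) representation $V(\sigma(c))$ is the adjoint of $-V(c)$ with respect to the forms, so $V(\bar a),V(\bar b)$ are symmetric (resp. skew-symmetric) $p\times p$ matrices. $OSI=\mathbb{K}[ORep]^{SO}$, $SpSI=\mathbb{K}[SpRep]^{SSp}$; $\mathrm{pf}$ is the Pfaffian.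
   Formalization: For p odd no nondegenerate skew-symmetric form exists at X, Y, so SpSI(Q,ph) is undefined; the clause ''if p is odd, SpSI(Q,ph)=K'' is stated only for given nondegenerate skew-symmetric forms and is therefore vacuous. *)

(* Defs.v *)
From HB Require Import structures.
From mathcomp Require Import all_boot all_order all_fingroup all_algebra.
Set Implicit Arguments. Unset Strict Implicit. Unset Printing Implicit Defensive.
Import Order.TTheory GRing.Theory Num.Theory.
Local Open Scope ring_scope.

Inductive gen_alg (T : Type) (K : nzRingType) (G : (T -> K) -> Prop) : (T -> K) -> Prop :=
| alg_const (c : K) : gen_alg G (fun _ => c)
| alg_gen f : G f -> gen_alg G f
| alg_add f g : gen_alg G f -> gen_alg G g -> gen_alg G (fun x => f x + g x)
| alg_mul f g : gen_alg G f -> gen_alg G g -> gen_alg G (fun x => f x * g x).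

Lemma pf_idx0 (n i : nat) : (i < n./2)%N -> (i.*2 < n)%N.
Proof.
move=> H; have H1 : (i.*2.+2 <= n)%N.
  have : ((i.+1).*2 <= (n./2).*2)%N by rewrite leq_double.
  move/leq_trans; apply.
  by rewrite -[X in (_ <= X)%N](odd_double_half n) leq_addl.
by apply: leq_trans H1; rewrite ltnW.
Qed.

Lemma pf_idx1 (n i : nat) : (i < n./2)%N -> (i.*2.+1 < n)%N.
Proof.
move=> H; have : ((i.+1).*2 <= (n./2).*2)%N by rewrite leq_double.
move/leq_trans; apply.
by rewrite -[X in (_ <= X)%N](odd_double_half n) leq_addl.
Qed.

Definition pf_fst n (i : 'I_(n./2)) : 'I_n := Ordinal (pf_idx0 (ltn_ord i)).
Definition pf_snd n (i : 'I_(n./2)) : 'I_n := Ordinal (pf_idx1 (ltn_ord i)).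

(* Pfaffian of an n x n matrix (meaningful for n = 2m even, A skew):
   pf A = 1/(2^m m!) * sum_{s in S_2m} sgn(s) prod_{i<m} A_{s(2i), s(2i+1)}
   (indices 0-based). *)
Definition pfaff (R : comUnitRingType) n (A : 'M[R]_n) : R :=
  ((2 ^ (n./2) * (n./2)`!)%N%:R)^-1 *
  \sum_(s : 'S_n) (-1) ^+ odd_perm s *
     \prod_(i < n./2) A (s (pf_fst i)) (s (pf_snd i)).

(* kh = k/2, lh = l/2.  u j = V(u_{j+1}) : y_j -> y_{j+1},  v i = V(v_{i+1}) : x_i -> x_{i+1},
   with y_0 = x_0, x_{lh} = X, y_{kh} = Y.  All dimensions are p. *)
Definition Rep (K : fieldType) (p kh lh : nat) : Type :=
  (('I_kh -> 'M[K]_p) * ('I_lh -> 'M[K]_p))%type.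

Definition polyfun (K : fieldType) p kh lh (f : Rep K p kh lh -> K) : Prop :=
  gen_alg (fun g => (exists j a b, g = (fun V : Rep K p kh lh => V.1 j a b)) \/
                   (exists i a b, g = (fun V : Rep K p kh lh => V.2 i a b))) f.

(* group elements: gx i = g_{x_i} (i < lh), gx lh = g_X ;
   gy j = g_{y_j} (0 < j < kh), gy kh = g_Y ; g_{y_0} = g_{x_0}. *)
Definition gY (K : fieldType) p (gx gy : nat -> 'M[K]_p) (j : nat) : 'M[K]_p :=
  if j == 0%N then gx 0%N else gy j.

Definition rep_act (K : fieldType) p kh lh (gx gy : nat -> 'M[K]_p)
  (V : Rep K p kh lh) : Rep K p kh lh :=
  (fun j : 'I_kh => gY gx gy j.+1 *m V.1 j *m invmx (gY gx gy j),
   fun i : 'I_lh => gx i.+1 *m V.2 i *m invmx (gx i)).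

Definition SLm (K : fieldType) p (A : 'M[K]_p) : Prop := \det A = 1.
Definition SOm (K : fieldType) p (M A : 'M[K]_p) : Prop := A^T *m M *m A = M /\ \det A = 1.
Definition Spm (K : fieldType) p (M A : 'M[K]_p) : Prop := A^T *m M *m A = M.

Definition in_group (K : fieldType) p kh lh (GX GY : 'M[K]_p -> Prop)
  (gx gy : nat -> 'M[K]_p) : Prop :=
  (forall i, (i < lh)%N -> SLm (gx i)) /\
  (forall j, (0 < j < kh)%N -> SLm (gy j)) /\ GX (gx lh) /\ GY (gy kh).

Definition si_invariant (K : fieldType) p kh lh (GX GY : 'M[K]_p -> Prop)
  (f : Rep K p kh lh -> K) : Prop :=
  forall gx gy, in_group kh lh GX GY gx gy -> forall V, f (rep_act gx gy V) = f V.

Definition pathmx (K : fieldType) p n (M : 'I_n -> 'M[K]_p) : 'M[K]_p :=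
  foldl (fun acc i => M i *m acc) 1%:M (enum 'I_n).

(* With V(sigma c) = - V(c)^T * (form at h(c)) (form = identity pairing at non-fixed
   vertices, form matrix MX at X), the path abar gives
   V(abar) = (-1)^lh * W^T MX W, W = V(v_lh) ... V(v_1). *)
Definition Vabar (K : fieldType) p kh lh (MX : 'M[K]_p) (V : Rep K p kh lh) : 'M[K]_p :=
  ((-1) ^+ lh) *: ((pathmx V.2)^T *m MX *m pathmx V.2).
Definition Vbbar (K : fieldType) p kh lh (MY : 'M[K]_p) (V : Rep K p kh lh) : 'M[K]_p :=
  ((-1) ^+ kh) *: ((pathmx V.1)^T *m MY *m pathmx V.1).

(* bivariate polynomials: {poly {poly K}}, phi = outer variable, psi = inner variable *)
Definition pencil (K : fieldType) p (A B : 'M[K]_p) : 'M[{poly {poly K}}]_p :=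
  \matrix_(a, b) (('X%:P : {poly {poly K}}) * ((A a b)%:P)%:P + 'X * ((B a b)%:P)%:P).

Definition bicoef (K : fieldType) (P : {poly {poly K}}) (d i : nat) : K :=
  (P`_(d - i))`_i.

Definition c_det (K : fieldType) p kh lh (MX MY : 'M[K]_p) (i : nat)
  (V : Rep K p kh lh) : K :=
  bicoef (\det (pencil (Vabar MX V) (Vbbar MY V))) p i.

Definition c_pf (K : fieldType) p kh lh (MX MY : 'M[K]_p) (i : nat)
  (V : Rep K p kh lh) : K :=
  bicoef (pfaff (pencil (Vabar MX V) (Vbbar MY V))) (p./2) i.

Definition O_gens (K : fieldType) p kh lh (MX MY : 'M[K]_p) (f : Rep K p kh lh -> K) : Prop :=
  (exists j : 'I_kh, f = (fun V : Rep K p kh lh => \det (V.1 j))) \/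
  (exists i : 'I_lh, f = (fun V : Rep K p kh lh => \det (V.2 i))) \/
  (exists i, (i <= p)%N /\ f = c_det MX MY i).

Definition Sp_gens (K : fieldType) p kh lh (MX MY : 'M[K]_p) (f : Rep K p kh lh -> K) : Prop :=
  (exists j : 'I_kh, f = (fun V : Rep K p kh lh => \det (V.1 j))) \/
  (exists i : 'I_lh, f = (fun V : Rep K p kh lh => \det (V.2 i))) \/
  (exists i, (i <= p./2)%N /\ f = c_pf MX MY i).

(* Main.v *)
Require Import Defs.
From Stdlib Require Import FunctionalExtensionality.
From HB Require Import structures.
From mathcomp Require Import all_boot all_order all_fingroup all_algebra.
From mathcomp Require Import ring zify.
Set Implicit Arguments. Unset Strict Implicit. Unset Printing Implicit Defensive.
Import Order.TTheory GRing.Theory Num.Theory.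
Local Open Scope ring_scope.

(* On the locus where all maps are invertible the group moves a representation to a
   normal form, so an invariant is determined by its restriction to a slice.

   Inner vertices.  Let [v_0], [v_1] be consecutive arrows with product [Z], and
   [D_d = diag(d,1,...,1)].  Then [f (v_0, v_1) = f (D_d, Z D_d^-1)] with [d = \det v_0],
   and [f (v_0, v_1) = f (D_e^-1 Z, D_e)] with [e = \det v_1].  These are Laurent expansions
   of [f] in [d] and in [e], with coefficients polynomial in [Z]; since [d e = \det Z],
   comparing them removes the negative powers.  Hence [f] is a polynomial in [\det v_0],
   [\det v_1] with coefficients invariant functions of the shorter chain, and by induction
   one arrow is left on each side: [U : x_0 -> Y] and [W : x_0 -> X].

   Two arrows.  For generic [(U, W)] the forms [W^T MX W] and [U^T MY U] are simultaneously
   block diagonal in a basis of determinant [1], and [(U, W)] is equivalent to a pair of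
   diagonal matrices with parameters [(r, t)].  The restriction of [f] to this slice is
   symmetric under simultaneous permutations of [(r_i, t_i)], its torus components are
   multihomogeneous of the same degree in each pair [(r_i, t_i)], and in the orthogonal case
   it is invariant under even sign changes of the [r_i].  The multihomogeneous form of the
   fundamental theorem on symmetric functions expresses it through the coefficients of
   [\prod_i (r_i^e + t_i^e X)] ([e = 2], resp. [e = 1]) and, if [e = 2], through
   [\prod_i r_i] and [\prod_i t_i]; these are the restrictions of the generators. *)

(** Polynomial functions are plain functions in the algebra [gen_alg] generated by the coordinates.
    Identities between them are tested on polynomial curves: any two points lie on one, and a
    one-variable polynomial that vanishes off the zeros of a nonzero polynomial is 0. So an identity
    need only be checked where some polynomial function, not identically zero, does not vanish.

    The slice argument therefore needs a generic locus cut out by a single polynomial function. For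
    the Pfaffian the characteristic polynomial of the pencil is a square, so its discriminant is
    useless. Instead the determinant, or the Pfaffian, of the pencil gives a polynomial P; with S
    the matrix of one form relative to the other, the condition is that P'(S) be invertible.

    Both cases share this argument, with 1x1 or 2x2 blocks and with [Delta] the determinant or the
    unnormalised Pfaffian. A slice matrix carries each parameter on one coordinate of its block
    only. Its determinant is then the product of the parameters in both cases, while the form sees
    their powers of exponent 2, resp. 1. *)

Section GenAlg.
Variables (K : fieldType) (T : Type) (G : (T -> K) -> Prop).

Lemma gen_alg_ext (f g : T -> K) : gen_alg G f -> (forall x, g x = f x) -> gen_alg G g.
Proof. by move=> hf e; have -> : g = f by apply: functional_extensionality. Qed.

Lemma gen_algZ c f : gen_alg G f -> gen_alg G (fun x => c * f x).
Proof. by move=> hf; apply: (alg_mul (alg_const _ c)). Qed.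

Lemma gen_algB f g : gen_alg G f -> gen_alg G g -> gen_alg G (fun x => f x - g x).
Proof.
move=> hf hg; apply: gen_alg_ext (alg_add hf (gen_algZ (-1) hg)) _ => x.
by rewrite mulN1r.
Qed.

Lemma gen_alg_sum I (r : seq I) (P : pred I) (F : I -> T -> K) :
  (forall i, gen_alg G (F i)) -> gen_alg G (fun x => \sum_(i <- r | P i) F i x).
Proof.
move=> hF; elim: r => [|i r IH].
  by apply: gen_alg_ext (alg_const _ 0) _ => x; rewrite big_nil.
case Pi: (P i); last by apply: gen_alg_ext IH _ => x; rewrite big_cons Pi.
by apply: gen_alg_ext (alg_add (hF i) IH) _ => x; rewrite big_cons Pi.
Qed.

Lemma gen_alg_prod I (r : seq I) (P : pred I) (F : I -> T -> K) :
  (forall i, gen_alg G (F i)) -> gen_alg G (fun x => \prod_(i <- r | P i) F i x).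
Proof.
move=> hF; elim: r => [|i r IH].
  by apply: gen_alg_ext (alg_const _ 1) _ => x; rewrite big_nil.
case Pi: (P i); last by apply: gen_alg_ext IH _ => x; rewrite big_cons Pi.
by apply: gen_alg_ext (alg_mul (hF i) IH) _ => x; rewrite big_cons Pi.
Qed.

Lemma gen_algX n f : gen_alg G f -> gen_alg G (fun x => f x ^+ n).
Proof.
move=> hf; elim: n => [|n IH]; first exact: (alg_const _ 1).
by apply: gen_alg_ext (alg_mul hf IH) _ => x; rewrite exprS.
Qed.

Lemma gen_alg_det n (M : T -> 'M[K]_n) :
  (forall i j, gen_alg G (fun x => M x i j)) -> gen_alg G (fun x => \det (M x)).
Proof.
move=> hM; apply: gen_alg_sum => s; apply: gen_algZ.
by apply: gen_alg_prod => i; apply: hM.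
Qed.

Lemma gen_alg_mulmx m n q (A : T -> 'M[K]_(m, n)) (B : T -> 'M[K]_(n, q)) :
  (forall i j, gen_alg G (fun x => A x i j)) -> (forall i j, gen_alg G (fun x => B x i j)) ->
  forall i j, gen_alg G (fun x => (A x *m B x) i j).
Proof.
move=> hA hB i j; apply: (@gen_alg_ext (fun x => \sum_k A x i k * B x k j)).
  by apply: gen_alg_sum => k; apply: alg_mul.
by move=> x; rewrite mxE.
Qed.

End GenAlg.

Lemma gen_alg_comp (K : fieldType) (T T' : Type) (G : (T -> K) -> Prop)
    (G' : (T' -> K) -> Prop) (phi : T' -> T) :
  (forall g, G g -> gen_alg G' (fun x => g (phi x))) ->
  forall f, gen_alg G f -> gen_alg G' (fun x => f (phi x)).
Proof.
move=> h f; elim=> [c|g /h //|g1 g2 _ h1 _ h2|g1 g2 _ h1 _ h2].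
- exact: alg_const.
- exact: (alg_add h1 h2).
- exact: (alg_mul h1 h2).
Qed.

Lemma gen_alg_invariant (K : fieldType) (T : Type) (G : (T -> K) -> Prop) (x y : T) :
  (forall g, G g -> g x = g y) -> forall f, gen_alg G f -> f x = f y.
Proof. by move=> h f; elim=> [c|g /h|? ? _ -> _ ->|? ? _ -> _ ->]. Qed.

(** Meant for [sigma] the inclusion of the slice: if the generators of an algebra on the slice
    extend to the whole space, so does all they generate. *)
Lemma gen_alg_lift (K : fieldType) (S T : Type) (G : (S -> K) -> Prop)
    (H : (T -> K) -> Prop) (sigma : S -> T) :
  (forall g, G g -> exists2 h, gen_alg H h & forall x, g x = h (sigma x)) ->
  forall f, gen_alg G f -> exists2 h, gen_alg H h & forall x, f x = h (sigma x).
Proof.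
move=> hG f; elim=> [c|g /hG //|f1 f2 _ [h1 H1 E1] _ [h2 H2 E2]|f1 f2 _ [h1 H1 E1] _ [h2 H2 E2]].
- by exists (fun=> c) => //; apply: alg_const.
- by exists (fun x => h1 x + h2 x) => [|x]; [apply: alg_add | rewrite E1 E2].
- by exists (fun x => h1 x * h2 x) => [|x]; [apply: alg_mul | rewrite E1 E2].
Qed.

(** * Density along polynomial curves *)

Section Density.
Variable K : fieldType.
Hypothesis charK0 : [pchar K] =i pred0.

Lemma natr_inj_char0 : injective (fun n : nat => n%:R : K).
Proof.
suff H m n : (m <= n)%N -> m%:R = n%:R :> K -> m = n.
  by move=> m n; case/orP: (leq_total m n) => le E; [|apply/esym]; apply: H.
move=> le_mn /esym/eqP; rewrite -subr_eq0 -natrB //.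
by rewrite (pcharf0P K).1 // subn_eq0 => le_nm; apply/eqP; rewrite eqn_leq le_mn.
Qed.

Lemma poly_eq0_everywhere (q : {poly K}) : (forall z, q.[z] = 0) -> q = 0.
Proof.
move=> h; apply/eqP/negPn/negP => q0.
have := @max_poly_roots _ q [seq i%:R | i <- iota 0 (size q)] q0.
rewrite size_map size_iota ltnn map_inj_uniq ?iota_uniq; last exact: natr_inj_char0.
have -> : all (root q) [seq i%:R | i <- iota 0 (size q)].
  by apply/allP => x _; rewrite /root h.
by move/(_ isT isT).
Qed.

Lemma poly_eq0_cofinite (d q : {poly K}) :
  d != 0 -> (forall z, d.[z] != 0 -> q.[z] = 0) -> q = 0.
Proof.
move=> d0 h; have /eqP : d * q = 0.
  apply: poly_eq0_everywhere => z; rewrite hornerM.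
  by case: (eqVneq d.[z] 0) => [->|/h ->]; rewrite ?mul0r ?mulr0.
by rewrite mulf_eq0 (negbTE d0) => /eqP.
Qed.

Lemma poly_eq_nonzero (q1 q2 : {poly K}) : (forall z, z != 0 -> q1.[z] = q2.[z]) -> q1 = q2.
Proof.
move=> h; apply/eqP; rewrite -subr_eq0; apply/eqP.
apply: (@poly_eq0_cofinite 'X); first by rewrite polyX_eq0.
by move=> z; rewrite hornerX hornerD hornerN => /h ->; rewrite subrr.
Qed.

Definition polycurve T (G : (T -> K) -> Prop) (gamma : K -> T) :=
  forall g, G g -> exists q : {poly K}, forall z, g (gamma z) = q.[z].

Lemma polycurve_gen T (G : (T -> K) -> Prop) gamma :
  polycurve G gamma -> polycurve (gen_alg G) gamma.
Proof.
move=> h f; elim=> [c|g /h //|f1 f2 _ [q1 E1] _ [q2 E2]|f1 f2 _ [q1 E1] _ [q2 E2]].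
- by exists c%:P => z; rewrite hornerC.
- by exists (q1 + q2) => z; rewrite hornerD E1 E2.
- by exists (q1 * q2) => z; rewrite hornerM E1 E2.
Qed.

(** A single point of the curve with d nonzero suffices: along the curve d becomes a nonzero
    polynomial in z, and f - g a polynomial that vanishes off its zeros. *)
Lemma eq_on_curve T (G : (T -> K) -> Prop) gamma (d f g : T -> K) z0 z :
  polycurve G gamma -> gen_alg G d -> gen_alg G f -> gen_alg G g ->
  d (gamma z0) != 0 ->
  (forall z, d (gamma z) != 0 -> f (gamma z) = g (gamma z)) -> f (gamma z) = g (gamma z).
Proof.
move=> hc /(polycurve_gen hc)[qd Ed] /(polycurve_gen hc)[qf Ef] /(polycurve_gen hc)[qg Eg].
rewrite Ed => d0 h; apply/eqP; rewrite -subr_eq0 Ef Eg -hornerN -hornerD.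
rewrite (_ : qf - qg = 0) ?horner0 //; apply: (@poly_eq0_cofinite qd).
  by apply: contraNneq d0 => ->; rewrite horner0.
by move=> y; rewrite -Ed => /h; rewrite Ef Eg hornerD hornerN => ->; rewrite subrr.
Qed.

Definition joinable T (G : (T -> K) -> Prop) :=
  forall x y, exists gamma, [/\ polycurve G gamma, gamma 0 = x & gamma 1 = y].

Lemma eq_dense T (G : (T -> K) -> Prop) (d f g : T -> K) x0 :
  joinable G -> gen_alg G d -> gen_alg G f -> gen_alg G g -> d x0 != 0 ->
  (forall x, d x != 0 -> f x = g x) -> forall x, f x = g x.
Proof.
move=> hj hd hf hg d0 h x; have [gamma [hc <- E1]] := hj x x0.
by apply: (@eq_on_curve _ _ _ d f g 1 0 hc) => //; [rewrite E1|move=> z; apply: h].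
Qed.

(** * Polynomial and Laurent expansions in one parameter *)

Section Expansion.
Variables (T T' : Type) (G : (T -> K) -> Prop) (G' : (T' -> K) -> Prop).

Definition coefs_in (P : T' -> {poly K}) := forall i, gen_alg G' (fun x => (P x)`_i).

Lemma coefs_inD P Q : coefs_in P -> coefs_in Q -> coefs_in (fun x => P x + Q x).
Proof. by move=> hP hQ i; apply: gen_alg_ext (alg_add (hP i) (hQ i)) _ => x; rewrite coefD. Qed.

Lemma coefs_inM P Q : coefs_in P -> coefs_in Q -> coefs_in (fun x => P x * Q x).
Proof.
move=> hP hQ i; apply: (@gen_alg_ext _ _ _ (fun x => \sum_(j < i.+1) (P x)`_j * (Q x)`_(i - j))).
  by apply: gen_alg_sum => j; apply: alg_mul.
by move=> x; rewrite coefM.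
Qed.

Lemma coefs_in_const (q : {poly K}) : coefs_in (fun=> q).
Proof. by move=> i; apply: alg_const. Qed.

Definition poly_family (F : T' -> K -> K) :=
  exists n (P : T' -> {poly K}),
    [/\ forall x, (size (P x) <= n)%N, coefs_in P & forall x z, F x z = (P x).[z]].

Lemma poly_family_gen (phi : T' -> K -> T) :
  (forall g, G g -> poly_family (fun x z => g (phi x z))) ->
  forall f, gen_alg G f -> poly_family (fun x z => f (phi x z)).
Proof.
move=> h f; elim=> [c|g /h //|f1 f2 _ [n1 [P1 [s1 c1 E1]]] _ [n2 [P2 [s2 c2 E2]]]
  |f1 f2 _ [n1 [P1 [s1 c1 E1]]] _ [n2 [P2 [s2 c2 E2]]]].
- exists 1%N, (fun=> c%:P); split=> [x||x z].
  + by rewrite size_polyC; case: eqP.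
  + exact: coefs_in_const.
  + by rewrite hornerC.
- exists (maxn n1 n2), (fun x => P1 x + P2 x); split=> [x||x z].
  + by apply: leq_trans (size_polyD _ _) _; rewrite geq_max !leq_max s1 s2 orbT.
  + exact: coefs_inD.
  + by rewrite hornerD E1 E2.
- exists (n1 + n2)%N, (fun x => P1 x * P2 x); split=> [x||x z].
  + apply: leq_trans (size_polyMleq _ _) _.
    by apply: leq_trans (leq_pred _) (leq_add (s1 x) (s2 x)).
  + exact: coefs_inM.
  + by rewrite hornerM E1 E2.
Qed.

(** A Laurent polynomial in z with exponents between -n and n, stored as z^n times itself. The bound
    n is uniform in x, and nothing is asked at z = 0. *)
Definition laurent_family (F : T' -> K -> K) :=
  exists n (P : T' -> {poly K}),
    [/\ forall x, (size (P x) <= n.*2.+1)%N, coefs_in P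
      & forall x z, z != 0 -> F x z * z ^+ n = (P x).[z]].

Lemma laurent_family_gen (phi : T' -> K -> T) :
  (forall g, G g -> laurent_family (fun x z => g (phi x z))) ->
  forall f, gen_alg G f -> laurent_family (fun x z => f (phi x z)).
Proof.
move=> h f; elim=> [c|g /h //|f1 f2 _ [n1 [P1 [s1 c1 E1]]] _ [n2 [P2 [s2 c2 E2]]]
  |f1 f2 _ [n1 [P1 [s1 c1 E1]]] _ [n2 [P2 [s2 c2 E2]]]].
- exists 0%N, (fun=> c%:P); split=> [x||x z _].
  + by rewrite size_polyC; case: eqP.
  + exact: coefs_in_const.
  + by rewrite hornerC mulr1.
- exists (n1 + n2)%N, (fun x => P1 x * 'X^n2 + P2 x * 'X^n1); split=> [x||x z z0].
  + apply: leq_trans (size_polyD _ _) _; rewrite geq_max.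
    have H1 := s1 x; have H2 := s2 x.
    have := size_polyMleq (P1 x) 'X^n2; have := size_polyMleq (P2 x) 'X^n1.
    rewrite !size_polyXn; lia.
  + by apply: coefs_inD; apply: coefs_inM => //; apply: coefs_in_const.
  + by rewrite hornerD !hornerM !hornerXn -E1 // -E2 // exprD; ring.
- exists (n1 + n2)%N, (fun x => P1 x * P2 x); split=> [x||x z z0].
  + apply: leq_trans (size_polyMleq _ _) _.
    have H1 := s1 x; have H2 := s2 x; lia.
  + exact: coefs_inM.
  + by rewrite hornerM -E1 // -E2 // exprD; ring.
Qed.

End Expansion.
End Density.

(** * Reduction to one arrow on each side *)

Section Path.
Variables (K : fieldType) (p : nat).
Implicit Types (A B g X Y : 'M[K]_p).

Lemma pathmx_recl n (M : 'I_n.+1 -> 'M[K]_p) :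
  pathmx M = pathmx (fun i => M (lift ord0 i)) *m M ord0.
Proof.
have H (I : Type) (N : I -> 'M[K]_p) (s : seq I) A :
    foldl (fun acc i => N i *m acc) A s = foldl (fun acc i => N i *m acc) 1%:M s *m A.
  elim: s A => [|i s IH] A /=; first by rewrite mul1mx.
  by rewrite IH mulmx1 [in RHS]IH mulmxA.
rewrite /pathmx enum_ordSl /= mulmx1 H; congr (_ *m _).
by elim: (enum 'I_n) (1%:M : 'M[K]_p) => //= i s IH A; rewrite IH.
Qed.

Lemma pathmx0 (M : 'I_0 -> 'M[K]_p) : pathmx M = 1%:M.
Proof. by rewrite /pathmx; case: (enum 'I_0) => // -[]. Qed.

Lemma pathmx1 (M : 'I_1 -> 'M[K]_p) : pathmx M = M ord0.
Proof. by rewrite pathmx_recl pathmx0 mul1mx. Qed.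

Lemma det1_unit A : \det A = 1 -> A \in unitmx.
Proof. by rewrite unitmxE => ->; apply: unitr1. Qed.

Lemma det1_inv A : \det A = 1 -> \det (invmx A) = 1.
Proof. by rewrite det_inv => ->; rewrite invr1. Qed.

Lemma invmxM A B : A \in unitmx -> B \in unitmx -> invmx (A *m B) = invmx B *m invmx A.
Proof.
move=> uA uB; have uAB : A *m B \in unitmx by rewrite unitmx_mul uA.
apply: (can_inj (mulKmx uAB)); rewrite mulmxV //.
by rewrite mulmxA -(mulmxA A) mulmxV // mulmx1 mulmxV.
Qed.

Lemma pathmx_act n (M : 'I_n -> 'M[K]_p) (g : nat -> 'M[K]_p) :
  (forall i, (0 < i < n)%N -> g i \in unitmx) -> (0 < n)%N ->
  pathmx (fun i : 'I_n => g i.+1 *m M i *m invmx (g i)) = g n *m pathmx M *m invmx (g 0%N).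
Proof.
elim: n M g => // n IH M g hg _; rewrite !pathmx_recl /=.
case: n IH M hg => [_ M hg|n IH M hg]; first by rewrite !pathmx0 !mul1mx.
rewrite (IH (fun i => M (lift ord0 i)) (fun i => g i.+1)) => [|i /andP[_ hi]|//].
  by rewrite -!mulmxA mulKmx // hg.
exact: hg.
Qed.

Definition corner d : 'M[K]_p := diag_mx (\row_j (if j == 0%N :> nat then d else 1)).

Lemma det_corner d : (0 < p)%N -> \det (corner d) = d.
Proof.
rewrite /corner; case: p => // n _; rewrite det_diag (bigD1 ord0) //= mxE eqxx.
by rewrite big1 ?mulr1 // => i ne; rewrite mxE ifN.
Qed.

Lemma corner_mul d e : corner d *m corner e = corner (d * e).
Proof.
rewrite /corner mulmx_diag; congr diag_mx; apply/rowP => j; rewrite !mxE.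
by case: ifP => _ //; rewrite mulr1.
Qed.

Lemma corner1 : corner 1 = 1%:M.
Proof.
rewrite /corner -diag_const_mx; congr diag_mx; apply/rowP => j; rewrite !mxE.
by case: ifP.
Qed.

Lemma cornerV d : d != 0 -> corner d *m corner d^-1 = 1%:M.
Proof. by move=> d0; rewrite corner_mul divff // corner1. Qed.

Lemma cornerVl d : d != 0 -> corner d^-1 *m corner d = 1%:M.
Proof. by move=> d0; rewrite corner_mul mulVf // corner1. Qed.

Lemma corner_unit d : d != 0 -> corner d \in unitmx.
Proof. by move=> d0; case: (mulmx1_unit (cornerV d0)). Qed.

Lemma corner_inv d : d != 0 -> invmx (corner d) = corner d^-1.
Proof.
move=> d0; apply: (can_inj (mulKmx (corner_unit d0))).
by rewrite mulmxV ?corner_unit // cornerV.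
Qed.

End Path.

Section RepBasics.
Variables (K : fieldType) (p : nat).

Lemma rep_joinable kh lh : joinable (fun g => (exists j a b, g = (fun V : Rep K p kh lh => V.1 j a b)) \/
                   (exists i a b, g = (fun V : Rep K p kh lh => V.2 i a b))).
Proof.
move=> V V'; exists (fun z => (fun j => V.1 j + z *: (V'.1 j - V.1 j),
                              fun i => V.2 i + z *: (V'.2 i - V.2 i))); split.
- move=> g [] [i [a [b ->]]] /=.
    exists ((V.1 i a b)%:P + (V'.1 i a b - V.1 i a b) *: 'X) => z.
    by rewrite !mxE hornerD hornerC hornerZ hornerX mulrC.
  exists ((V.2 i a b)%:P + (V'.2 i a b - V.2 i a b) *: 'X) => z.
  by rewrite !mxE hornerD hornerC hornerZ hornerX mulrC.
- rewrite [RHS]surjective_pairing.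
  by congr pair; apply: functional_extensionality => i; rewrite scale0r addr0.
- rewrite [RHS]surjective_pairing.
  by congr pair; apply: functional_extensionality => i; rewrite scale1r addrC subrK.
Qed.

Lemma polyfun_arrow1 kh lh j a b : polyfun (fun V : Rep K p kh lh => V.1 j a b).
Proof. by apply: alg_gen; left; exists j, a, b. Qed.

Lemma polyfun_arrow2 kh lh j a b : polyfun (fun V : Rep K p kh lh => V.2 j a b).
Proof. by apply: alg_gen; right; exists j, a, b. Qed.

Lemma gen_alg_path T (G : (T -> K) -> Prop) n (M : T -> 'I_n -> 'M[K]_p) :
  (forall i a b, gen_alg G (fun x => M x i a b)) ->
  forall a b, gen_alg G (fun x => pathmx (M x) a b).
Proof.
elim: n M => [|n IH] M hM a b.
  by apply: gen_alg_ext (alg_const G ((1%:M : 'M[K]_p) a b)) _ => x; rewrite pathmx0.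
apply: (@gen_alg_ext _ _ _ (fun x => (pathmx (fun i => M x (lift ord0 i)) *m M x ord0) a b)).
  by apply: gen_alg_mulmx => // c d; apply: (IH (fun x i => M x (lift ord0 i))).
by move=> x; rewrite pathmx_recl.
Qed.

Lemma rep_act1 kh lh (V : Rep K p kh lh) : rep_act (fun=> 1%:M) (fun=> 1%:M) V = V.
Proof.
rewrite [RHS]surjective_pairing; congr pair; apply: functional_extensionality => i;
by rewrite /gY ?if_same invmx1 mulmx1 mul1mx.
Qed.

(** The first arrow of [V] is discarded and X, Y take its place; the other arrows move up by one.
    The [inord] is a mere cast, its argument being in range. *)
Definition put kh m X Y (V : Rep K p kh m.+1) : Rep K p kh m.+2 :=
  (V.1, fun i => match val i with 0 => X | 1 => Y | i'.+2 => V.2 (inord i'.+1) end).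

Definition merge kh m (V : Rep K p kh m.+2) : Rep K p kh m.+1 :=
  (V.1, fun i => if i == ord0 then V.2 (lift ord0 ord0) *m V.2 ord0 else V.2 (lift ord0 i)).

Lemma put_merge kh m (V : Rep K p kh m.+2) : put (V.2 ord0) (V.2 (lift ord0 ord0)) (merge V) = V.
Proof.
rewrite [RHS]surjective_pairing; congr pair; apply: functional_extensionality => -[[|[|i]] hi] /=.
- by congr (V.2 _); apply: val_inj.
- by congr (V.2 _); apply: val_inj.
- rewrite ifN; last by rewrite -val_eqE /= inordK.
  by congr (V.2 _); apply: val_inj; rewrite /= inordK.
Qed.

Lemma merge0 kh m (V : Rep K p kh m.+2) : (merge V).2 ord0 = V.2 (lift ord0 ord0) *m V.2 ord0.
Proof. by []. Qed.

Lemma pathmx_merge kh m (V : Rep K p kh m.+2) : pathmx (merge V).2 = pathmx V.2.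
Proof.
by rewrite !pathmx_recl /= !mulmxA.
Qed.

Definition insert_g (g : 'M[K]_p) (gx : nat -> 'M[K]_p) (i : nat) : 'M[K]_p :=
  match i with 0 => gx 0%N | 1 => g | i'.+2 => gx i'.+1 end.

Lemma rep_act_put kh m X Y (V : Rep K p kh m.+1) g gx gy :
  rep_act (insert_g g gx) gy (put X Y V) =
  put (g *m X *m invmx (gx 0%N)) (gx 1%N *m Y *m invmx g) (rep_act gx gy V).
Proof.
congr pair; apply: functional_extensionality => -[[|[|i]] hi] //=.
by rewrite inordK.
Qed.

Lemma in_group_insert kh m GX GY (g : 'M[K]_p) gx gy : SLm g -> Defs.in_group kh m.+1 GX GY gx gy ->
  Defs.in_group kh m.+2 GX GY (insert_g g gx) gy.
Proof.
move=> hg [h1 [h2 h3]]; split; last by [].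
by move=> [|[|i]] hi //=; apply: h1.
Qed.

End RepBasics.

Section LaurentMono.
Variables (K : fieldType) (T : Type) (G : (T -> K) -> Prop).

Lemma laurent_const (g : T -> K) : gen_alg G g -> laurent_family G (fun x _ => g x).
Proof.
move=> hg; exists 0%N, (fun x => (g x)%:P); split=> [x|[|i]|x z _].
- by rewrite size_polyC; case: eqP.
- by apply: gen_alg_ext hg _ => x; rewrite coefC.
- by apply: gen_alg_ext (alg_const G 0) _ => x; rewrite coefC.
- by rewrite hornerC mulr1.
Qed.

Lemma laurent_X : laurent_family G (fun _ z => z).
Proof.
exists 1%N, (fun=> 'X^2); split=> [x||x z _]; first by rewrite size_polyXn.
- exact: coefs_in_const.
- by rewrite hornerXn expr1 expr2.
Qed.

Lemma laurent_V (g : T -> K) : gen_alg G g -> laurent_family G (fun x z => g x * z^-1).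
Proof.
move=> hg; exists 1%N, (fun x => (g x)%:P); split=> [x|[|i]|x z z0].
- by rewrite size_polyC; case: eqP.
- by apply: gen_alg_ext hg _ => x; rewrite coefC.
- by apply: gen_alg_ext (alg_const G 0) _ => x; rewrite coefC.
- by rewrite hornerC expr1 mulfVK.
Qed.

(** Allows two families to be written with the same pole order, so that their coefficients can be
    compared. *)
Lemma laurent_pad F : laurent_family G F -> exists n0, forall n, (n0 <= n)%N ->
  exists P : T -> {poly K},
    [/\ forall x, (size (P x) <= n.*2.+1)%N, coefs_in G P
      & forall x z, z != 0 -> F x z * z ^+ n = (P x).[z]].
Proof.
move=> [n0 [P [sP cP E]]]; exists n0 => n le; exists (fun x => P x * 'X^(n - n0)); split=> [x||x z z0].
- have H := sP x; have := size_polyMleq (P x) 'X^(n - n0); rewrite size_polyXn; lia.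
- by apply: coefs_inM => //; apply: coefs_in_const.
- by rewrite hornerM hornerXn -E // -mulrA -exprD subnKC.
Qed.

Lemma eq_laurent F F' : laurent_family G F -> (forall x z, F' x z = F x z) -> laurent_family G F'.
Proof.
by move=> [n [P [sP cP E]]] e; exists n, P; split=> // x z z0; rewrite e E.
Qed.

End LaurentMono.

(** * Elimination of an inner vertex *)

Section Merge.
Variables (K : fieldType) (p kh m : nat) (GX GY : 'M[K]_p -> Prop).
Hypotheses (charK0 : [pchar K] =i pred0) (hp : (0 < p)%N).
Hypotheses (GX1 : GX 1%:M) (GY1 : GY 1%:M) (detGX : forall h, GX h -> \det h = 1).
Variable f : Rep K p kh m.+2 -> K.
Hypotheses (pf : polyfun f) (invf : si_invariant GX GY f).

Lemma put_inv X Y (V : Rep K p kh m.+1) g gx gy :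
  SLm g -> Defs.in_group kh m.+1 GX GY gx gy ->
  f (put (g *m X *m invmx (gx 0%N)) (gx 1%N *m Y *m invmx g) (rep_act gx gy V)) = f (put X Y V).
Proof. by move=> hg hG; rewrite -rep_act_put invf //; apply: in_group_insert. Qed.

Lemma put_inv1 X Y (V : Rep K p kh m.+1) g :
  SLm g -> f (put (g *m X) (Y *m invmx g) V) = f (put X Y V).
Proof.
move=> hg; have := @put_inv X Y V g (fun=> 1%:M) (fun=> 1%:M) hg.
rewrite rep_act1 invmx1 mulmx1 mul1mx; apply.
by split=> [i _|]; [|split=> // i _]; rewrite /SLm det1.
Qed.

Let alpha (V : Rep K p kh m.+1) d := f (put (corner p d) (V.2 ord0 *m corner p d^-1) V).
Let beta (V : Rep K p kh m.+1) e := f (put (corner p e^-1 *m V.2 ord0) (corner p e) V).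

(** An element acting at the source of the corner is compensated at the inserted vertex by its
    conjugate under the corner, which again has determinant 1. *)
Lemma alpha_inv V gx gy d : d != 0 -> Defs.in_group kh m.+1 GX GY gx gy ->
  alpha (rep_act gx gy V) d = alpha V d.
Proof.
move=> d0 hG; have dg0 : \det (gx 0%N) = 1 by case: hG => h _; apply: h.
rewrite /alpha -(@put_inv _ _ V (corner p d *m gx 0%N *m corner p d^-1) gx gy) //; last first.
  by rewrite /SLm !det_mulmx dg0 !det_corner // mulr1 divff.
congr (f (put _ _ _)).
  by rewrite -!mulmxA [corner p d^-1 *m _]mulmxA cornerVl // mul1mx mulmxV ?mulmx1 // det1_unit.
rewrite /= !invmxM ?unitmx_mul ?corner_unit ?invr_eq0 ?det1_unit // !corner_inv ?invr_eq0 // invrK.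
by rewrite -!mulmxA [corner p d^-1 *m (corner p d *m _)]mulmxA cornerVl // mul1mx.
Qed.

Lemma beta_inv V gx gy d : d != 0 -> Defs.in_group kh m.+1 GX GY gx gy ->
  beta (rep_act gx gy V) d = beta V d.
Proof.
move=> d0 hG; have dg1 : \det (gx 1%N) = 1.
  (* For m = 0 the target of the corner is the fixed vertex X, where determinant 1 comes from
     [detGX]. *)
  case: hG => h [_ [hX _]]; case: (posnP m) => [m0|m0]; last exact: h.
  by apply: detGX; rewrite m0 in hX.
rewrite /beta -(@put_inv _ _ V (corner p d^-1 *m gx 1%N *m corner p d) gx gy) //; last first.
  by rewrite /SLm !det_mulmx dg1 !det_corner // mulr1 mulVf.
congr (f (put _ _ _)).
  by rewrite /= -!mulmxA [corner p d *m (corner p d^-1 *m _)]mulmxA cornerV // mul1mx.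
rewrite /= !invmxM ?unitmx_mul ?corner_unit ?invr_eq0 ?det1_unit // !corner_inv ?invr_eq0 // invrK.
rewrite -!mulmxA [corner p d *m (corner p d^-1 *m _)]mulmxA cornerV // mul1mx mulmxA.
by rewrite mulmxV ?mul1mx // det1_unit.
Qed.

(** With Z the first arrow and e = det Z / d, the element D_e^-1 Z D_d^-1 has determinant 1; acting
    at the middle vertex it carries (D_d, Z D_d^-1) to (D_e^-1 Z, D_e). *)
Lemma alpha_beta V d : d != 0 -> \det (V.2 ord0) != 0 -> alpha V d = beta V (\det (V.2 ord0) / d).
Proof.
move=> d0 D0; set D := \det _ in D0 *.
have e0 : D / d != 0 by rewrite mulf_neq0 // invr_eq0.
have uV : V.2 ord0 \in unitmx by rewrite unitmxE unitfE.
rewrite /alpha -(@put_inv1 _ _ V (corner p (D / d)^-1 *m V.2 ord0 *m corner p d^-1)); last first.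
  by rewrite /SLm !det_mulmx !det_corner // -/D; field; rewrite d0.
congr (f (put _ _ _)); first by rewrite -!mulmxA cornerVl // mulmx1.
rewrite !invmxM ?unitmx_mul ?corner_unit ?invr_eq0 ?uV // !corner_inv ?invr_eq0 // !invrK.
rewrite -!mulmxA [corner p d^-1 *m (corner p d *m _)]mulmxA cornerVl // mul1mx mulmxA.
by rewrite mulmxV // mul1mx.
Qed.

Lemma f_alpha V : \det (V.2 ord0) != 0 -> f V = alpha (merge V) (\det (V.2 ord0)).
Proof.
move=> D0; set D := \det _ in D0 *.
have uV : V.2 ord0 \in unitmx by rewrite unitmxE unitfE.
rewrite -{1}(put_merge V) -(@put_inv1 _ _ _ (corner p D *m invmx (V.2 ord0))); last first.
  by rewrite /SLm det_mulmx det_inv det_corner // divff.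
rewrite mulmxKV // invmxM ?corner_unit ?unitmx_inv // invmxK corner_inv // mulmxA.
by rewrite -merge0.
Qed.

Lemma alpha_laurent : laurent_family
  (fun g => (exists j a b, g = (fun V : Rep K p kh m.+1 => V.1 j a b)) \/
            (exists i a b, g = (fun V : Rep K p kh m.+1 => V.2 i a b))) alpha.
Proof.
apply: laurent_family_gen pf => g [] [[i hi] [a [b ->]]].
  by apply: laurent_const; apply: polyfun_arrow1.
case: i hi => [|[|i]] hi /=.
- case: (eqVneq a b) => [->|ne].
    case: (eqVneq (val b) 0%N) => [b0|b0].
      by apply: eq_laurent (@laurent_X _ _ _) _ => x z; rewrite !mxE eqxx b0 /= mulr1n.
    apply: eq_laurent (laurent_const (alg_const _ 1)) _ => x z.
    by rewrite !mxE eqxx (negbTE b0) mulr1n.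
  apply: eq_laurent (laurent_const (alg_const _ 0)) _ => x z.
  by rewrite !mxE (negbTE ne) mulr0n.
- case: (eqVneq (val b) 0%N) => [b0|b0].
    apply: (eq_laurent (laurent_V (@polyfun_arrow2 K p kh m.+1 ord0 a b))) => x z.
    by rewrite mul_mx_diag !mxE b0 eqxx.
  apply: (eq_laurent (laurent_const (@polyfun_arrow2 K p kh m.+1 ord0 a b))) => x z.
  by rewrite mul_mx_diag !mxE (negbTE b0) mulr1.
- by apply: laurent_const; apply: polyfun_arrow2.
Qed.

Lemma beta_laurent : laurent_family
  (fun g => (exists j a b, g = (fun V : Rep K p kh m.+1 => V.1 j a b)) \/
            (exists i a b, g = (fun V : Rep K p kh m.+1 => V.2 i a b))) beta.
Proof.
apply: laurent_family_gen pf => g [] [[i hi] [a [b ->]]].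
  by apply: laurent_const; apply: polyfun_arrow1.
case: i hi => [|[|i]] hi /=.
- case: (eqVneq (val a) 0%N) => [b0|b0].
    apply: (eq_laurent (laurent_V (@polyfun_arrow2 K p kh m.+1 ord0 a b))) => x z.
    by rewrite mul_diag_mx !mxE b0 eqxx mulrC.
  apply: (eq_laurent (laurent_const (@polyfun_arrow2 K p kh m.+1 ord0 a b))) => x z.
  by rewrite mul_diag_mx !mxE (negbTE b0) mul1r.
- case: (eqVneq a b) => [->|ne].
    case: (eqVneq (val b) 0%N) => [b0|b0].
      by apply: eq_laurent (@laurent_X _ _ _) _ => x z; rewrite !mxE eqxx b0 /= mulr1n.
    apply: eq_laurent (laurent_const (alg_const _ 1)) _ => x z.
    by rewrite !mxE eqxx (negbTE b0) mulr1n.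
  apply: eq_laurent (laurent_const (alg_const _ 0)) _ => x z.
  by rewrite !mxE (negbTE ne) mulr0n.
- by apply: laurent_const; apply: polyfun_arrow2.
Qed.

(* Comparing the Laurent expansions of [f] in [\det v_0] and in [\det v_1] for a
   fixed product [v_1 v_0] shows that no negative powers are needed. *)
Lemma merge_decomp : exists n (a b : nat -> Rep K p kh m.+1 -> K),
  [/\ forall i, polyfun (a i) /\ si_invariant GX GY (a i),
      forall i, polyfun (b i) /\ si_invariant GX GY (b i) &
      forall V, f V = \sum_(i < n.+1) \det (V.2 ord0) ^+ i * a i (merge V)
                + \sum_(i < n) \det (V.2 (lift ord0 ord0)) ^+ i.+1 * b i (merge V)].
Proof.
have [na Ha] := laurent_pad alpha_laurent; have [nb Hb] := laurent_pad beta_laurent.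
have [A [sA cA EA]] := Ha (na + nb)%N (leq_addr _ _).
have [B [sB cB EB]] := Hb (na + nb)%N (leq_addl _ _).
set n := (na + nb)%N in sA EA sB EB.
have invA gx gy V : Defs.in_group kh m.+1 GX GY gx gy -> A (rep_act gx gy V) = A V.
  by move=> hG; apply: (poly_eq_nonzero charK0) => z z0; rewrite -!EA // alpha_inv.
have invB gx gy V : Defs.in_group kh m.+1 GX GY gx gy -> B (rep_act gx gy V) = B V.
  by move=> hG; apply: (poly_eq_nonzero charK0) => z z0; rewrite -!EB // beta_inv.
(* Index n + i holds the coefficient of the i-th power. So [a] is the part of nonnegative exponent
   in det v_0 and [b] the part of positive exponent in det v_1. *)
exists n, (fun i V => (A V)`_(n + i)), (fun i V => (B V)`_(n + i.+1)); split.
- by move=> i; split; [apply: cA | move=> gx gy hG V; rewrite invA].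
- by move=> i; split; [apply: cB | move=> gx gy hG V; rewrite invB].
(* Substitute e = D/d in the expansion of [beta] and compare coefficients of d^-j: the negative part
   of one expansion is the positive part of the other, twisted by D^j. *)
have AB V : \det (V.2 ord0) != 0 -> forall j, (j <= n)%N ->
    (A V)`_(n - j) = (B V)`_(n + j) * \det (V.2 ord0) ^+ j.
  move=> D0 j le; set D := \det _ in D0 *.
  have /polyP/(_ (n - j)%N) : D ^+ n *: A V =
      \poly_(i < n.*2.+1) ((B V)`_(n.*2 - i) * D ^+ (n.*2 - i)).
    apply: (poly_eq_nonzero charK0) => z z0; rewrite hornerZ -EA // alpha_beta // -/D.
    have e0 : D / z != 0 by rewrite mulf_neq0 // invr_eq0.
    have -> : D ^+ n * (beta V (D / z) * z ^+ n) = beta V (D / z) * (D / z) ^+ n * z ^+ n.*2.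
      rewrite expr_div_n -addnn exprD; field; exact: expf_neq0.
    rewrite EB // (horner_coef_wide _ (sB V)) mulr_suml horner_poly.
    rewrite (reindex_inj rev_ord_inj) /=; apply: eq_bigr => i _.
    have hi : (i <= n.*2)%N by rewrite -ltnS.
    have -> : z ^+ n.*2 = z ^+ (n.*2 - i) * z ^+ i by rewrite -exprD subnK.
    by rewrite subSS expr_div_n; field; apply: expf_neq0.
  rewrite coefZ coef_poly ifT; last lia.
  have -> : (n.*2 - (n - j) = n + j)%N by lia.
  by rewrite exprD mulrCA => /(mulfI (expf_neq0 n D0)).
pose d (V : Rep K p kh m.+2) := \det (V.2 ord0) * \det (V.2 (lift ord0 ord0)).
have hdet i : polyfun (fun V : Rep K p kh m.+2 => \det (V.2 i)).
  by apply: gen_alg_det => a b; apply: polyfun_arrow2.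
have hmerge g : polyfun g -> polyfun (fun V : Rep K p kh m.+2 => g (merge V)).
  apply: gen_alg_comp => _ [] [i [a [b ->]]] /=; first exact: polyfun_arrow1.
  case: (i == ord0); last exact: polyfun_arrow2.
  by apply: gen_alg_mulmx => ? ?; apply: polyfun_arrow2.
apply: (@eq_dense _ charK0 _ _ d _ _ (fun=> 1%:M, fun=> 1%:M) (@rep_joinable _ _ _ _)) => //.
- exact: (alg_mul (hdet _) (hdet _)).
- apply: alg_add; apply: gen_alg_sum => i; apply: alg_mul.
  + exact: gen_algX (hdet _).
  + exact: (hmerge _ (cA (n + i)%N)).
  + exact: gen_algX (hdet _).
  + exact: (hmerge _ (cB (n + i.+1)%N)).
- by rewrite /d /= det1 mulr1 oner_neq0.
move=> V; rewrite /d mulf_eq0 negb_or => /andP[d0 d1].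
rewrite f_alpha //; set x := \det _ in d0 *; set y := \det _ in d1 *.
have Dxy : \det ((merge V).2 ord0) = x * y by rewrite merge0 det_mulmx mulrC.
apply: (mulIf (expf_neq0 n d0)); rewrite EA // (horner_coef_wide _ (sA _)).
rewrite -addnn -addnS big_split_ord /= addrC mulrDl; congr (_ + _).
  by rewrite mulr_suml; apply: eq_bigr => i _; rewrite exprD; ring.
(* Here x^-j D^j = y^j because D = x y: negative powers of det v_0 turn into positive powers of det
   v_1. *)
rewrite mulr_suml (reindex_inj rev_ord_inj) /=; apply: eq_bigr => i _.
have -> : x ^+ n = x ^+ (n - i.+1) * x ^+ i.+1 by rewrite -exprD subnK.
by rewrite AB ?Dxy ?mulf_neq0 // exprMn; ring.
Qed.

End Merge.

Section Reduction.
Variables (K : fieldType) (p : nat).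
Hypotheses (charK0 : [pchar K] =i pred0) (hp : (0 < p)%N).

(** The third family sees only the two path products, which do not change when consecutive arrows
    are merged; it can therefore stay abstract during the reduction. Its index is unbounded:
    coefficients beyond the degree are 0 in the instances. *)
Definition path_gens (C : nat -> 'M[K]_p -> 'M[K]_p -> K) kh lh (f : Rep K p kh lh -> K) : Prop :=
  (exists j : 'I_kh, f = (fun V => \det (V.1 j))) \/
  (exists i : 'I_lh, f = (fun V => \det (V.2 i))) \/
  (exists i, f = (fun V => C i (pathmx V.1) (pathmx V.2))).

Definition si_generated GX GY C kh lh := forall f : Rep K p kh lh -> K,
  polyfun f -> si_invariant GX GY f -> gen_alg (path_gens C (kh := kh) (lh := lh)) f.

Lemma generated_lh GX GY C kh :
  GX 1%:M -> GY 1%:M -> (forall h, GX h -> \det h = 1) ->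
  si_generated GX GY C kh 1 -> forall lh, si_generated GX GY C kh lh.+1.
Proof.
move=> GX1 GY1 detGX H1; elim=> [|m IH] // f pf invf.
have [n [a [b [ha hb E]]]] := merge_decomp charK0 hp GX1 GY1 detGX pf invf.
have hd i : gen_alg (path_gens C (kh := kh) (lh := m.+2)) (fun V => \det (V.2 i)).
  by apply: alg_gen; right; left; exists i.
have hm g : gen_alg (path_gens C (kh := kh) (lh := m.+1)) g ->
    gen_alg (path_gens C (kh := kh) (lh := m.+2)) (fun V => g (merge V)).
  apply: gen_alg_comp => _ [[j ->]|[[i ->]|[i ->]]] /=.
  - by apply: alg_gen; left; exists j.
  - case: (i == ord0); last exact: hd.
    by apply: gen_alg_ext (alg_mul (hd _) (hd _)) _ => V; rewrite det_mulmx.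
  - apply: alg_gen; right; right; exists i; apply: functional_extensionality => V.
    by rewrite (pathmx_merge V).
apply: gen_alg_ext E.
apply: alg_add; apply: gen_alg_sum => i; apply: alg_mul; try exact: gen_algX;
  apply: hm; apply: IH; [exact: (ha _).1|exact: (ha _).2|exact: (hb _).1|exact: (hb _).2].
Qed.

Definition swap kh lh (V : Rep K p kh lh) : Rep K p lh kh := (V.2, V.1).

Lemma swap_inv GX GY kh lh f : (0 < lh)%N -> (0 < kh)%N ->
  si_invariant GX GY f -> @si_invariant K p lh kh GY GX (fun V => f (swap V)).
Proof.
move=> lh0 kh0 hf gx gy [h1 [h2 [h3 h4]]] V.
rewrite -(hf (gY gx gy) gx _ (swap V)); last first.
  split; first by move=> [|i] hi; rewrite /gY /=; [apply: h1|apply: h2].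
  split; first by move=> j /andP[_ hj]; apply: h1.
  by split=> //; rewrite /gY; case: (lh) lh0 h4.
congr f; congr pair; apply: functional_extensionality => -[[|i] hi] //.
Qed.

Lemma generated_swap GX GY C kh lh : (0 < lh)%N -> (0 < kh)%N ->
  si_generated GX GY C kh lh -> si_generated GY GX (fun i U W => C i W U) lh kh.
Proof.
move=> lh0 kh0 H f pf invf.
have := H (fun V => f (swap V)) _ (swap_inv kh0 lh0 invf).
move=> H'; have {}H' : gen_alg (path_gens C (kh := kh) (lh := lh)) (fun V => f (swap V)).
  apply: H'; move: pf; apply: gen_alg_comp => _ [] [i [a [b ->]]].
    exact: polyfun_arrow2.
  exact: polyfun_arrow1.
apply: (@gen_alg_ext _ _ _ (fun V => f (swap (swap V)))); last by move=> [].
move: H'; apply: (@gen_alg_comp _ _ _ _ _ (@swap lh kh)) => _ [[j ->]|[[i ->]|[i ->]]].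
- by apply: alg_gen; right; left; exists j.
- by apply: alg_gen; left; exists i.
- by apply: alg_gen; right; right; exists i.
Qed.

(** The reduction shortens the v side only; the u side is reached by exchanging the two sides. *)
Lemma generated_all GX GY C :
  GX 1%:M -> GY 1%:M -> (forall h, GX h -> \det h = 1) -> (forall h, GY h -> \det h = 1) ->
  si_generated GX GY C 1 1 -> forall kh lh, si_generated GX GY C kh.+1 lh.+1.
Proof.
move=> GX1 GY1 detGX detGY H kh lh; apply: generated_lh => //.
apply: (@generated_swap GY GX (fun i U W => C i W U) 1 kh.+1) => //.
by apply: generated_lh => //; apply: generated_swap.
Qed.

End Reduction.

(** * Invariant polynomials on the slice *)

Section Slice.
Variable K : fieldType.
Hypothesis charK0 : [pchar K] =i pred0.

(** Infinite sequences instead of tuples of length q, so that the induction on q involves no change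
    of type. *)
Definition coords : Type := ((nat -> K) * (nat -> K))%type.
Implicit Types (x : coords) (F H : coords -> K).

(* Only the first [q] entries of the two sequences are coordinates. *)
Definition xcoord q (g : coords -> K) :=
  exists2 i, (i < q)%N & g = (fun x => x.1 i) \/ g = (fun x => x.2 i).

Definition upd (r : nat -> K) i c : nat -> K := fun j => if j == i then c else r j.
Definition transp (i j k : nat) : nat := if k == i then j else if k == j then i else k.
Definition permx i j x : coords := (fun k => x.1 (transp i j k), fun k => x.2 (transp i j k)).
Definition scale (tau : nat -> K) x : coords := (fun i => tau i * x.1 i, fun i => tau i * x.2 i).
Definition flip i x : coords := (upd x.1 i (- x.1 i), x.2).
Definition swapx x : coords := (x.2, x.1).
Definition polymap q q' (phi : coords -> coords) :=
  forall g, xcoord q g -> gen_alg (xcoord q') (fun x => g (phi x)).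

Lemma eq_coords x (y : coords) : (forall i, x.1 i = y.1 i) -> (forall i, x.2 i = y.2 i) -> x = y.
Proof.
case: x y => [a b] [c d] /= h1 h2.
by congr pair; apply: functional_extensionality.
Qed.

Lemma coord1 q i : (i < q)%N -> gen_alg (xcoord q) (fun x => x.1 i).
Proof. by move=> hi; apply: alg_gen; exists i => //; left. Qed.

Lemma coord2 q i : (i < q)%N -> gen_alg (xcoord q) (fun x => x.2 i).
Proof. by move=> hi; apply: alg_gen; exists i => //; right. Qed.

Lemma polymap_comp q q' phi F :
  polymap q q' phi -> gen_alg (xcoord q) F -> gen_alg (xcoord q') (fun x => F (phi x)).
Proof. by move=> h; apply: (gen_alg_comp h). Qed.

Lemma polymap_permx q i j : (i < q)%N -> (j < q)%N -> polymap q q (permx i j).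
Proof.
move=> hi hj _ [k hk [] ->] /=; rewrite /transp; [apply: coord1|apply: coord2];
by case: ifP => // _; case: ifP.
Qed.

Lemma polymap_scale q tau : polymap q q (scale tau).
Proof.
by move=> _ [k hk [] ->] /=; apply: gen_algZ; [apply: coord1|apply: coord2].
Qed.

Lemma polymap_flip q i : polymap q q (flip i).
Proof.
move=> _ [k hk [] ->] /=; last exact: coord2.
rewrite /upd; case: eqP => [<-|_]; last exact: coord1.
by apply: gen_alg_ext (gen_algZ (-1) (coord1 hk)) _ => x; rewrite mulN1r.
Qed.

Lemma polymap_swapx q : polymap q q swapx.
Proof. by move=> _ [k hk [] ->] /=; [apply: coord2|apply: coord1]. Qed.

Definition line x (y : coords) z : coords :=
  (fun i => x.1 i + z * (y.1 i - x.1 i), fun i => x.2 i + z * (y.2 i - x.2 i)).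

Lemma line_curve q x y : polycurve (xcoord q) (line x y).
Proof.
move=> _ [i hi [] ->] /=.
  exists ((x.1 i)%:P + (y.1 i - x.1 i) *: 'X) => z.
  by rewrite hornerD hornerC hornerZ hornerX mulrC.
exists ((x.2 i)%:P + (y.2 i - x.2 i) *: 'X) => z.
by rewrite hornerD hornerC hornerZ hornerX mulrC.
Qed.

Lemma line0 x y : line x y 0 = x.
Proof. by apply: eq_coords => i /=; rewrite mul0r addr0. Qed.

Lemma line1 x y : line x y 1 = y.
Proof. by apply: eq_coords => i /=; rewrite mul1r addrC subrK. Qed.

Lemma coord_joinable q : joinable (xcoord q).
Proof.
by move=> x y; exists (line x y); split; [apply: line_curve|apply: line0|apply: line1].
Qed.

Lemma prod_transp (R : comPzRingType) q (f : nat -> R) i j : (i < q)%N -> (j < q)%N ->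
  \prod_(k < q) f (transp i j k) = \prod_(k < q) f k.
Proof.
move=> hi hj; rewrite [RHS](reindex_inj (@perm_inj _ (tperm (Ordinal hi) (Ordinal hj)))) /=.
apply: eq_bigr => k _; congr f; rewrite /transp permE /=.
by rewrite -!val_eqE /=; case: ifP => // _; case: ifP.
Qed.

Definition prod1 q x := \prod_(i < q) x.1 i.

Lemma gen_prod1 q : gen_alg (xcoord q) (prod1 q).
Proof. by apply: gen_alg_prod => i; apply: coord1. Qed.

Lemma prod1_permx q i j x : (i < q)%N -> (j < q)%N -> prod1 q (permx i j x) = prod1 q x.
Proof. exact: prod_transp. Qed.

Lemma prod1_scale q tau x : prod1 q (scale tau x) = \prod_(i < q) tau i * prod1 q x.
Proof. by rewrite -big_split. Qed.

Lemma prod1_flip q i x : (i < q)%N -> prod1 q (flip i x) = - prod1 q x.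
Proof.
move=> hi; rewrite /prod1 (bigD1 (Ordinal hi)) //= [in RHS](bigD1 (Ordinal hi)) //=.
rewrite /upd eqxx mulNr; congr (- (_ * _)); apply: eq_bigr => k.
by rewrite -val_eqE /= => /negbTE ->.
Qed.

(** The factor theorem. By induction on the generation, F x = F (zero x) + x.1 i * F' x, where
    [zero] replaces x.1 i by 0. *)
Lemma divide_coord q F i : gen_alg (xcoord q) F -> (i < q)%N ->
  (forall x, x.1 i = 0 -> F x = 0) ->
  exists2 F', gen_alg (xcoord q) F' & forall x, F x = x.1 i * F' x.
Proof.
move=> hF hi hv; pose zero x : coords := (upd x.1 i 0, x.2).
have hz : polymap q q zero.
  move=> _ [k hk [] ->] /=; last exact: coord2.
  by rewrite /upd; case: eqP => _; [apply: alg_const|apply: coord1].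
suff [F' hF' E] : exists2 F', gen_alg (xcoord q) F' & forall x, F x = F (zero x) + x.1 i * F' x.
  by exists F' => // x; rewrite {1}E hv ?add0r //= /upd eqxx.
elim: {hv} hF => [c|g [k hk [] ->]|f g hf [f' hf' Ef] hg [g' hg' Eg]
   |f g hf [f' hf' Ef] hg [g' hg' Eg]].
- by exists (fun=> 0) => [|x]; [apply: alg_const|rewrite mulr0 addr0].
- exists (fun=> (k == i)%:R) => [|x]; first exact: alg_const.
  by rewrite /= /upd; case: eqP => [->|_]; rewrite ?mulr1 ?add0r ?mulr0 ?addr0.
- by exists (fun=> 0) => [|x]; [apply: alg_const|rewrite mulr0 addr0].
- by exists (fun x => f' x + g' x) => [|x]; [apply: alg_add|rewrite Ef Eg; ring].
- exists (fun x => f' x * g x + f (zero x) * g' x) => [|x].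
    by apply: alg_add; apply: alg_mul => //; apply: polymap_comp hz hf.
  by rewrite (Ef x) (Eg x); ring.
Qed.

Lemma divide_prod1 q F : gen_alg (xcoord q) F ->
  (forall i x, (i < q)%N -> x.1 i = 0 -> F x = 0) ->
  exists2 F', gen_alg (xcoord q) F' & forall x, F x = prod1 q x * F' x.
Proof.
move=> hF hv; suff H k : (k <= q)%N ->
    exists2 F', gen_alg (xcoord q) F' & forall x, F x = prod1 k x * F' x by exact: H.
elim: k => [_|k IH hk].
  by exists F => // x; rewrite /prod1 big_ord0 mul1r.
have [F1 hF1 E1] := IH (ltnW hk).
have hk1 : gen_alg (xcoord q) (prod1 k).
  by apply: gen_alg_prod => i; apply: coord1; apply: ltn_trans hk.
have [F2 hF2 E2] : exists2 F', gen_alg (xcoord q) F' & forall x, F1 x = x.1 k * F' x.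
  apply: divide_coord => // x xk.
  (* The line from x to y stays in the hyperplane x.1 k = 0, and at y the first k coordinates are 1.
     So [prod1 k] is not identically 0 on this line and can be cancelled. *)
  pose y : coords := (upd (fun=> 1) k 0, x.2).
  rewrite -(line0 x y).
  apply: (@eq_on_curve _ charK0 _ _ _ (prod1 k) F1 (fun=> 0) 1 0 (@line_curve q x y)) => //.
  - exact: alg_const.
  - rewrite line1 /prod1 big1 ?oner_neq0 // => i _ /=.
    by rewrite /upd ltn_eqF // ltn_ord.
  - move=> z; set u := line x y z => p0.
    have : F u = 0 by apply: (hv k) => //=; rewrite xk /upd eqxx subrr mulr0 addr0.
    by rewrite E1 => /eqP; rewrite mulf_eq0 (negbTE p0) => /eqP.
exists F2 => // x; rewrite E1 E2 /prod1 big_ord_recr /=; ring.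
Qed.

(** Transformation rules of F and of the divisor [pi] pass to the quotient, since [pi] can be
    cancelled on a dense set. *)
Lemma quot_equivariant q pi F F' phi a b x0 :
  gen_alg (xcoord q) pi -> gen_alg (xcoord q) F' -> pi x0 != 0 ->
  (forall x, F x = pi x * F' x) -> polymap q q phi -> a != 0 ->
  (forall x, pi (phi x) = a * pi x) -> (forall x, F (phi x) = a * b * F x) ->
  forall x, F' (phi x) = b * F' x.
Proof.
move=> hpi hF' x00 E hphi a0 Hpi HF.
apply: (@eq_dense _ charK0 _ _ pi _ _ x0 (@coord_joinable q)) => //.
- exact: polymap_comp hphi hF'.
- exact: gen_algZ.
move=> x px; have := HF x; rewrite !E Hpi => e.
by apply: (mulfI (mulf_neq0 a0 px)); rewrite e; ring.
Qed.

(** As tau is arbitrary, for a polynomial in the first q pairs this is homogeneity of degree N in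
    each pair separately. *)
Definition weight q N F := forall tau, (forall i, tau i != 0) -> forall x,
  F (scale tau x) = (\prod_(i < q) tau i) ^+ N * F x.
Definition symmetric_coords q F := forall i j, (i < q)%N -> (j < q)%N -> forall x, F (permx i j x) = F x.
Definition even_coords q F := forall i, (i < q)%N -> forall x, F (flip i x) = F x.

(** Along z -> z x the function is a polynomial in z that is constant for nonzero z, so it equals
    its value at z = 0. *)
Lemma weight0_const q F : gen_alg (xcoord q) F -> weight q 0 F ->
  forall x, F x = F (fun=> 0, fun=> 0).
Proof.
move=> hF hw x; have hc : polycurve (xcoord q) (fun z => scale (fun=> z) x).
  move=> _ [i hi [] ->] /=.
    by exists (x.1 i *: 'X) => z; rewrite hornerZ hornerX mulrC.
  by exists (x.2 i *: 'X) => z; rewrite hornerZ hornerX mulrC.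
have [Q E] := polycurve_gen hc hF.
have EQ : Q = (F x)%:P.
  apply: (poly_eq_nonzero charK0) => z z0.
  by rewrite -E hw // expr0 mul1r hornerC.
have := E 0; rewrite EQ hornerC => <-; congr F.
by apply: eq_coords => i /=; rewrite mul0r.
Qed.

(** At x.1 = 1 these are the elementary symmetric functions of the x.2 k ^+ e; the entries x.1 k
    make them homogeneous of degree e in every pair. *)
Definition esym_coef e q x i : K := (\prod_(k < q) ((x.1 k ^+ e)%:P + (x.2 k ^+ e) *: 'X))`_i.

Lemma esym_permx e q i j x : (i < q)%N -> (j < q)%N ->
  esym_coef e q (permx i j x) = esym_coef e q x.
Proof.
move=> hi hj; apply: functional_extensionality => k; rewrite /esym_coef.
by rewrite (@prod_transp _ q (fun k => (x.1 k ^+ e)%:P + (x.2 k ^+ e) *: 'X)).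
Qed.

Lemma esym_scale e q tau x i :
  esym_coef e q (scale tau x) i = (\prod_(k < q) tau k) ^+ e * esym_coef e q x i.
Proof.
rewrite /esym_coef -coefCM -prodrXl rmorph_prod -big_split; congr (nth _ (polyseq _) _).
by apply: eq_bigr => k _ /=; rewrite !exprMn mulrDr -polyCM -mul_polyC -[in RHS]mul_polyC polyCM; ring.
Qed.

Lemma esym_flip q i x : esym_coef 2 q (flip i x) = esym_coef 2 q x.
Proof.
apply: functional_extensionality => k; congr (nth _ (polyseq _) _).
by apply: eq_bigr => j _ /=; rewrite /upd; case: eqP => [->|//]; rewrite sqrrN.
Qed.

Lemma gen_esym e q i : gen_alg (xcoord q) (fun x => esym_coef e q x i).
Proof.
suff: coefs_in (xcoord q) (fun x => \prod_(k < q) ((x.1 k ^+ e)%:P + (x.2 k ^+ e) *: 'X)) by exact.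
suff H m : (m <= q)%N ->
    coefs_in (xcoord q) (fun x => \prod_(k < m) ((x.1 k ^+ e)%:P + (x.2 k ^+ e) *: 'X)) by exact: H.
elim: m => [_|m IH hm] j.
  by apply: gen_alg_ext (alg_const _ ((1 : {poly K})`_j)) _ => x; rewrite big_ord0.
apply: (@gen_alg_ext _ _ _ (fun x => ((\prod_(k < m) ((x.1 k ^+ e)%:P + (x.2 k ^+ e) *: 'X))
  * ((x.1 m ^+ e)%:P + (x.2 m ^+ e) *: 'X))`_j)); last by move=> x; rewrite big_ord_recr.
apply: coefs_inM j; first exact: IH (ltnW hm).
move=> [|[|j]].
- by apply: gen_alg_ext (gen_algX e (coord1 hm)) _ => x; rewrite coefD coefZ coefX coefC mulr0 addr0.
- by apply: gen_alg_ext (gen_algX e (coord2 hm)) _ => x; rewrite coefD coefZ coefX coefC mulr1 add0r.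
- by apply: gen_alg_ext (alg_const _ 0) _ => x; rewrite coefD coefZ coefX coefC mulr0 add0r.
Qed.

Lemma esym_coef0 e q x : esym_coef e q x 0 = prod1 q x ^+ e.
Proof.
rewrite /esym_coef coef0_prod -prodrXl; apply: eq_bigr => k _.
by rewrite coefD coefC coefZ coefX mulr0 addr0.
Qed.

(** On the hyperplane x.1 q = 0 the last factor is a multiple of 'X, which shifts the coefficients
    for q pairs by one. This drives the induction on q. *)
Lemma esym_last0 e q x i : x.1 q = 0 ->
  esym_coef e.+1 q.+1 x i.+1 = x.2 q ^+ e.+1 * esym_coef e.+1 q x i.
Proof.
move=> x0; rewrite /esym_coef big_ord_recr /= x0 expr0n /= add0r.
by rewrite -scalerAr coefZ coefMX.
Qed.

Definition nat_coord (g : (nat -> K) -> K) := exists i, g = fun y : nat -> K => y i.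

Lemma gen_nat_comp q (c : coords -> nat -> K) G :
  (forall i, gen_alg (xcoord q) (fun x => c x i)) -> gen_alg nat_coord G ->
  gen_alg (xcoord q) (fun x => G (c x)).
Proof. by move=> hc; apply: gen_alg_comp => _ [i ->]; apply: hc. Qed.

(** The exponent e is [b.+1]. Homogeneity of G is carried along because the induction on q
    multiplies all arguments of G by x.2 q ^+ e. *)
Definition homogeneous_in (b : bool) q N F :=
  exists G, [/\ gen_alg nat_coord G,
     forall z (y : nat -> K), G (fun i => z * y i) = z ^+ N * G y &
     forall x, F x = G (esym_coef b.+1 q x)].

Definition admissible (b : bool) q N F := [/\ gen_alg (xcoord q) F, weight q (b.+1 * N) F,
  symmetric_coords q F & b -> even_coords q F].

(** Setting x.1 q = 0 and x.2 q = 1 leaves an admissible function of q pairs, hence a G in their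
    coefficients. Evaluating G at the shifted coefficients of q + 1 pairs lifts it back: the lift
    agrees with F on x.1 q = 0 by homogeneity and on the other hyperplanes by symmetry. *)
Lemma last_coord_step (b : bool) q N F : (forall F, admissible b q N F -> homogeneous_in b q N F) ->
  admissible b q.+1 N F ->
  exists G, [/\ gen_alg nat_coord G, forall z (y : nat -> K), G (fun i => z * y i) = z ^+ N * G y,
    admissible b q.+1 N (fun x => F x - G (fun i => esym_coef b.+1 q.+1 x i.+1)) &
    forall i x, (i < q.+1)%N -> x.1 i = 0 -> F x = G (fun i => esym_coef b.+1 q.+1 x i.+1)].
Proof.
move=> IH [hF wF sF eF].
pose res x : coords := (upd x.1 q 0, upd x.2 q 1).
have resP : polymap q.+1 q res.
  move=> _ [k hk [] ->] /=; rewrite /upd; case: eqP => [_|/eqP ne]; try exact: alg_const.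
    by apply: coord1; rewrite ltn_neqAle ne.
  by apply: coord2; rewrite ltn_neqAle ne.
have [|G [hG homG EG]] := IH (fun x => F (res x)).
  split; first exact: polymap_comp resP hF.
  - move=> tau t0 x; have t1 i : upd tau q 1 i != 0.
      by rewrite /upd; case: ifP => _; rewrite ?oner_neq0 ?t0.
    have := wF _ t1 (res x); rewrite big_ord_recr /= {3}/upd eqxx mulr1.
    under eq_bigr => i _ do rewrite /upd (ltn_eqF (ltn_ord i)).
    move=> <-; congr F; apply: eq_coords => i /=; rewrite /upd.
      by case: eqP => //; rewrite mulr0.
    by case: eqP => //; rewrite mulr1.
  - move=> i j hi hj x; rewrite -(sF i j (ltnW hi) (ltnW hj) (res x)); congr F.
    have tq k : (transp i j k == q) = (k == q).
      rewrite /transp; case: (eqVneq k i) => [->|_]; first by rewrite !ltn_eqF.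
      by case: (eqVneq k j) => [->|//]; rewrite !ltn_eqF.
    by apply: eq_coords => k /=; rewrite /upd tq.
  - move=> hb i hi x; rewrite -(eF hb i (ltnW hi) (res x)); congr F.
    apply: eq_coords => // k /=; rewrite /upd.
    by case: (eqVneq k i) => [->|_] //; rewrite (ltn_eqF hi).
have hGc : gen_alg (xcoord q.+1) (fun x => G (fun i => esym_coef b.+1 q.+1 x i.+1)).
  by apply: gen_nat_comp hG => i; apply: gen_esym.
have sG i j x : (i < q.+1)%N -> (j < q.+1)%N -> G (fun k => esym_coef b.+1 q.+1 (permx i j x) k.+1)
    = G (fun k => esym_coef b.+1 q.+1 x k.+1).
  by move=> hi hj; rewrite esym_permx.
have vq x : x.1 q = 0 -> F x = G (fun i => esym_coef b.+1 q.+1 x i.+1).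
  move=> xq; rewrite -(line0 x (x.1, upd x.2 q 1)).
  apply: (@eq_on_curve _ charK0 _ _ _ (fun x => x.2 q) F
    (fun x => G (fun i => esym_coef b.+1 q.+1 x i.+1)) 1 0 (@line_curve q.+1 _ _)) => //.
  - exact: coord2.
  - by rewrite line1 /= /upd eqxx oner_neq0.
  move=> z; set u := line _ _ z => u2; have u1 : u.1 q = 0 by rewrite /= xq subrr mulr0 addr0.
  move: u u1 u2 => u u1 u2.
  have -> : (fun i => esym_coef b.+1 q.+1 u i.+1) =
            (fun i => u.2 q ^+ b.+1 * esym_coef b.+1 q u i).
    by apply: functional_extensionality => i; rewrite esym_last0.
  rewrite homG -exprM.
  (* On this hyperplane, where x.2 q is nonzero, u arises from [res u] by scaling the last pair
     alone. *)
  have Eu : u = scale (upd (fun=> 1) q (u.2 q)) (res u).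
    apply: eq_coords => i; rewrite [RHS]/= /upd.
      by case: eqP => [->|_]; rewrite ?mul1r ?mulr0.
    by case: eqP => [->|_]; rewrite ?mul1r ?mulr1.
  rewrite [F u](congr1 F Eu) wF => [|i]; last by rewrite /upd; case: ifP => _; rewrite ?oner_neq0.
  rewrite big_ord_recr /= {2}/upd eqxx big1 ?mul1r => [|i _]; last by rewrite /upd (ltn_eqF (ltn_ord i)).
  by rewrite EG.
exists G; split=> //; last first.
  move=> i x hi xi; rewrite -(sF i q) // -(sG i q) //; apply: vq => /=.
  by rewrite /transp; case: eqP => [->|_]; rewrite ?eqxx.
split; first exact: gen_algB.
- move=> tau t0 x; rewrite wF // mulrBr; congr (_ - _).
  rewrite exprM -homG; congr G; apply: functional_extensionality => i.
  by rewrite esym_scale.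
- by move=> i j hi hj x; rewrite sF // sG.
- move=> hb i hi x; rewrite eF //; congr (_ - G _).
  by case: (b) hb => // _; rewrite esym_flip.
Qed.

Lemma two_neq0 : (2 : K) != 0.
Proof. by rewrite (pcharf0P K).1. Qed.

Lemma eqN0 (a : K) : a = - a -> a = 0.
Proof.
move=> e; have /eqP : 2 * a = 0 by rewrite mulr2n mulrDl mul1r {1}e addNr.
by rewrite mulf_eq0 (negbTE two_neq0) => /eqP.
Qed.

Lemma flip_id i x : x.1 i = 0 -> flip i x = x.
Proof.
by move=> xi; apply: eq_coords => j //=; rewrite /upd; case: eqP => // ->; rewrite xi oppr0.
Qed.

Lemma prod1_point q : prod1 q (fun=> 1, fun=> 1) != 0.
Proof. by rewrite /prod1 big1 ?oner_neq0. Qed.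

Lemma quot1_symmetric q F F' : gen_alg (xcoord q) F' -> (forall x, F x = prod1 q x * F' x) ->
  symmetric_coords q F -> symmetric_coords q F'.
Proof.
move=> hF' E sF i j hi hj x.
rewrite (@quot_equivariant q (prod1 q) F F' (permx i j) 1 1 _ (gen_prod1 q) hF' (prod1_point q) E) ?mul1r ?oner_neq0 //.
- exact: polymap_permx.
- by move=> y; rewrite prod1_permx // mul1r.
- by move=> y; rewrite sF // !mul1r.
Qed.

Lemma quot1_flip q F F' s : gen_alg (xcoord q) F' -> (forall x, F x = prod1 q x * F' x) ->
  (forall i x, (i < q)%N -> F (flip i x) = - s * F x) ->
  forall i x, (i < q)%N -> F' (flip i x) = s * F' x.
Proof.
move=> hF' E sF i x hi.
rewrite (@quot_equivariant q (prod1 q) F F' (flip i) (-1) s _ (gen_prod1 q) hF' (prod1_point q) E) ?oppr_eq0 ?oner_neq0 //.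
- exact: polymap_flip.
- by move=> y; rewrite prod1_flip // mulN1r.
- by move=> y; rewrite sF // mulN1r.
Qed.

Lemma quot1_weight q F F' N : gen_alg (xcoord q) F' -> (forall x, F x = prod1 q x * F' x) ->
  weight q N.+1 F -> weight q N F'.
Proof.
move=> hF' E wF tau t0 x.
have T0 : \prod_(i < q) tau i != 0 by apply/prodf_neq0 => i _.
rewrite (@quot_equivariant q (prod1 q) F F' (scale tau) (\prod_(i < q) tau i) ((\prod_(i < q) tau i) ^+ N) _ (gen_prod1 q) hF' (prod1_point q) E) //.
- exact: polymap_scale.
- by move=> y; rewrite prod1_scale.
- by move=> y; rewrite wF // exprS.
Qed.

(* The fundamental theorem of symmetric functions in multihomogeneous form.
   With [b = true] the variables [x.1 i] occur only through their squares. *)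
Lemma symmetric_generated (b : bool) q N F : admissible b q N F -> homogeneous_in b q N F.
Proof.
elim: q N F => [|q IHq] N F.
  move=> [hF _ _ _]; have E x : F x = F (fun=> 0, fun=> 0).
    by apply: (gen_alg_invariant _ hF) => g [].
  (* The empty product is 1, so y 0 = 1 here; the power of y 0 only gives G the right degree. *)
  exists (fun y => F (fun=> 0, fun=> 0) * y 0%N ^+ N); split=> [|z y|x].
  - by apply: gen_algZ; apply: gen_algX; apply: alg_gen; exists 0%N.
  - by rewrite exprMn mulrCA.
  - by rewrite esym_coef0 /prod1 big_ord0 !expr1n mulr1.
elim: N F => [|N IHN] F aF; have [G [hG homG aH vH]] := last_coord_step (IHq _) aF;
  have shG : gen_alg nat_coord (fun y => G (fun i => y i.+1))
    by apply: (gen_alg_comp (phi := fun y i => y i.+1) _ hG) => _ [i ->]; apply: alg_gen; exists i.+1.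
  exists (fun y => G (fun i => y i.+1)); split=> // x.
  apply/eqP; rewrite -subr_eq0; apply/eqP.
  (* In weight 0 the difference is constant, and it vanishes at the origin. *)
  case: aH => hH wH _ _; rewrite muln0 in wH.
  by rewrite (weight0_const hH wH) (vH 0%N) // subrr.
set H := (fun x => _ - _) in aH.
have [hH wH sH eH] := aH.
have vH' i x : (i < q.+1)%N -> x.1 i = 0 -> H x = 0.
  by move=> hi xi; rewrite /H (vH i) // subrr.
have [H1 hH1 E1] := divide_prod1 hH vH'.
have sH1 := quot1_symmetric hH1 E1 sH.
(* For e = 2 the quotient of an even function by the product is odd in each x.1 i, so it vanishes on
   the hyperplanes again and a second factor splits off. In both cases the weight drops from e (N +
   1) to e N. *)
have [H2 [aH2 E2]] : exists H2, admissible b q.+1 N H2 /\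
    forall x, H x = prod1 q.+1 x ^+ b.+1 * H2 x.
  case: (b) wH eH => [wH eH|wH _]; last first.
    exists H1; split=> [|x]; last by rewrite E1 expr1.
    by split=> //; rewrite mul1n; rewrite mul1n in wH; apply: quot1_weight wH.
  have fH1 : forall i x, (i < q.+1)%N -> H1 (flip i x) = -1 * H1 x.
    by apply: quot1_flip hH1 E1 _ => i x hi; rewrite eH // opprK mul1r.
  have vH1 i x : (i < q.+1)%N -> x.1 i = 0 -> H1 x = 0.
    by move=> hi xi; apply: eqN0; rewrite -{1}(flip_id xi) fH1 // mulN1r.
  have [H2 hH2 E2] := divide_prod1 hH1 vH1.
  exists H2; split=> [|x]; last by rewrite E1 E2 expr2 mulrA.
  split=> //; last 2 first.
  - exact: quot1_symmetric hH2 E2 sH1.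
  - have fH1' i x : (i < q.+1)%N -> H1 (flip i x) = - 1 * H1 x by exact: fH1.
    by move=> _ i hi x; rewrite (quot1_flip hH2 E2 fH1') ?mul1r.
  rewrite mulnS in wH; apply: quot1_weight hH2 E2 _; exact: quot1_weight hH1 E1 wH.
have [G2 [hG2 homG2 EG2]] := IHN _ aH2.
exists (fun y => G (fun i => y i.+1) + y 0%N * G2 y); split=> [|z y|x].
- by apply: alg_add => //; apply: alg_mul => //; apply: alg_gen; exists 0%N.
- by rewrite homG homG2 exprS; ring.
- by rewrite esym_coef0 -EG2 -E2 /H addrC subrK.
Qed.

(** By invariance under scalings of product 1, F (scale tau x) depends on tau only through the
    product T and equals its value for the scaling (T, 1, ..., 1). This is a polynomial in T, whose
    coefficients are the components [FN]. The last clause passes to them every symmetry of F that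
    normalises the scalings and preserves the product. *)
Lemma weight_decomposition q F : gen_alg (xcoord q.+1) F ->
  (forall tau : nat -> K, (forall i, tau i != 0) -> \prod_(i < q.+1) tau i = 1 -> forall x, F (scale tau x) = F x) ->
  exists n (FN : nat -> coords -> K),
   [/\ forall N, gen_alg (xcoord q.+1) (FN N), forall N, weight q.+1 N (FN N),
      forall x, F x = \sum_(N < n) FN N x &
      forall phi, (forall x, F (phi x) = F x) ->
       (forall tau : nat -> K, (forall i, tau i != 0) -> exists tau' : nat -> K, [/\ forall i, tau' i != 0,
           \prod_(i < q.+1) tau' i = \prod_(i < q.+1) tau i &
           forall x, scale tau (phi x) = phi (scale tau' x)]) ->
       forall N x, FN N (phi x) = FN N x].
Proof.
move=> hF tF; pose e z := upd (fun=> 1 : K) 0 z.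
have e0 z i : z != 0 -> e z i != 0.
  by move=> z0; rewrite /e /upd; case: ifP => _; rewrite ?oner_neq0.
have eprod z : \prod_(i < q.+1) e z i = z.
  by rewrite big_ord_recl /= {1}/e /upd eqxx big1 ?mulr1.
have Fe tau x : (forall i, tau i != 0) -> F (scale tau x) = F (scale (e (\prod_(i < q.+1) tau i)) x).
  move=> t0; set T := \prod_(i < q.+1) _.
  have T0 : T != 0 by apply/prodf_neq0 => i _.
  rewrite -(tF (fun i => tau i / e T i) _ _ (scale (e T) x)) => [|i|].
  - by congr F; apply: eq_coords => i /=; rewrite mulrA mulfVK // e0.
  - by rewrite mulf_neq0 // invr_eq0 e0.
  - by rewrite big_split /= prodfV eprod divff.
have [n [P [sP cP E]]] : poly_family (xcoord q.+1) (fun x z => F (scale (e z) x)).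
  apply: poly_family_gen hF => g [i hi Eg].
  have [i0|i0] := eqVneq i 0%N; case: Eg => {g}->; rewrite ?i0 /=.
  - exists 2, (fun x => x.1 0%N *: 'X); split=> [x|j|x z].
    + by apply: leq_trans (size_scale_leq _ _) _; rewrite size_polyX.
    + apply: gen_alg_ext (gen_algZ (j == 1)%:R (coord1 (ltn0Sn q))) _ => x.
      by rewrite coefZ coefX mulrC.
    + by rewrite hornerZ hornerX mulrC.
  - exists 2, (fun x => x.2 0%N *: 'X); split=> [x|j|x z].
    + by apply: leq_trans (size_scale_leq _ _) _; rewrite size_polyX.
    + apply: gen_alg_ext (gen_algZ (j == 1)%:R (coord2 (ltn0Sn q))) _ => x.
      by rewrite coefZ coefX mulrC.
    + by rewrite hornerZ hornerX mulrC.
  - exists 1%N, (fun x => (x.1 i)%:P); split=> [x|[|j]|x z].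
    + exact: size_polyC_leq1.
    + by apply: gen_alg_ext (coord1 hi) _ => x; rewrite coefC.
    + by apply: gen_alg_ext (alg_const _ 0) _ => x; rewrite coefC.
    + by rewrite hornerC /e /upd (negbTE i0) mul1r.
  - exists 1%N, (fun x => (x.2 i)%:P); split=> [x|[|j]|x z].
    + exact: size_polyC_leq1.
    + by apply: gen_alg_ext (coord2 hi) _ => x; rewrite coefC.
    + by apply: gen_alg_ext (alg_const _ 0) _ => x; rewrite coefC.
    + by rewrite hornerC /e /upd (negbTE i0) mul1r.
exists n, (fun N x => (P x)`_N); split=> // [N tau t0 x|x|phi Hphi Hsc N x].
- set T := \prod_(i < q.+1) _.
  have -> : P (scale tau x) = \poly_(i < n) (T ^+ i * (P x)`_i).
    apply: (poly_eq_nonzero charK0) => z z0; rewrite -E.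
    have -> : scale (e z) (scale tau x) = scale (fun i => e z i * tau i) x.
      by apply: eq_coords => i /=; rewrite mulrA.
    rewrite Fe => [|i]; last by rewrite mulf_neq0 ?e0.
    rewrite big_split /= eprod -/T E (horner_coef_wide _ (sP x)) horner_poly.
    by apply: eq_bigr => i _; rewrite exprMn; ring.
  rewrite coef_poly; case: ltnP => // le.
  by rewrite [X in _ = _ * X]nth_default ?mulr0 // (leq_trans (sP x)).
- have -> : F x = F (scale (e 1) x).
    congr F; apply: eq_coords => i /=; rewrite /e /upd if_same mul1r //.
  by rewrite E (horner_coef_wide _ (sP x)); apply: eq_bigr => i _; rewrite expr1n mulr1.
- congr (nth _ (polyseq _) _); apply: (poly_eq_nonzero charK0) => z z0; rewrite -!E.
  have [tau' [t0 tp ts]] := Hsc (e z) (fun i => e0 z i z0).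
  by rewrite ts Hphi Fe // tp eprod.
Qed.

Lemma transpK i j : involutive (transp i j).
Proof.
move=> k; rewrite /transp; case: (eqVneq k i) => [->|ki].
  by case: (eqVneq j i) => [//|_]; rewrite eqxx.
by case: (eqVneq k j) => [->|kj]; rewrite ?eqxx // (negbTE ki) (negbTE kj).
Qed.

Lemma permx_scale i j tau x : scale tau (permx i j x) = permx i j (scale (fun k => tau (transp i j k)) x).
Proof.
by apply: eq_coords => k /=; rewrite transpK.
Qed.

Lemma flip_scale i tau x : scale tau (flip i x) = flip i (scale tau x).
Proof. by apply: eq_coords => k //=; rewrite /upd; case: eqP => [->|//]; rewrite mulrN. Qed.

Lemma flipK i x : flip i (flip i x) = x.
Proof. by apply: eq_coords => k //=; rewrite /upd; case: eqP => [->|//]; rewrite eqxx opprK. Qed.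

Definition esym_gen e q F := exists i, F = fun x => esym_coef e q x i.

Lemma torus_symmetric_generated q F : gen_alg (xcoord q.+1) F ->
  (forall tau : nat -> K, (forall i, tau i != 0) -> \prod_(i < q.+1) tau i = 1 -> forall x, F (scale tau x) = F x) ->
  symmetric_coords q.+1 F -> gen_alg (esym_gen 1 q.+1) F.
Proof.
move=> hF tF sF; have [n [FN [gN wN EF iN]]] := weight_decomposition hF tF.
apply: gen_alg_ext EF; apply: gen_alg_sum => N.
have [|G [hG _ E]] := @symmetric_generated false q.+1 N (FN N).
  split=> //; first by rewrite mul1n.
  move=> i j hi hj; apply: iN; first exact: sF.
  move=> tau t0; exists (fun k => tau (transp i j k)); split=> // [|x].
    exact: prod_transp.
  exact: permx_scale.
apply: gen_alg_ext E; apply: gen_alg_comp hG => _ [i ->].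
by apply: alg_gen; exists i.
Qed.

Definition prod2 q x := prod1 q (swapx x).

Definition signed_gen q F := [\/ F = prod1 q, F = prod2 q | esym_gen 2 q F].

(** Scaling one pair by -1 multiplies F by (-1)^N, so a function even in x.1 i has the parity of N
    in x.2 i. For odd N it is thus divisible by [prod2], and the quotient has even weight. *)
Lemma even_generated q N F : gen_alg (xcoord q.+1) F -> weight q.+1 N F -> symmetric_coords q.+1 F ->
  even_coords q.+1 F -> gen_alg (signed_gen q.+1) F.
Proof.
have even_case M F' : gen_alg (xcoord q.+1) F' -> weight q.+1 (2 * M) F' ->
    symmetric_coords q.+1 F' -> even_coords q.+1 F' -> gen_alg (signed_gen q.+1) F'.
  move=> hF wF sF eF; have [|G [hG _ E]] := @symmetric_generated true q.+1 M F'; first by split.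
  apply: gen_alg_ext E; apply: gen_alg_comp hG => _ [i ->].
  by apply: alg_gen; constructor 3; exists i.
move=> hF wF sF eF; have := odd_double_half N; case: (odd N) => /= EN; last first.
  by apply: (even_case N./2) => //; rewrite mul2n; rewrite add0n in EN; rewrite EN.
rewrite add1n in EN; rewrite -{}EN in wF.
have sw_hF := polymap_comp (@polymap_swapx q.+1) hF.
have E2 : forall i x, (i < q.+1)%N -> F (swapx (flip i x)) = - F (swapx x).
  move=> i x hi; pose tau := upd (fun=> 1 : K) i (-1).
  have -> : swapx (flip i x) = scale tau (flip i (swapx x)).
    apply: eq_coords => k /=; rewrite /tau /upd; case: eqP => [->|_]; by rewrite ?mul1r ?mulN1r ?opprK.
  rewrite wF => [|k]; last by rewrite /tau /upd; case: ifP => _; rewrite ?oppr_eq0 oner_neq0.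
  rewrite (bigD1 (Ordinal hi)) //= {1}/tau /upd eqxx big1 => [|k]; last first.
    by rewrite /tau /upd -val_eqE /= => /negbTE ->.
  by rewrite mulr1 exprS -mul2n exprM sqrrN !expr1n mulr1 mulN1r eF.
have v2 i x : (i < q.+1)%N -> x.1 i = 0 -> F (swapx x) = 0.
  by move=> hi xi; apply: eqN0; rewrite -{1}(flip_id xi) E2.
have [F1 hF1 EF1] := divide_prod1 sw_hF v2.
have hF1' := polymap_comp (@polymap_swapx q.+1) hF1.
apply: (@gen_alg_ext _ _ _ (fun x => prod2 q.+1 x * F1 (swapx x))).
  apply: alg_mul; first by apply: alg_gen; constructor 2.
  apply: (even_case N./2) => //.
  - rewrite mul2n => tau t0 x.
    apply: (@quot1_weight _ (fun x => F (swapx x)) _ _ hF1 EF1 _ tau t0 (swapx x)).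
    by move=> sg s0 y; exact: (wF sg s0 (swapx y)).
  - move=> i j hi hj x.
    apply: (@quot1_symmetric _ (fun x => F (swapx x)) _ hF1 EF1 _ i j hi hj (swapx x)).
    by move=> a b ha hb y; exact: (sF a b ha hb (swapx y)).
  - move=> i hi x; rewrite -[RHS]mul1r.
    apply: (@quot_equivariant q.+1 (prod2 q.+1) F (fun x => F1 (swapx x)) (flip i) 1 1 (fun=> 1, fun=> 1)) => //.
    + exact: polymap_comp (@polymap_swapx q.+1) (gen_prod1 _).
    + exact: prod1_point.
    + by case=> r t; rewrite /prod2 -EF1.
    + exact: polymap_flip.
    + exact: oner_neq0.
    + by move=> y; rewrite mul1r.
    + by move=> y; rewrite eF // !mul1r.
by case=> r t; rewrite /prod2 -EF1.
Qed.

(** Oddness forces the factor [prod1], and the quotient is even of weight one less; in weight 0 an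
    odd function is constant, hence 0. *)
Lemma odd_generated q N F : gen_alg (xcoord q.+1) F -> weight q.+1 N F -> symmetric_coords q.+1 F ->
  (forall i x, (i < q.+1)%N -> F (flip i x) = - F x) -> gen_alg (signed_gen q.+1) F.
Proof.
move=> hF wF sF fF.
have v i x : (i < q.+1)%N -> x.1 i = 0 -> F x = 0.
  by move=> hi xi; apply: eqN0; rewrite -{1}(flip_id xi) fF.
case: N wF => [|N] wF.
  apply: gen_alg_ext (alg_const _ 0) _ => x.
  by rewrite (weight0_const hF wF) (v 0%N).
have [F1 hF1 E1] := divide_prod1 hF v.
apply: (gen_alg_ext _ E1); apply: alg_mul; first by apply: alg_gen; constructor 1.
apply: (@even_generated q N) => //.
- exact: quot1_weight hF1 E1 wF.
- exact: quot1_symmetric hF1 E1 sF.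
- have fF' i x : (i < q.+1)%N -> F (flip i x) = - 1 * F x by rewrite mulN1r; apply: fF.
  by move=> i hi x; rewrite (quot1_flip hF1 E1 fF') ?mul1r.
Qed.

(** Invariance under pairs of sign changes makes the effect of a single one independent of the
    index. If it turns h into s, then h + s is even and h - s is odd in every x.1 i. *)
Lemma torus_signed_generated q F : gen_alg (xcoord q.+1) F ->
  (forall tau : nat -> K, (forall i, tau i != 0) -> \prod_(i < q.+1) tau i = 1 -> forall x, F (scale tau x) = F x) ->
  symmetric_coords q.+1 F ->
  (forall i j, (i < q.+1)%N -> (j < q.+1)%N -> i != j -> forall x, F (flip i (flip j x)) = F x) ->
  gen_alg (signed_gen q.+1) F.
Proof.
move=> hF tF sF fF; have [n [FN [gN wN EF iN]]] := weight_decomposition hF tF.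
apply: gen_alg_ext EF; apply: gen_alg_sum => N; move: (val N) => {N} N.
have sN : symmetric_coords q.+1 (FN N).
  move=> i j hi hj; apply: iN; first exact: sF.
  move=> tau t0; exists (fun k => tau (transp i j k)); split=> // [|x].
    exact: prod_transp.
  exact: permx_scale.
have fN i j x : (i < q.+1)%N -> (j < q.+1)%N -> FN N (flip i (flip j x)) = FN N x.
  move=> hi hj; have [->|ne] := eqVneq i j; first by rewrite flipK.
  apply: (iN (fun x => flip i (flip j x))); first exact: fF.
  by move=> tau t0; exists tau; split=> // y; rewrite !flip_scale.
have f0 i x : (i < q.+1)%N -> FN N (flip i x) = FN N (flip 0 x).
  by move=> hi; rewrite -(fN i 0%N (flip 0 x)) // flipK.
pose h := FN N; pose s x := h (flip 0 x).
have hs : gen_alg (xcoord q.+1) s by apply: polymap_comp (@polymap_flip _ _) (gN N).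
have ws : weight q.+1 N s by move=> tau t0 x; rewrite /s /h -flip_scale wN.
have ss : symmetric_coords q.+1 s.
  move=> i j hi hj x; rewrite /s /h.
  have -> : flip 0 (permx i j x) = permx i j (flip (transp i j 0) x).
    apply: eq_coords => k //=; rewrite /upd -(inj_eq (can_inj (transpK i j))).
    by case: eqP => // ->.
  rewrite sN // f0 // /transp; case: ifP => // _; case: ifP => //.
apply: (@gen_alg_ext _ _ _ (fun x => 2^-1 * (h x + s x) + 2^-1 * (h x - s x))); last first.
  by move=> x; rewrite -[FN N x]/(h x); field; apply: two_neq0.
apply: alg_add; apply: gen_algZ.
  apply: (@even_generated _ N).
  - exact: (alg_add (gN N) hs).
  - by move=> tau t0 x; rewrite /h wN // ws // mulrDr.
  - by move=> i j hi hj x; rewrite /h sN // ss.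
  - by move=> i hi x; rewrite /h f0 // /s /h fN // addrC.
apply: (@odd_generated _ N).
- exact: (gen_algB (gN N) hs).
- by move=> tau t0 x; rewrite /h wN // ws // mulrBr.
- by move=> i j hi hj x; rewrite /h sN // ss.
- by move=> i x hi; rewrite /h f0 // /s /h fN // opprB.
Qed.

End Slice.

(** * Alternating sums and pencils *)

(* The common shape of the Leibniz formula and of the (unnormalised) Pfaffian. *)
Definition altsum (R : comNzRingType) p q (rho1 rho2 : 'S_p -> 'I_q -> 'I_p) (M : 'M[R]_p) : R :=
  \sum_(s : 'S_p) (-1) ^+ odd_perm s * \prod_(i < q) M (rho1 s i) (rho2 s i).

Lemma map_altsum (R S : comNzRingType) (f : {rmorphism R -> S}) p q rho1 rho2 (M : 'M[R]_p) :
  @altsum S p q rho1 rho2 (map_mx f M) = f (altsum rho1 rho2 M).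
Proof.
rewrite /altsum rmorph_sum; apply: eq_bigr => s _.
rewrite rmorphM rmorph_sign rmorph_prod; congr (_ * _).
by apply: eq_bigr => i _; rewrite mxE.
Qed.

(** The bivariate pencil at phi = 1, with 'X in the place of psi. *)
Definition upencil (R : comNzRingType) p (A B : 'M[R]_p) : 'M[{poly R}]_p :=
  \matrix_(i, j) ((B i j)%:P + A i j *: 'X).

Section LinearProduct.
Variables (K : fieldType) (I : Type) (a b : I -> K).

Let Q (r : seq I) : {poly K} := \prod_(i <- r) ((b i)%:P + a i *: 'X).
Let P (r : seq I) : {poly {poly K}} :=
  \prod_(i <- r) (('X%:P : {poly {poly K}}) * ((a i)%:P)%:P + 'X * ((b i)%:P)%:P).

Lemma size_linear_prod r : (size (Q r) <= (size r).+1)%N.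
Proof.
elim: r => [|i r IH]; first by rewrite /Q big_nil size_poly1.
rewrite /Q big_cons; apply: leq_trans (size_polyMleq _ _) _.
have : (size (((b i)%:P + a i *: 'X)%R : {poly K}) <= 2)%N.
  apply: leq_trans (size_polyD _ _) _; rewrite geq_max (leq_trans (size_polyC_leq1 _)) //=.
  by apply: leq_trans (size_scale_leq _ _) _; rewrite size_polyX.
move: IH; rewrite -/(Q r) /=; lia.
Qed.

Lemma coef_linear_cons i r k : (Q (i :: r))`_k = b i * (Q r)`_k + (if k is k'.+1 then a i * (Q r)`_k' else 0).
Proof.
rewrite /Q big_cons mulrDl coefD coefCM -scalerAl coefZ coefXM.
by case: k => [|k] //=; rewrite mulr0.
Qed.

Lemma coef_linear_prod r : (Q r)`_(size r) = \prod_(i <- r) a i.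
Proof.
elim: r => [|i r IH]; first by rewrite /Q !big_nil coef1.
by rewrite coef_linear_cons big_cons /= IH nth_default ?mulr0 ?add0r ?size_linear_prod.
Qed.

(** P is homogeneous of degree [size r] in both variables together, so each coefficient in phi is
    one monomial in psi, read off from the dehomogenised product Q. *)
Lemma bivariate_linear_prod r m :
  (P r)`_m = if (m <= size r)%N then (Q r)`_(size r - m) *: 'X^(size r - m) else 0.
Proof.
elim: r m => [|i r IH] m.
  by rewrite /P /Q !big_nil coef1; case: m => [|m] //=; rewrite coef1 expr0 scale1r.
have PE : (P (i :: r))`_m = a i *: ('X * (P r)`_m) + (if m is m'.+1 then b i *: (P r)`_m' else 0).
  rewrite /P big_cons mulrDl coefD -!mulrA coefCM coefCM coefXM.
  rewrite -[a i *: _]mul_polyC mulrCA; congr (_ + _).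
  by case: m => [|m] //=; rewrite coefCM mul_polyC.
rewrite PE IH /=; case: m {PE} => [|m].
  rewrite leq0n !subn0 coef_linear_cons [(Q r)`_(size r).+1]nth_default ?size_linear_prod //.
  by rewrite mulr0 add0r addr0 -scalerAr scalerA exprS.
rewrite IH subSS ltnS; case: (ltngtP m (size r)) => [lt|lt|->].
- have -> : (size r - m = (size r - m.+1).+1)%N by lia.
  by rewrite coef_linear_cons scalerDl -scalerAr !scalerA exprS addrC.
- by rewrite mulr0 !scaler0 addr0.
- by rewrite mulr0 scaler0 add0r subnn coef_linear_cons addr0 scalerA.
Qed.

End LinearProduct.

Section AltsumPencil.
Variables (K : fieldType) (p q : nat) (rho1 rho2 : 'S_p -> 'I_q -> 'I_p).
Implicit Types A B : 'M[K]_p.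

Let size_enumI : size (index_enum 'I_q) = q.
Proof. by rewrite -[RHS](card_ord q) cardT enumT. Qed.

Let signC (s : 'S_p) : (-1) ^+ odd_perm s = ((-1) ^+ odd_perm s)%:P :> {poly K}.
Proof. by rewrite rmorph_sign. Qed.

Lemma upencil_term A B s : \prod_(i < q) upencil A B (rho1 s i) (rho2 s i) =
  \prod_(i < q) ((B (rho1 s i) (rho2 s i))%:P + A (rho1 s i) (rho2 s i) *: 'X).
Proof. by apply: eq_bigr => i _; rewrite mxE. Qed.

Lemma size_altsum_upencil A B : (size (altsum rho1 rho2 (upencil A B)) <= q.+1)%N.
Proof.
apply: leq_trans (size_sum _ _ _) _; apply/bigmax_leqP => s _.
rewrite signC mul_polyC; apply: leq_trans (size_scale_leq _ _) _.
by rewrite upencil_term -[X in (_ <= X.+1)%N]size_enumI size_linear_prod.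
Qed.

Lemma coef_altsum_upencil A B k : (altsum rho1 rho2 (upencil A B))`_k =
  \sum_(s : 'S_p) (-1) ^+ odd_perm s *
    (\prod_(i < q) ((B (rho1 s i) (rho2 s i))%:P + A (rho1 s i) (rho2 s i) *: 'X))`_k.
Proof.
rewrite coef_sum; apply: eq_bigr => s _.
by rewrite signC coefCM upencil_term.
Qed.

Lemma lead_altsum_upencil A B : (altsum rho1 rho2 (upencil A B))`_q = altsum rho1 rho2 A.
Proof.
rewrite coef_altsum_upencil; apply: eq_bigr => s _; congr (_ * _).
by rewrite -[X in nth _ _ X]size_enumI coef_linear_prod.
Qed.

Lemma horner_altsum_upencil A B z :
  (altsum rho1 rho2 (upencil A B)).[z] = altsum rho1 rho2 (z *: A + B).
Proof.
rewrite -[LHS]/(horner_eval z _) -map_altsum; congr altsum; apply/matrixP => i j.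
by rewrite !mxE /= /horner_eval hornerD hornerC hornerZ hornerX addrC mulrC.
Qed.

Lemma bicoef_altsum A B k : (k <= q)%N ->
  bicoef (altsum rho1 rho2 (pencil A B)) q k = (altsum rho1 rho2 (upencil A B))`_k.
Proof.
move=> kq; rewrite /bicoef coef_altsum_upencil !coef_sum; apply: eq_bigr => s _.
have -> : (-1) ^+ odd_perm s = (((-1) ^+ odd_perm s)%:P)%:P :> {poly {poly K}}.
  by rewrite !rmorph_sign.
rewrite !coefCM; congr (_ * _).
have -> : \prod_(i < q) pencil A B (rho1 s i) (rho2 s i) = \prod_(i < q)
   ('X%:P * ((A (rho1 s i) (rho2 s i))%:P)%:P + 'X * ((B (rho1 s i) (rho2 s i))%:P)%:P).
  by apply: eq_bigr => i _; rewrite mxE.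
rewrite bivariate_linear_prod size_enumI leq_subr subKn // coefZ coefXn eqxx mulr1.
by [].
Qed.

Lemma coefs_in_altsum T (G : (T -> K) -> Prop) (M : T -> 'M[{poly K}]_p) :
  (forall i j, coefs_in G (fun x => M x i j)) -> coefs_in G (fun x => altsum rho1 rho2 (M x)).
Proof.
move=> hM k; apply: (@gen_alg_ext _ _ _ (fun x => \sum_(s : 'S_p)
   ((-1) ^+ odd_perm s * \prod_(i < q) M x (rho1 s i) (rho2 s i))`_k)); last first.
  by move=> x; rewrite coef_sum.
apply: gen_alg_sum => s; move: k; apply: coefs_inM; first exact: coefs_in_const.
elim: (index_enum _) => [|i r IH] k.
  by apply: gen_alg_ext (alg_const _ (1 : {poly K})`_k) _ => x; rewrite big_nil.
apply: (@gen_alg_ext _ _ _ (fun x => (M x (rho1 s i) (rho2 s i) *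
  \prod_(j <- r) M x (rho1 s j) (rho2 s j))`_k)); last by move=> x; rewrite big_cons.
exact: coefs_inM.
Qed.

Lemma coefs_in_upencil T (G : (T -> K) -> Prop) (A B : T -> 'M[K]_p) :
  (forall i j, gen_alg G (fun x => A x i j)) -> (forall i j, gen_alg G (fun x => B x i j)) ->
  coefs_in G (fun x => altsum rho1 rho2 (upencil (A x) (B x))).
Proof.
move=> hA hB; apply: coefs_in_altsum => i j [|[|k]].
- by apply: gen_alg_ext (hB i j) _ => x; rewrite mxE coefD coefC coefZ coefX mulr0 addr0.
- by apply: gen_alg_ext (hA i j) _ => x; rewrite mxE coefD coefC coefZ coefX mulr1 add0r.
- by apply: gen_alg_ext (alg_const _ 0) _ => x; rewrite mxE coefD coefC coefZ coefX mulr0 addr0.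
Qed.

End AltsumPencil.

Lemma deriv_prod_XsubC_neq0 (K : fieldType) (rs : seq K) :
  reflect (forall z, z \in rs -> (\prod_(y <- rs) ('X - y%:P))^`().[z] != 0) (uniq rs).
Proof.
elim: rs => [|x r IH]; first by apply: (iffP idP).
have E z : (\prod_(y <- x :: r) ('X - y%:P))^`().[z] =
    (\prod_(y <- r) ('X - y%:P)).[z] + (z - x) * (\prod_(y <- r) ('X - y%:P))^`().[z].
  by rewrite big_cons derivM derivXsubC mul1r hornerD hornerM hornerXsubC.
have R z : ((\prod_(y <- r) ('X - y%:P)).[z] == 0) = (z \in r) by rewrite -/(root _ z) root_prod_XsubC.
apply: (iffP andP) => [[nx /IH ur] z|H].
  rewrite E inE => /orP[/eqP ->|zr]; first by rewrite subrr mul0r addr0 R.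
  have /eqP-> : (\prod_(y <- r) ('X - y%:P)).[z] == 0 by rewrite R.
  rewrite add0r mulf_neq0 ?ur // subr_eq0; by apply: contraNneq nx => <-.
have nx : x \notin r by rewrite -R; have := H x (mem_head _ _); rewrite E subrr mul0r addr0.
split=> //; apply/IH => z zr; have := H z; rewrite inE zr orbT => /(_ isT).
rewrite E; have /eqP-> : (\prod_(y <- r) ('X - y%:P)).[z] == 0 by rewrite R.
by rewrite add0r mulf_eq0 negb_or => /andP[].
Qed.

Section FormTransfer.
Variables (K : fieldType) (p : nat) (J : 'M[K]_p).

(** The bases X and P^-1 D have the same Gram matrix for M, so the map taking one to the other is an
    isometry. *)
Lemma form_transfer (M P X D : 'M[K]_p) : M = P^T *m J *m P -> P \in unitmx -> X \in unitmx ->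
  X^T *m M *m X = D^T *m J *m D ->
  let h := invmx P *m D *m invmx X in h^T *m M *m h = M /\ h *m X = invmx P *m D.
Proof.
move=> EM uP uX E h; split; last by rewrite mulmxKV.
have -> : h^T *m M *m h = (invmx X)^T *m (D^T *m J *m D) *m invmx X.
  have PP : (invmx P)^T *m P^T = 1%:M by rewrite -trmx_mul mulmxV // trmx1.
  rewrite EM /h !trmx_mul !mulmxA -(mulmxA _ (invmx P)^T) PP mulmx1.
  by rewrite -(mulmxA _ P) mulmxV // mulmx1.
rewrite -E -!mulmxA mulmxV // mulmx1 !mulmxA -trmx_mul mulmxV //.
by rewrite trmx1 mul1mx.
Qed.

End FormTransfer.

(** * Generic orbits meet the slice *)

Section Generic.
Variables (K : closedFieldType) (p q e c : nat).
Hypotheses (charK0 : [pchar K] =i pred0) (hp : (0 < p)%N) (e0 : (0 < e)%N).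
Variables (rho1 rho2 : 'S_p -> 'I_q -> 'I_p) (blk : 'I_p -> nat) (one : pred 'I_p).
Variables (J : 'M[K]_p) (eps : K) (G : 'M[K]_p -> 'M[K]_p -> Prop).

Local Notation Delta := (altsum rho1 rho2).
(** [one] marks the coordinates whose entry stays 1, so that each block contributes its parameter
    once to the determinant. *)
Definition dmx (r : nat -> K) : 'M[K]_p := diag_mx (\row_j (if one j then 1 else r (blk j))).

Hypothesis blk_lt : forall j, (blk j < q)%N.
Hypotheses (eps0 : eps != 0) (JT : J^T = eps *: J) (uJ : J \in unitmx).
Hypothesis Delta_congr : forall (R : comNzRingType) (X M : 'M[R]_p),
  Delta (X^T *m M *m X) = \det X ^+ c * Delta M.
Hypothesis DeltaJ : Delta J != 0.
Hypothesis Delta_blk : forall (y : nat -> {poly K}),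
  Delta (diag_mx (\row_j y (blk j)) *m map_mx polyC J) = \prod_(i < q) y i * (Delta J)%:P.
Hypothesis dmx_form : forall r, dmx r *m J *m dmx r = diag_mx (\row_j r (blk j) ^+ e) *m J.
Hypothesis det_dmx : forall r, \det (dmx r) = \prod_(i < q) r i.
(** The kernel of M is at least as large as a block: one vector for the determinant, two for the
    Pfaffian. Independence is asked only among the vectors of block i. *)
Hypothesis kernel_blk : forall M : 'M[K]_p, M^T = eps *: M -> Delta M = 0 -> forall i, (i < q)%N ->
  exists N : 'I_p -> 'rV[K]_p, (forall j, N j *m M = 0) /\
   forall u : 'rV[K]_p, (forall j, blk j != i -> u 0 j = 0) -> \sum_j u 0 j *: N j = 0 -> u = 0.
Hypothesis form_blk : forall M : 'M[K]_p, M^T = eps *: M ->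
  (forall i j, blk i != blk j -> M i j = 0) -> exists t, M = dmx t *m J *m dmx t.

Lemma dmxT r : (dmx r)^T = dmx r.
Proof. exact: tr_diag_mx. Qed.

(** * Simultaneous block diagonalisation of two forms *)

Section Eigen.
Variables (A B : 'M[K]_p).
Hypotheses (uA : A \in unitmx) (AT : A^T = eps *: A) (BT : B^T = eps *: B).
Let delta := \det A.
(** The adjugate instead of the inverse keeps S polynomial in A and B; it multiplies the eigenvalues
    of B A^-1 by delta. *)
Let S := B *m \adj A.
Definition spectral_poly : {poly K} := Delta (upencil A (- delta *: B)).
(** P'(S) for P = [spectral_poly]; the iterates are the powers of S. *)
Definition spectral_mx : 'M[K]_p := \sum_(i < q) (spectral_poly^`())`_i *: iter i (mulmx^~ S) 1%:M.
Hypotheses (uPS : spectral_mx \in unitmx) (DA : Delta A != 0).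

Let d0 : delta != 0. Proof. by rewrite -unitfE -unitmxE. Qed.

Lemma eigen_row v z : v *m (z *: A - delta *: B) = 0 :> 'rV[K]_p -> v *m S = z *: v.
Proof.
rewrite mulmxBr -!scalemxAr => /eqP; rewrite subr_eq0 => /eqP E.
apply: (scalerI d0); rewrite /S mulmxA scalemxAl -E -scalemxAl -mulmxA mul_mx_adj.
by rewrite -/delta mul_mx_scalar !scalerA mulrC.
Qed.

Lemma eigen_spectral v z : v *m S = z *: v :> 'rV[K]_p ->
  v *m spectral_mx = spectral_poly^`().[z] *: v.
Proof.
move=> E; have Ei i : v *m iter i (mulmx^~ S) 1%:M = z ^+ i *: v.
  elim: i => [|i IH] /=; first by rewrite mulmx1 expr0 scale1r.
  by rewrite mulmxA IH -scalemxAl E scalerA exprSr.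
rewrite /spectral_mx mulmx_sumr (@horner_coef_wide _ q); last first.
  apply: leq_trans (size_poly _ _) _.
  by rewrite -subn1 leq_subLR add1n size_altsum_upencil.
by rewrite scaler_suml; apply: eq_bigr => i _; rewrite -scalemxAr Ei scalerA.
Qed.

(** P has degree q because its top coefficient is Delta A. A multiple root z would give a nonzero
    eigenvector of S on which P'(S) acts as P'(z) = 0, against invertibility. *)
Lemma spectral_roots : exists lam : nat -> K, {in gtn q &, injective lam} /\
  forall i, (i < q)%N -> Delta (lam i *: A - delta *: B) = 0.
Proof.
have spE z : spectral_poly.[z] = Delta (z *: A - delta *: B).
  by rewrite horner_altsum_upencil scaleNr.
have lead : spectral_poly`_q = Delta A by apply: lead_altsum_upencil.
have sz : size spectral_poly = q.+1.
  apply/eqP; rewrite eqn_leq size_altsum_upencil ltnNge.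
  by apply: contra DA => le; rewrite -lead nth_default.
have [rs Ers] := closed_field_poly_normal spectral_poly.
have l0 : lead_coef spectral_poly != 0 by rewrite lead_coef_eq0 -size_poly_gt0 sz.
have szr : size rs = q.
  by move: sz; rewrite Ers size_scale // size_prod_XsubC => -[].
have rsP z : (z \in rs) = (spectral_poly.[z] == 0).
  by rewrite Ers hornerZ mulf_eq0 (negbTE l0) /= -/(root _ z) root_prod_XsubC.
have uq : uniq rs.
  apply/deriv_prod_XsubC_neq0 => z zr; apply/negP => /eqP dz.
  have D0 : Delta (z *: A - delta *: B) = 0 by apply/eqP; rewrite -spE -rsP.
  have MT : (z *: A - delta *: B)^T = eps *: (z *: A - delta *: B).
    by rewrite [LHS]linearB /= ![(_ *: _)^T]linearZ /= AT BT scalerBr !scalerA ![_ * eps]mulrC.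
  have q0 : (0 < q)%N by rewrite -szr; case: rs zr {Ers szr rsP dz}.
  have [j bj] : exists j : 'I_p, blk j = blk (Ordinal hp) by exists (Ordinal hp).
  have [N [hN hu]] := kernel_blk MT D0 (blk_lt j).
  have Ns : N j *m spectral_mx = 0.
    rewrite (eigen_spectral (eigen_row (hN j))) {1}Ers derivZ hornerZ.
    by rewrite -/(lead_coef spectral_poly) dz mulr0 scale0r.
  have Nj : N j = 0 by rewrite -[N j](mulmxK uPS) Ns mul0mx.
  have /rowP/(_ j) : (\row_k (k == j)%:R : 'rV[K]_p) = 0.
    apply: hu => [k|]; first by rewrite mxE; apply: contraNeq => /eqP; case: eqP => // ->.
    rewrite (bigD1 j) //= Nj scaler0 add0r big1 // => k /negbTE kj.
    by rewrite mxE kj scale0r.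
  by rewrite !mxE eqxx => /eqP; rewrite oner_eq0.
exists (fun i => nth 0 rs i); split=> [i j hi hj E|i hi].
  by apply/eqP; rewrite -(nth_uniq 0 _ _ uq) ?szr // E.
by apply/eqP; rewrite -spE -rsP mem_nth // szr.
Qed.

(** Kernel vectors of the degenerate members of the pencil, one block for each root, form an
    eigenbasis of S. In this basis delta B' = L A' with L diagonal; A' and B' have the same
    symmetry, so transposing gives delta B' = A' L, and entries between different blocks vanish. *)
Lemma simultaneous_block : exists g : 'M[K]_p, exists r t,
  [/\ \det g = 1, g *m A *m g^T = dmx t *m J *m dmx t & g *m B *m g^T = dmx r *m J *m dmx r].
Proof.
have [lam [injl lamP]] := spectral_roots.
have MT z : (z *: A - delta *: B)^T = eps *: (z *: A - delta *: B).
  by rewrite [LHS]linearB /= ![(_ *: _)^T]linearZ /= AT BT scalerBr !scalerA ![_ * eps]mulrC.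
have /fin_all_exists[N hN] : forall i : 'I_q, exists N : 'I_p -> 'rV[K]_p,
    (forall j, N j *m (lam i *: A - delta *: B) = 0) /\
    forall u : 'rV[K]_p, (forall j, blk j != i -> u 0 j = 0) -> \sum_j u 0 j *: N j = 0 -> u = 0.
  by move=> i; apply: (kernel_blk (MT _) (lamP i (ltn_ord i)) (ltn_ord i)).
pose b j := Ordinal (blk_lt j).
pose g0 : 'M[K]_p := \matrix_j N (b j) j.
pose L := diag_mx (\row_j lam (blk j)) : 'M[K]_p.
have gS : g0 *m S = L *m g0.
  apply/row_matrixP => j; rewrite row_mul rowK mul_diag_mx.
  rewrite (eigen_row ((hN (b j)).1 j)); apply/rowP => k; by rewrite !mxE.
have ug0 : g0 \in unitmx.
  rewrite -row_free_unit; apply: inj_row_free => u ug.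
  (* As g0 S = L g0, a relation u g0 = 0 remains one after multiplying u by L - l. Taking for l all
     roots except that of block i leaves only the coordinates of this block. *)
  have mask (s : seq K) : (\row_j (u 0 j * \prod_(l <- s) (lam (blk j) - l))) *m g0 = 0.
    elim: s => [|l s IH].
      by rewrite -[RHS]ug; congr (_ *m _); apply/rowP => j; rewrite !mxE big_nil mulr1.
    have -> : \row_j (u 0 j * \prod_(l0 <- l :: s) (lam (blk j) - l0)) =
       (\row_j (u 0 j * \prod_(l <- s) (lam (blk j) - l))) *m (L - l%:M).
      apply/rowP => j; rewrite mulmxBr mul_mx_scalar mul_mx_diag !mxE big_cons; ring.
    by rewrite -mulmxA mulmxBl -gS mul_scalar_mx mulmxBr -scalemxAr mulmxA IH mul0mx scaler0 subr0.
  apply/rowP => j0; rewrite mxE.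
  pose i := b j0; pose s := [seq lam k | k <- iota 0 q & k != val i].
  have := mask s; set u' := \row_j _ => u'g.
  have u'0 : u' = 0.
    apply: (hN i).2 => [j ne|].
      rewrite mxE (big_rem (lam (blk j))) /= ?subrr ?mul0r ?mulr0 //.
      by apply: map_f; rewrite mem_filter ne mem_iota /=.
    rewrite -[RHS]u'g mulmx_sum_row; apply: eq_bigr => j _.
    rewrite rowK; case: (eqVneq (b j) i) => [-> //|ne].
    suff -> : u' 0 j = 0 by rewrite !scale0r.
    rewrite mxE (big_rem (lam (blk j))) /= ?subrr ?mul0r ?mulr0 //.
    by apply: map_f; rewrite mem_filter mem_iota /= add0n blk_lt andbT; apply: contraNneq ne => E; apply/eqP/val_inj.
  have /rowP/(_ j0) := u'0; rewrite !mxE => /eqP; rewrite mulf_eq0 => /orP[/eqP //|].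
  rewrite prodf_seq_eq0 => /hasP[l /mapP[k]]; rewrite mem_filter mem_iota => /andP[ki kq] -> /=.
  rewrite subr_eq0 => /eqP /injl E; case/negP: ki; rewrite -E //.
  exact: blk_lt.
have dg0 : \det g0 != 0 by rewrite -unitfE -unitmxE.
(* Rescaling one eigenvector makes the determinant 1. *)
have {ug0} [g dg {}gS] : exists2 g : 'M[K]_p, \det g = 1 & g *m S = L *m g.
  exists (corner p (\det g0)^-1 *m g0); first by rewrite det_mulmx det_corner // mulVf.
  rewrite -mulmxA gS !mulmxA; congr (_ *m _).
  by rewrite !mulmx_diag; congr diag_mx; apply/rowP => j; rewrite !mxE mulrC.
have gB : delta *: (g *m B) = L *m (g *m A).
  rewrite [RHS]mulmxA -gS /S -!mulmxA mul_adj_mx -/delta mul_mx_scalar.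
  by rewrite !scalemxAr.
pose A' := g *m A *m g^T; pose B' := g *m B *m g^T.
have E1 : delta *: B' = L *m A' by rewrite /B' scalemxAl gB /A' !mulmxA.
have A'T : A'^T = eps *: A' by rewrite /A' !trmx_mul trmxK AT -scalemxAl -scalemxAr mulmxA.
have B'T : B'^T = eps *: B' by rewrite /B' !trmx_mul trmxK BT -scalemxAl -scalemxAr mulmxA.
have E2 : delta *: B' = A' *m L.
  apply: (scalerI eps0); rewrite scalerA mulrC -scalerA -B'T -linearZ /= E1 trmx_mul A'T.
  by rewrite tr_diag_mx -scalemxAl.
have zA i j : blk i != blk j -> A' i j = 0.
  move=> ne; have /matrixP/(_ i j) := E1; rewrite E2 mul_diag_mx mul_mx_diag !mxE => /eqP.
  rewrite mulrC -subr_eq0 -mulrBl mulf_eq0 subr_eq0 => /orP[/eqP E|/eqP //].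
  by case/eqP: ne; apply/esym; apply: injl E; apply: blk_lt.
have zB i j : blk i != blk j -> B' i j = 0.
  move=> ne; have /matrixP/(_ i j) := E1.
  rewrite mul_diag_mx mxE [in X in _ = X]mxE zA // mulr0 => /eqP.
  by rewrite mulf_eq0 (negbTE d0) => /eqP.
have [t Et] := form_blk A'T zA; have [r Er] := form_blk B'T zB.
by exists g, r, t; split.
Qed.

End Eigen.

(** * Invariants and their restriction to the slice *)

Section Forms.
Variables (MX MY PX PY : 'M[K]_p).
Hypotheses (EMX : MX = PX^T *m J *m PX) (EMY : MY = PY^T *m J *m PY).
Hypotheses (uPX : PX \in unitmx) (uPY : PY \in unitmx).
Hypothesis G_form : forall M h, G M h -> h^T *m M *m h = M.
Hypothesis G_detX : forall h, G MX h -> \det h = 1.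
Hypothesis G_detY : forall h, G MY h -> \det h = 1.
Hypothesis G_conj : forall M P N : 'M[K]_p, M = P^T *m J *m P -> P \in unitmx ->
  N^T *m J *m N = J -> \det N = 1 -> G M (invmx P *m N *m P).
(** The element that carries X to the slice is a priori only an isometry. It may be corrected to lie
    in G at the price of other slice parameters. *)
Hypothesis G_fix : forall (M P h X : 'M[K]_p) r, M = P^T *m J *m P -> P \in unitmx ->
  h^T *m M *m h = M -> h *m X = invmx P *m dmx r ->
  exists h' r', G M h' /\ h' *m X = invmx P *m dmx r'.
Hypothesis perm_mxs : forall i j, (i < q)%N -> (j < q)%N -> exists N : 'M[K]_p,
  [/\ \det N = 1, N^T *m J *m N = J & forall r, N *m dmx r = dmx (fun k => r (transp i j k)) *m N].

Definition quad (M W : 'M[K]_p) := W^T *m M *m W.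
Definition pencil_coef i (U W : 'M[K]_p) : K := (Delta (upencil (quad MX W) (quad MY U)))`_i.

Lemma gen_alg_quad T (H : (T -> K) -> Prop) M (W : T -> 'M[K]_p) :
  (forall i j, gen_alg H (fun x => W x i j)) -> forall i j, gen_alg H (fun x => quad M (W x) i j).
Proof.
move=> hW; apply: gen_alg_mulmx => //; apply: gen_alg_mulmx => i j; last exact: alg_const.
by apply: gen_alg_ext (hW j i) _ => x; rewrite mxE.
Qed.

Lemma path_gens_polyfun kh lh f :
  path_gens pencil_coef (kh := kh) (lh := lh) f -> polyfun f.
Proof.
have hU := @gen_alg_path K p _ _ kh _ (fun i a b => @polyfun_arrow1 K p kh lh i a b).
have hW := @gen_alg_path K p _ _ lh _ (fun i a b => @polyfun_arrow2 K p kh lh i a b).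
move=> [[j ->]|[[i ->]|[i ->]]].
- by apply: gen_alg_det => a b; apply: polyfun_arrow1.
- by apply: gen_alg_det => a b; apply: polyfun_arrow2.
- by apply: (coefs_in_upencil rho1 rho2 _ _ i); apply: gen_alg_quad.
Qed.

Lemma quad_act M h W g : h^T *m M *m h = M ->
  quad M (h *m W *m g) = g^T *m quad M W *m g.
Proof.
move=> E; rewrite /quad !trmx_mul -!mulmxA; congr (_ *m (_ *m _)).
by rewrite !mulmxA E.
Qed.

Lemma path_gens_inv kh lh f : (0 < kh)%N -> (0 < lh)%N ->
  path_gens pencil_coef (kh := kh) (lh := lh) f -> si_invariant (G MX) (G MY) f.
Proof.
move=> kh0 lh0 hf gx gy hG V; case: (hG) => h1 [h2 [h3 h4]].
have dx i : (i <= lh)%N -> \det (gx i) = 1.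
  by rewrite leq_eqVlt => /orP[/eqP ->|/h1 //]; apply: G_detX.
have dy j : (j <= kh)%N -> \det (gY gx gy j) = 1.
  case: j => [|j] hj; first exact: dx.
  move: hj; rewrite leq_eqVlt => /orP[/eqP E|hj]; last exact: h2.
  by rewrite E /gY -E /= E; apply: G_detY.
case: hf => [[j ->]|[[i ->]|[i ->]]].
- by rewrite /= !det_mulmx det_inv !dy ?invr1 ?mulr1 ?mul1r // ltnW.
- by rewrite /= !det_mulmx det_inv !dx ?invr1 ?mulr1 ?mul1r // ltnW.
have EU : pathmx (rep_act gx gy V).1 = gY gx gy kh *m pathmx V.1 *m invmx (gx 0%N).
  rewrite /rep_act /= (@pathmx_act _ _ _ V.1 (gY gx gy)) // => k /andP[_ hk].
  by apply: det1_unit; apply: dy; apply: ltnW.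
have EW : pathmx (rep_act gx gy V).2 = gx lh *m pathmx V.2 *m invmx (gx 0%N).
  rewrite /rep_act /= (@pathmx_act _ _ _ V.2 gx) // => k /andP[_ hk].
  by apply: det1_unit; apply: dx; apply: ltnW.
rewrite /pencil_coef EU EW !quad_act; try exact: G_form; last first.
  by apply: G_form; rewrite /gY; case: (kh) kh0 h4.
set g := invmx _; set A := quad MX _; set B := quad MY _.
have -> : upencil (g^T *m A *m g) (g^T *m B *m g) =
    (map_mx polyC g)^T *m upencil A B *m map_mx polyC g.
  have UE (A1 B1 : 'M[K]_p) : upencil A1 B1 = map_mx polyC B1 + 'X *: map_mx polyC A1.
    by apply/matrixP => a b; rewrite !mxE mulrC mul_polyC.
  by rewrite !UE !map_mxM mulmxDr mulmxDl -scalemxAr -scalemxAl map_trmx.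
rewrite Delta_congr det_map_mx det_inv dx // invr1 expr1n mul1r //.
Qed.

(** The factor P^-1 carries M to the standard form: the form pulled back along P^-1 D is D J D. *)
Definition slice (x : coords K) : Rep K p 1 1 :=
  (fun=> invmx PY *m dmx x.1, fun=> invmx PX *m dmx x.2).

Lemma quad_slice M P r : M = P^T *m J *m P -> P \in unitmx ->
  quad M (invmx P *m dmx r) = diag_mx (\row_j r (blk j) ^+ e) *m J.
Proof.
move=> -> uP; rewrite /quad trmx_mul dmxT -dmx_form -!mulmxA; congr (_ *m _).
rewrite mulKVmx // !mulmxA -trmx_mul mulmxV // trmx1 mul1mx //.
Qed.

Lemma upencil_slice x : upencil (quad MX (invmx PX *m dmx x.2)) (quad MY (invmx PY *m dmx x.1)) =
  diag_mx (\row_j ((x.1 (blk j) ^+ e)%:P + (x.2 (blk j) ^+ e) *: 'X)) *m map_mx polyC J.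
Proof.
rewrite !quad_slice //; apply/matrixP => i j; rewrite !mul_diag_mx !mxE polyCM mulrDl.
by rewrite -!mul_polyC polyCM; ring.
Qed.

Lemma pencil_coef_slice i x : pencil_coef i ((slice x).1 ord0) ((slice x).2 ord0) =
  Delta J * esym_coef e q x i.
Proof.
rewrite /pencil_coef /slice /= upencil_slice.
rewrite (Delta_blk (fun k => (x.1 k ^+ e)%:P + (x.2 k ^+ e) *: 'X)).
by rewrite mulrC coefCM.
Qed.

Definition spec (V : Rep K p 1 1) := spectral_mx (quad MX (V.2 ord0)) (quad MY (V.1 ord0)).
Definition generic (V : Rep K p 1 1) : K :=
  \det (V.1 ord0) * \det (V.2 ord0) * \det (spec V).

Lemma quadT M P W : M = P^T *m J *m P -> (quad M W)^T = eps *: quad M W.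
Proof.
have H N X : N^T = eps *: N -> (X^T *m N *m X)^T = eps *: (X^T *m N *m X).
  by move=> NT; rewrite !trmx_mul trmxK NT -scalemxAl -scalemxAr mulmxA.
by move=> ->; apply: (H _ _); apply: (H _ _).
Qed.

Lemma generic_polyfun : polyfun generic.
Proof.
have h1 := @gen_alg_quad _ _ MY _ (@polyfun_arrow1 K p 1 1 ord0).
have h2 := @gen_alg_quad _ _ MX _ (@polyfun_arrow2 K p 1 1 ord0).
have hdet := gen_alg_det h2.
apply: alg_mul; first apply: alg_mul.
- by apply: gen_alg_det => a b; apply: polyfun_arrow1.
- by apply: gen_alg_det => a b; apply: polyfun_arrow2.
apply: gen_alg_det => a b; rewrite /spec /spectral_mx.
have hadj i j : gen_alg (fun g => (exists j a b, g = (fun V : Rep K p 1 1 => V.1 j a b)) \/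
   (exists i a b, g = (fun V : Rep K p 1 1 => V.2 i a b)))
   (fun V => (\adj (quad MX (V.2 ord0))) i j).
  apply: (@gen_alg_ext _ _ _ (fun V => (-1) ^+ (j + i) * \det (row' j (col' i (quad MX (V.2 ord0)))))).
    apply: gen_algZ; apply: gen_alg_det => a' b'.
    by apply: gen_alg_ext (h2 (lift j a') (lift i b')) _ => V; rewrite !mxE.
  by move=> V; rewrite mxE.
have hS := gen_alg_mulmx h1 hadj.
apply: (@gen_alg_ext _ _ _ (fun V => \sum_(i < q)
   (spectral_poly (quad MX (V.2 ord0)) (quad MY (V.1 ord0)))^`()`_i *
   (iter i (mulmx^~ (quad MY (V.1 ord0) *m \adj (quad MX (V.2 ord0)))) 1%:M) a b)); last first.
  by move=> V; rewrite summxE; apply: eq_bigr => i _; rewrite mxE.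
apply: gen_alg_sum => i; apply: alg_mul.
  apply: (@gen_alg_ext _ _ _ (fun V => i.+1%:R *
      (spectral_poly (quad MX (V.2 ord0)) (quad MY (V.1 ord0)))`_i.+1)).
    apply: gen_algZ; apply: (coefs_in_upencil rho1 rho2 h2 _ i.+1) => a' b'.
    apply: gen_alg_ext (alg_mul (gen_algZ (-1) hdet) (h1 a' b')) _ => V.
    by rewrite mxE mulN1r.
  by move=> V; rewrite coef_deriv mulr_natl.
elim: (val i) a b => [|k IH] a b /=; first exact: alg_const.
exact: gen_alg_mulmx.
Qed.

(** At t_i = 1 and r_i = i + 1 the matrix S is diagonal with entries det J * (i + 1)^e, distinct for
    distinct blocks in characteristic 0. The shift by 1 keeps all r_i nonzero. *)
Lemma generic_point : exists V, generic V != 0.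
Proof.
pose r0 : nat -> K := fun i => i.+1%:R; exists (slice (r0, fun=> 1)).
have dm1 : dmx (fun=> 1) = 1%:M.
  by rewrite /dmx -diag_const_mx; congr diag_mx; apply/rowP => j; rewrite !mxE if_same.
rewrite /generic /= dm1 mulmx1 det_mulmx !mulf_neq0 //.
- by rewrite det_inv invr_eq0 -unitfE -unitmxE.
- by rewrite det_dmx; apply/prodf_neq0 => i _; rewrite (pcharf0P K).1.
- by rewrite det_inv invr_eq0 -unitfE -unitmxE.
rewrite /spec /=.
have -> : quad MX (invmx PX *m dmx (fun=> 1)) = J.
  rewrite quad_slice // -[RHS]mul1mx; congr (_ *m _); rewrite -diag_const_mx.
  by congr diag_mx; apply/rowP => j; rewrite !mxE expr1n.
rewrite quad_slice //; set Dm := diag_mx _; set d := \det J.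
have dJ : d != 0 by rewrite -unitfE -unitmxE.
pose mu i : K := d * r0 i ^+ e.
have Epi : spectral_poly J (Dm *m J) = Delta J *: \prod_(y <- [seq mu i | i <- iota 0 q]) ('X - y%:P).
  rewrite /spectral_poly -/d.
  have -> : upencil J (- d *: (Dm *m J)) = diag_mx (\row_j ('X - (mu (blk j))%:P)) *m map_mx polyC J.
    apply/matrixP => i j; rewrite !mul_diag_mx !mxE -mul_polyC /mu !polyCM polyCN; ring.
  rewrite (Delta_blk (fun k => 'X - (mu k)%:P)) mulrC mul_polyC; congr (_ *: _).
  by rewrite big_map -[in RHS](subn0 q) big_mkord.
suff -> : spectral_mx J (Dm *m J) = diag_mx (\row_j (spectral_poly J (Dm *m J))^`().[mu (blk j)]).
  rewrite det_diag; apply/prodf_neq0 => j _; rewrite mxE Epi derivZ hornerZ mulf_neq0 //.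
  apply: (deriv_prod_XsubC_neq0 _ _).
  - rewrite map_inj_in_uniq ?iota_uniq // => i k _ _ /(mulfI dJ).
    rewrite /r0 -!natrX => /(natr_inj_char0 charK0) /eqP; rewrite eqn_exp2r // => /eqP.
    by case.
  - by apply: map_f; rewrite mem_iota blk_lt.
apply/row_matrixP => j; rewrite [LHS]rowE [RHS]row_diag_mx mxE.
apply: eigen_spectral; rewrite -mulmxA mul_mx_adj -/d mul_mx_scalar -scalemxAr mul_mx_diag.
by apply/rowP => k; rewrite !mxE eqxx /= /mu; case: (eqVneq k j) => [->|_]; rewrite ?mul1r ?mulr1 ?mul0r ?mulr0.
Qed.

(** A base change at x_0 makes both pulled back forms block diagonal. They are then Gram matrices of
    slice matrices, and isometries at X and Y do the rest. *)
Lemma generic_orbit V : generic V != 0 -> exists gx gy x,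
  Defs.in_group 1 1 (G MX) (G MY) gx gy /\ rep_act gx gy V = slice x.
Proof.
rewrite /generic !mulf_eq0 !negb_or => /andP[/andP[dU dW] dS].
set U := V.1 ord0 in dU *; set W := V.2 ord0 in dW *.
have uU : U \in unitmx by rewrite unitmxE unitfE.
have uW : W \in unitmx by rewrite unitmxE unitfE.
have uQ : quad MX W \in unitmx.
  by rewrite /quad EMX !unitmx_mul !unitmx_tr uW uPX uJ.
have DQ : Delta (quad MX W) != 0.
  have -> : quad MX W = (PX *m W)^T *m J *m (PX *m W) by rewrite /quad EMX trmx_mul !mulmxA.
  rewrite Delta_congr mulf_neq0 // expf_neq0 // det_mulmx mulf_neq0 //.
  by rewrite -unitfE -unitmxE.
have uS : spectral_mx (quad MX W) (quad MY U) \in unitmx by rewrite unitmxE unitfE.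
have [g [r [t [dg EA EB]]]] := simultaneous_block uQ (quadT W EMX) (quadT U EMY) uS DQ.
have ug : g^T \in unitmx by rewrite unitmx_tr det1_unit.
have quadg M X : quad M (X *m g^T) = g *m quad M X *m g^T.
  by rewrite /quad trmx_mul trmxK !mulmxA.
have EA' : (W *m g^T)^T *m MX *m (W *m g^T) = (dmx t)^T *m J *m dmx t.
  by rewrite dmxT -EA -quadg.
have EB' : (U *m g^T)^T *m MY *m (U *m g^T) = (dmx r)^T *m J *m dmx r.
  by rewrite dmxT -EB -quadg.
have [|hx1 hx2] := form_transfer EMX uPX _ EA'; first by rewrite unitmx_mul uW.
have [|hy1 hy2] := form_transfer EMY uPY _ EB'; first by rewrite unitmx_mul uU.
have [hx [t' [GhX EX]]] := G_fix EMX uPX hx1 hx2.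
have [hy [r' [GhY EY]]] := G_fix EMY uPY hy1 hy2.
exists (fun i => if i == 0%N then invmx g^T else hx), (fun=> hy), (r', t'); split.
  split; first by case=> // _; rewrite /SLm /= det_inv det_tr dg invr1.
  by split=> // -[|j]; rewrite ?andbF.
congr pair; apply: functional_extensionality => i; rewrite (ord1 i) /= /gY /= invmxK -mulmxA.
  exact: EY.
exact: EX.
Qed.

Lemma slice_inv f x g h k : si_invariant (G MX) (G MY) f -> \det g = 1 -> G MY h -> G MX k ->
  f (fun=> h *m (invmx PY *m dmx x.1) *m invmx g, fun=> k *m (invmx PX *m dmx x.2) *m invmx g)
   = f (slice x).
Proof.
move=> hf dg hh hk; rewrite -[RHS](hf (fun i => if i == 0%N then g else k) (fun=> h)).
  congr f; congr pair; apply: functional_extensionality => i; rewrite (ord1 i) //.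
by split=> [[|i] //|]; split=> // -[|j]; rewrite ?andbF.
Qed.

Lemma G1 M P : M = P^T *m J *m P -> P \in unitmx -> G M 1%:M.
Proof.
move=> E uP; have -> : 1%:M = invmx P *m 1%:M *m P by rewrite mulmx1 mulVmx.
by apply: G_conj; rewrite ?det1 // trmx1 mul1mx mulmx1.
Qed.

Lemma slice_polyfun f : polyfun f -> gen_alg (xcoord q) (fun x : coords K => f (slice x)).
Proof.
have hd (P : 'M[K]_p) a b (s : coords K -> nat -> K) : (forall i, (i < q)%N -> gen_alg (xcoord q) (fun x => s x i)) ->
    gen_alg (xcoord q) (fun x => (invmx P *m dmx (s x)) a b).
  move=> hs; apply: (@gen_alg_ext _ _ _ (fun x => invmx P a b * (if one b then 1 else s x (blk b)))).
    by apply: gen_algZ; case: (one b); [apply: alg_const|apply: hs].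
  by move=> x; rewrite mul_mx_diag !mxE.
apply: gen_alg_comp => _ [] [i [a [b ->]]] /=.
  by apply: (hd PY a b (fun x => x.1)) => k; apply: coord1.
by apply: (hd PX a b (fun x => x.2)) => k; apply: coord2.
Qed.

Lemma dmxM r s : dmx r *m dmx s = dmx (fun i => r i * s i).
Proof.
rewrite /dmx mulmx_diag; congr diag_mx; apply/rowP => j; rewrite !mxE.
by case: ifP => _ //; rewrite mulr1.
Qed.

(** A diagonal element of SL acting at x_0 alone scales r_i and t_i by the same factor. *)
Lemma slice_torus f : si_invariant (G MX) (G MY) f -> forall tau : nat -> K, (forall i, tau i != 0) ->
  \prod_(i < q) tau i = 1 -> forall x, f (slice (scale tau x)) = f (slice x).
Proof.
move=> hf tau t0 tp x.
have dt : \det (dmx tau) = 1 by rewrite det_dmx.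
rewrite -[RHS](@slice_inv f x (invmx (dmx tau)) 1%:M 1%:M) ?det1_inv //; try exact: G1 uPX; last exact: G1 uPY.
rewrite invmxK !mul1mx -!mulmxA !dmxM; congr f; congr pair; apply: functional_extensionality => _ /=;
by congr (_ *m dmx _); apply: functional_extensionality => i; rewrite mulrC.
Qed.

Lemma slice_symmetric f : si_invariant (G MX) (G MY) f ->
  symmetric_coords q (fun x => f (slice x)).
Proof.
move=> hf i j hi hj x; have [N [dN fN EN]] := perm_mxs hi hj.
have uN : N \in unitmx by apply: det1_unit.
rewrite -[RHS](@slice_inv f x N (invmx PY *m N *m PY) (invmx PX *m N *m PX)) //; try exact: G_conj.
have H P r : P \in unitmx -> invmx P *m N *m P *m (invmx P *m dmx r) *m invmx N =
   invmx P *m dmx (fun k => r (transp i j k)).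
  by move=> uP; rewrite -!mulmxA mulKVmx // [N *m _]mulmxA EN mulmxK.
by rewrite !H.
Qed.

(** Let h be a polynomial in the generators that agrees with f on the slice. Both are invariant, so
    they agree on the generic locus and, by density, everywhere. *)
Lemma slice_generated f (SG : (coords K -> K) -> Prop) : polyfun f -> si_invariant (G MX) (G MY) f ->
  gen_alg SG (fun x => f (slice x)) ->
  (forall g, SG g -> exists2 h, gen_alg (path_gens pencil_coef (kh := 1) (lh := 1)) h
     & forall x, g x = h (slice x)) ->
  gen_alg (path_gens pencil_coef (kh := 1) (lh := 1)) f.
Proof.
move=> pf invf hS lift.
have [h hh E] := gen_alg_lift lift hS.
apply: (gen_alg_ext hh); have [V0 gV0] := generic_point.
have ph : polyfun h.
  apply: (gen_alg_comp (phi := id) _ hh) => g /path_gens_polyfun; exact.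
apply: (eq_dense charK0 (@rep_joinable K p 1 1) generic_polyfun pf ph gV0) => V /generic_orbit.
move=> [gx [gy [x [hG Ex]]]]; rewrite -(invf gx gy hG V) Ex E -Ex.
by apply: (gen_alg_invariant _ hh) => g hg; apply: (path_gens_inv _ _ hg hG).
Qed.

End Forms.
End Generic.

(** * The orthogonal case *)

Section SplitForm.
Variables (K : fieldType) (m n : nat).

Lemma complete_rows (A : 'M[K]_(m, m + n)) : row_free A ->
  exists2 g : 'M[K]_(m + n), g \in unitmx & usubmx g = A.
Proof.
move=> fA; exists (block_mx (col_ebase A) 0 0 1%:M *m row_ebase A).
  rewrite unitmx_mul row_ebase_unit andbT unitmxE det_ublock det1 mulr1 -unitmxE.
  exact: col_ebase_unit.
rewrite -mul_usub_mx /block_mx col_mxKu -[RHS]mulmx_ebase; congr (_ *m _).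
have /eqP -> := fA.
by rewrite pid_mx_row mul_mx_row mulmx1 mulmx0.
Qed.

(** Splitting off a nondegenerate subspace, for symmetric and skew forms alike: one elimination
    clears the lower left block, and the upper right one then vanishes by the symmetry of the
    form. *)
Lemma split_form (M : 'M[K]_(m + n)) (eps : K) (A : 'M[K]_(m, m + n)) :
  M^T = eps *: M -> A *m M *m A^T \in unitmx ->
  exists g C, [/\ g \in unitmx, g *m M *m g^T = block_mx (A *m M *m A^T) 0 0 C & C^T = eps *: C].
Proof.
move=> MT uA; have fA : row_free A.
  by apply: inj_row_free => v vA; rewrite -[v](mulmxK uA) !mulmxA vA !mul0mx.
have [g ug Eg] := complete_rows fA.
pose M1 := g *m M *m g^T.
have HT (h N : 'M[K]_(m + n)) : N^T = eps *: N -> (h *m N *m h^T)^T = eps *: (h *m N *m h^T).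
  by move=> NT; rewrite !trmx_mul trmxK NT -scalemxAl -scalemxAr mulmxA.
have E1 : ulsubmx M1 = A *m M *m A^T.
  by rewrite /M1 /ulsubmx -!mul_usub_mx -mulmx_lsub Eg -trmx_usub Eg.
set a := A *m M *m A^T in uA E1 *.
pose L : 'M[K]_(m + n) := block_mx 1%:M 0 (- dlsubmx M1 *m invmx a) 1%:M.
have uL : L \in unitmx by rewrite unitmxE det_lblock !det1 mulr1 unitr1.
pose R := L *m M1 *m L^T.
have RT : R^T = eps *: R by apply: (HT _ _); apply: (HT _ _).
have ER : exists b C, R = block_mx a b 0 C.
  rewrite /R -{1}(submxK M1) E1 /L tr_block_mx !mulmx_block.
  rewrite !mul1mx !mul0mx !addr0 !mulNmx mulmxKV // addNr mul0mx add0r !trmx1 trmx0 !mulmx1 !mulmx0 ?addr0.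
  eexists; eexists; reflexivity.
have [b [C EC]] := ER; exists (L *m g), C.
move: (RT); rewrite EC tr_block_mx scale_block_mx => /eq_block_mx[_ _ Eb EC'].
split=> //; first by rewrite unitmx_mul uL ug.
have -> : L *m g *m M *m (L *m g)^T = R by rewrite /R /M1 trmx_mul !mulmxA.
by rewrite EC -[b]trmxK Eb scaler0 trmx0.
Qed.

Lemma split_form_ind (M : 'M[K]_(m + n)) (eps : K) (A : 'M[K]_(m, m + n)) (Q : 'M[K]_n -> Prop) :
  M^T = eps *: M -> A *m M *m A^T \in unitmx ->
  (forall C, C^T = eps *: C -> exists2 h, h \in unitmx & Q (h *m C *m h^T)) ->
  exists g C, [/\ g \in unitmx, g *m M *m g^T = block_mx (A *m M *m A^T) 0 0 C & Q C].
Proof.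
move=> MT uA IH; have [g [C [ug Eg CT]]] := split_form MT uA.
have [h uh hQ] := IH C CT.
exists (block_mx 1%:M 0 0 h *m g), (h *m C *m h^T); split=> //.
  by rewrite unitmx_mul ug andbT unitmxE det_ublock det1 mul1r -unitmxE.
rewrite trmx_mul !mulmxA -(mulmxA _ g) -(mulmxA _ (g *m M)) Eg tr_block_mx !mulmx_block.
by rewrite !trmx1 !trmx0 !mul1mx !mulmx1 !mul0mx !mulmx0 !addr0 !add0r !mul0mx.
Qed.

End SplitForm.

Section Symmetric.
Variable K : closedFieldType.
Hypothesis charK0 : [pchar K] =i pred0.

Lemma closed_sqrt (a : K) : exists x, x ^+ 2 = a.
Proof.
have [x] := @solve_monicpoly K 2 (nth 0 [:: a]) isT.
by rewrite !big_ord_recl big_ord0 /= mulr1 mul0r !addr0 => ?; exists x.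
Qed.

Lemma bilinear_delta n (M : 'M[K]_n) i k :
  ((delta_mx 0 i : 'rV[K]_n) *m M *m (delta_mx 0 k : 'rV[K]_n)^T) 0 0 = M i k.
Proof. by rewrite -rowE trmx_delta -colE !mxE. Qed.

(** Polarisation: if M i i = M j j = 0, the vector e_i + e_j takes the value 2 M i j. *)
Lemma symmetric_nonzero n (M : 'M[K]_n) : M^T = M -> M != 0 ->
  exists v : 'rV[K]_n, (v *m M *m v^T) 0 0 != 0.
Proof.
move=> MT /matrix0Pn[i [j Mij]].
have [Mi|Mi] := eqVneq (M i i) 0; last by exists (delta_mx 0 i); rewrite bilinear_delta.
have [Mj|Mj] := eqVneq (M j j) 0; last by exists (delta_mx 0 j); rewrite bilinear_delta.
have addE (x y : 'M[K]_1) : (x + y) 0 0 = x 0 0 + y 0 0 by rewrite mxE.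
exists (delta_mx 0 i + delta_mx 0 j).
rewrite [(_ + _)^T]linearD /= !mulmxDl !mulmxDr !addE !bilinear_delta Mi Mj.
have -> : M j i = M i j by rewrite -{1}MT mxE.
by rewrite add0r addr0 -mulr2n -mulr_natr mulf_neq0 // two_neq0.
Qed.

Lemma symmetric_diag n (M : 'M[K]_n) : M^T = M ->
  exists g d, g \in unitmx /\ g *m M *m g^T = diag_mx d.
Proof.
elim: n M => [|n IH] M MT.
  by exists 1%:M, 0; split; [apply: unitmx1|apply/matrixP => -[]].
have [->|M0] := eqVneq M 0.
  by exists 1%:M, 0; split; rewrite ?unitmx1 // mulmx0 mul0mx linear0.
have [v hv] := symmetric_nonzero MT M0.
have [|||g [C [ug Eg [d Ed]]]] := @split_form_ind K 1 n M 1 v (fun C => exists d, C = diag_mx d).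
- by rewrite scale1r.
- by rewrite unitmxE det_mx11 unitfE.
- move=> C; rewrite scale1r => /IH[h [d [uh Eh]]].
  by exists h => //; exists d.
exists g, (row_mx (v *m M *m v^T) d : 'rV_(1 + n)); split=> //; rewrite Eg Ed.
refine (etrans _ (esym (@diag_mx_row _ n 1 (v *m M *m v^T) d))); congr block_mx; apply/matrixP => i j.
by rewrite !(ord1 i) !(ord1 j) [in RHS]mxE eqxx mulr1n.
Qed.

Lemma symmetric_square p (M : 'M[K]_p) : M^T = M -> M \in unitmx ->
  exists2 P : 'M[K]_p, P \in unitmx & M = P^T *m 1%:M *m P.
Proof.
move=> MT uM; have [g [d [ug Eg]]] := symmetric_diag MT.
have /fin_all_exists[s Es] : forall j, exists x, x ^+ 2 = d 0 j by move=> j; apply: closed_sqrt.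
pose D := diag_mx (\row_j s j) : 'M[K]_p.
have DD : D *m D = diag_mx d.
  by rewrite mulmx_diag; congr diag_mx; apply/rowP => j; rewrite !mxE -expr2 Es.
have uD : D \in unitmx.
  have : diag_mx d \in unitmx by rewrite -Eg !unitmx_mul unitmx_tr ug uM.
  by rewrite -DD unitmx_mul andbb.
exists (D *m (invmx g)^T); first by rewrite unitmx_mul uD unitmx_tr unitmx_inv.
rewrite mulmx1 trmx_mul trmxK tr_diag_mx mulmxA -(mulmxA _ D D) DD -Eg.
rewrite !mulmxA mulVmx // mul1mx -mulmxA -trmx_mul mulVmx // trmx1 mulmx1 //.
Qed.

End Symmetric.

Section Orthogonal.
Variables (K : closedFieldType) (p' : nat).
Local Notation p := p'.+1.
Hypothesis charK0 : [pchar K] =i pred0.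

Let rho1 (s : 'S_p) (i : 'I_p) := i.
Let rho2 (s : 'S_p) (i : 'I_p) := s i.
Let blk (j : 'I_p) : nat := j.
Let one : pred 'I_p := pred0.
Local Notation D := (dmx blk one).

Let DE (r : nat -> K) : D r = diag_mx (\row_(j < p) r j).
Proof. by []. Qed.

Let det_altsum (R : comNzRingType) (M : 'M[R]_p) : altsum rho1 rho2 M = \det M.
Proof. by []. Qed.

Let congr_det (R : comNzRingType) (X M : 'M[R]_p) :
  altsum rho1 rho2 (X^T *m M *m X) = \det X ^+ 2 * altsum rho1 rho2 M.
Proof. by rewrite !det_altsum !det_mulmx det_tr expr2; ring. Qed.

Let det_blk (y : nat -> {poly K}) :
  altsum rho1 rho2 (diag_mx (\row_j y (blk j)) *m map_mx polyC (1%:M : 'M[K]_p)) =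
  \prod_(i < p) y i * (altsum rho1 rho2 (1%:M : 'M[K]_p))%:P.
Proof.
rewrite !det_altsum map_mx1 mulmx1 det1 mulr1 det_diag.
by apply: eq_bigr => i _; rewrite mxE.
Qed.

Let form_D (r : nat -> K) : D r *m 1%:M *m D r = diag_mx (\row_j r (blk j) ^+ 2) *m 1%:M.
Proof.
rewrite !mulmx1 DE mulmx_diag; congr diag_mx; apply/rowP => j.
by rewrite !mxE expr2.
Qed.

Let det_D (r : nat -> K) : \det (D r) = \prod_(i < p) r i.
Proof. by rewrite DE det_diag; apply: eq_bigr => i _; rewrite mxE. Qed.

Let kernel_O (M : 'M[K]_p) : M^T = 1 *: M -> altsum rho1 rho2 M = 0 -> forall i, (i < p)%N ->
  exists N : 'I_p -> 'rV[K]_p, (forall j, N j *m M = 0) /\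
   forall u : 'rV[K]_p, (forall j, blk j != i -> u 0 j = 0) -> \sum_j u 0 j *: N j = 0 -> u = 0.
Proof.
move=> _; rewrite det_altsum => /eqP/det0P[v v0 vM] i hi; exists (fun=> v); split=> // u hu.
rewrite (bigD1 (Ordinal hi)) //= big1 => [|j ne]; last first.
  by rewrite hu ?scale0r.
rewrite addr0 => /eqP; rewrite scaler_eq0 (negbTE v0) orbF => /eqP u0.
apply/rowP => j; rewrite mxE; have [E|] := eqVneq (blk j) i; last exact: hu.
by rewrite -u0; congr (u 0 _); apply: val_inj.
Qed.

Let form_O (M : 'M[K]_p) : M^T = 1 *: M ->
  (forall i j, blk i != blk j -> M i j = 0) -> exists t, M = D t *m 1%:M *m D t.
Proof.
move=> _ hM; have /fin_all_exists[s Es] : forall j, exists x, x ^+ 2 = M j j by move=> j; apply: closed_sqrt.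
exists (fun k => s (inord k)); rewrite form_D mulmx1; apply/matrixP => i j; rewrite !mxE.
have [->|ne] := eqVneq i j; last by rewrite hM // mulr0n.
by rewrite mulr1n inord_val Es.
Qed.

Let SO_form (M h : 'M[K]_p) : SOm M h -> h^T *m M *m h = M. Proof. by case. Qed.
Let SO_det (M h : 'M[K]_p) : SOm M h -> \det h = 1. Proof. by case. Qed.

Lemma conj_form (J M P N : 'M[K]_p) : M = P^T *m J *m P -> P \in unitmx -> N^T *m J *m N = J ->
  (invmx P *m N *m P)^T *m M *m (invmx P *m N *m P) = M.
Proof.
move=> -> uP EN; rewrite !trmx_mul !mulmxA.
have PP : (invmx P)^T *m P^T = 1%:M by rewrite -trmx_mul mulmxV // trmx1.
rewrite -(mulmxA _ (invmx P)^T) PP mulmx1 -(mulmxA _ P (invmx P)) mulmxV // mulmx1.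
by rewrite -!mulmxA; congr (_ *m _); rewrite !mulmxA EN.
Qed.

Lemma det_conjmx (P N : 'M[K]_p) : P \in unitmx -> \det (invmx P *m N *m P) = \det N.
Proof.
move=> uP; rewrite !det_mulmx det_inv mulrAC mulVf ?mul1r //.
by rewrite -unitfE -unitmxE.
Qed.

Let SO_conj (M P N : 'M[K]_p) : M = P^T *m 1%:M *m P -> P \in unitmx ->
  N^T *m 1%:M *m N = 1%:M -> \det N = 1 -> SOm M (invmx P *m N *m P).
Proof.
by move=> EM uP EN dN; split; [apply: conj_form EM uP EN|rewrite det_conjmx].
Qed.

Let DM r s : D r *m D s = D (fun i => r i * s i : K).
Proof. exact: dmxM. Qed.

Let SO_fix (M P h X : 'M[K]_p) r : M = P^T *m 1%:M *m P -> P \in unitmx ->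
  h^T *m M *m h = M -> h *m X = invmx P *m D r ->
  exists h' r', SOm M h' /\ h' *m X = invmx P *m D r'.
Proof.
move=> EM uP Eh EX.
have dM : \det M != 0.
  by rewrite EM mulmx1 det_mulmx det_tr mulf_neq0 // -unitfE -unitmxE.
have : \det h ^+ 2 = 1.
  have := congr1 determinant Eh; rewrite !det_mulmx det_tr => E.
  by apply: (mulfI dM); rewrite mulr1 -[RHS]E; ring.
move/eqP; rewrite sqrf_eq1 => /orP[/eqP dh|/eqP dh]; first by exists h, r.
(* A reflection in the first coordinate, transported by P, corrects determinant -1; on the slice it
   only changes the sign of r 0. *)
pose s : nat -> K := upd (fun=> 1) 0 (-1); pose N := D s.
have NN : N^T *m 1%:M *m N = 1%:M.
  rewrite mulmx1 dmxT DM DE /s -diag_const_mx; congr diag_mx; apply/rowP => j.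
  by rewrite !mxE /upd; case: eqP; rewrite ?mulr1 // mulrNN mulr1.
have dN : \det N = -1.
  by rewrite det_D big_ord_recl /= {1}/s /upd eqxx big1 ?mulr1.
exists (invmx P *m N *m P *m h), (fun i => s i * r i); split.
  split; last by rewrite det_mulmx det_conjmx // dN dh mulrNN mulr1.
  have E (c : 'M[K]_p) : c^T *m M *m c = M -> (c *m h)^T *m M *m (c *m h) = M.
    move=> Ec; rewrite -[RHS]Eh -[in RHS]Ec trmx_mul !mulmxA //.
  exact: E (conj_form EM uP NN).
by rewrite -!mulmxA EX mulKVmx // DM.
Qed.

Let perm_O i j : (i < p)%N -> (j < p)%N -> exists N : 'M[K]_p,
  [/\ \det N = 1, N^T *m 1%:M *m N = 1%:M & forall r, N *m D r = D (fun k => r (transp i j k)) *m N].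
Proof.
move=> hi hj; have [->|ne] := eqVneq i j.
  exists 1%:M; split=> [||r]; rewrite ?det1 ?trmx1 ?mulmx1 ?mul1mx //.
  by congr dmx; apply: functional_extensionality => k; rewrite /transp; case: eqP => // ->.
(* The transposition has determinant -1. The sign at i repairs this and commutes with the diagonal
   slice matrices. *)
pose t := tperm (Ordinal hi) (Ordinal hj); pose s : nat -> K := upd (fun=> 1) i (-1).
have ss : D s *m D s = 1%:M.
  rewrite DM DE /s -diag_const_mx; congr diag_mx; apply/rowP => k.
  by rewrite !mxE /upd; case: eqP; rewrite ?mulr1 // mulrNN mulr1.
exists (D s *m perm_mx t); split=> [||r].
- rewrite det_mulmx det_perm odd_tperm -val_eqE /= ne expr1 det_D (bigD1 (Ordinal hi)) //=.
  rewrite {1}/s /upd eqxx big1 ?mulr1 ?mulrNN ?mulr1 // => k.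
  by rewrite /s /upd -val_eqE /= => /negbTE ->.
- rewrite mulmx1 trmx_mul dmxT mulmxA -(mulmxA _ (D s) (D s)) ss mulmx1.
  by rewrite tr_perm_mx -perm_mxM mulVg perm_mx1.
- have Ht : perm_mx t *m D r = D (fun k => r (transp i j k)) *m perm_mx t.
    apply/matrixP => a b; rewrite DE mul_mx_diag mul_diag_mx !mxE.
    have [E|] := eqVneq (t a) b; last by rewrite mul0r mulr0.
    rewrite mul1r mulr1 -E; congr r; rewrite /t permE /= /transp -!val_eqE /=.
    by case: ifP => // _; case: ifP.
  rewrite -mulmxA Ht !mulmxA !DM; congr (dmx _ _ _ *m _).
  by apply: functional_extensionality => k; rewrite mulrC.
Qed.

Definition det_coef (MX MY : 'M[K]_p) i (U W : 'M[K]_p) : K :=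
  (\det (upencil (W^T *m MX *m W) (U^T *m MY *m U)))`_i.

Lemma O_path_gens (MX MY : 'M[K]_p) : MX^T = MX -> MY^T = MY -> MX \in unitmx -> MY \in unitmx ->
  forall kh lh (f : Rep K p kh.+1 lh.+1 -> K),
  (polyfun f /\ si_invariant (SOm MX) (SOm MY) f) <->
  gen_alg (path_gens (det_coef MX MY) (kh := kh.+1) (lh := lh.+1)) f.
Proof.
move=> MXT MYT uMX uMY kh lh f.
have [PX uPX EMX] := symmetric_square charK0 MXT uMX.
have [PY uPY EMY] := symmetric_square charK0 MYT uMY.
have SO1 (M : 'M[K]_p) : SOm M 1%:M by split; rewrite ?trmx1 ?mul1mx ?mulmx1 ?det1.
split=> [[pf invf]|hf]; last first.
  split; first by apply: (gen_alg_comp (phi := id) _ hf) => g; apply: (@path_gens_polyfun K p p rho1 rho2).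
  move=> gx gy hG V; apply: (gen_alg_invariant _ hf) => g hg.
  have H := @path_gens_inv K p p 2 rho1 rho2 (@SOm K p) congr_det MX MY SO_form (@SO_det MX) (@SO_det MY) kh.+1 lh.+1 g isT isT hg.
  exact: H gx gy hG V.
move: kh lh f pf invf.
have hp : (0 < p)%N by [].
suff: si_generated (SOm MX) (SOm MY) (det_coef MX MY) 1 1.
  by move=> H kh lh; apply: (generated_all charK0 hp (SO1 _) (SO1 _) (@SO_det MX) (@SO_det MY) H).
move=> f pf invf.
have hblk (j : 'I_p) : (blk j < p)%N by apply: ltn_ord.
have T1 : (1%:M : 'M[K]_p)^T = 1 *: 1%:M by rewrite trmx1 scale1r.
have d1 : altsum rho1 rho2 (1%:M : 'M[K]_p) != 0 by rewrite det_altsum det1 oner_neq0.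
apply: (slice_generated charK0 hp (isT : (0 < 2)%N) hblk (oner_neq0 K) T1 (unitmx1 _ _)
  congr_det d1 det_blk form_D det_D kernel_O form_O EMX EMY uPX uPY SO_form (@SO_det MX)
  (@SO_det MY) SO_fix (SG := @signed_gen K p) pf invf).
  apply: (torus_signed_generated charK0).
  - exact: slice_polyfun.
  - exact: (slice_torus det_D EMX EMY uPX uPY SO_conj invf).
  - exact: (slice_symmetric EMX EMY uPX uPY SO_conj perm_O invf).
  (* The sign matrix with -1 at i and j has determinant 1 and preserves the standard form.
     Transported to Y and acting there alone, it changes the signs of r_i and r_j and leaves all t_k
     fixed. *)
  move=> i j hi hj ne x; pose s : nat -> K := upd (upd (fun=> 1) i (-1)) j (-1).
  have s2 k : s k * s k = 1.
    by rewrite /s /upd; case: eqP => _; [|case: eqP => _]; rewrite ?mulrNN mulr1.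
  have dN : \det (D s) = 1.
    rewrite det_D (bigD1 (Ordinal hi)) //= (bigD1 (Ordinal hj)) /=; last by rewrite -val_eqE /= eq_sym.
    rewrite {1 2}/s /upd !eqxx (negbTE ne) big1 ?mulr1 ?mulrNN ?mulr1 // => k.
    by rewrite /s /upd -!val_eqE /= => /andP[/negbTE -> /negbTE ->].
  have fN : (D s)^T *m 1%:M *m D s = 1%:M.
    rewrite mulmx1 dmxT DM DE -diag_const_mx; congr diag_mx; apply/rowP => k.
    by rewrite !mxE s2.
  rewrite -[RHS](slice_inv blk one PX PY x invf (det1 _ _) (SO_conj EMY uPY fN dN) (SO1 MX)) invmx1 !mulmx1 !mul1mx.
  congr f; congr pair; apply: functional_extensionality => _ /=.
  rewrite -!mulmxA mulKVmx // DM; congr (_ *m dmx _ _ _); apply: functional_extensionality => k.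
  rewrite /s /upd; case: (eqVneq k i) => [->|_].
    by rewrite (negbTE ne) mulN1r.
  by case: (eqVneq k j) => [->|_]; rewrite ?mulN1r ?mul1r.
have hd1 : gen_alg (path_gens (det_coef MX MY) (kh := 1) (lh := 1)) (fun V => \det (V.1 ord0)).
  by apply: alg_gen; left; exists ord0.
have hd2 : gen_alg (path_gens (det_coef MX MY) (kh := 1) (lh := 1)) (fun V => \det (V.2 ord0)).
  by apply: alg_gen; right; left; exists ord0.
have dinv (P : 'M[K]_p) (r : nat -> K) : P \in unitmx -> \prod_(i < p) r i = \det P * \det (invmx P *m D r).
  by move=> uP; rewrite det_mulmx det_inv mulrA divff ?mul1r ?det_D // -unitfE -unitmxE.
move=> g [->|->|[i ->]].
- by exists (fun V => \det PY * \det (V.1 ord0)) => [|x]; [apply: gen_algZ|apply: dinv].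
- by exists (fun V => \det PX * \det (V.2 ord0)) => [|x]; [apply: gen_algZ|apply: dinv].
exists (fun V => det_coef MX MY i (pathmx V.1) (pathmx V.2)).
  by apply: alg_gen; right; right; exists i.
move=> x; rewrite !pathmx1; have := pencil_coef_slice det_blk form_D EMX EMY uPX uPY i x.
by rewrite det_altsum det1 mul1r => <-.
Qed.

End Orthogonal.

(** * Pfaffians and skew-symmetric forms *)

Section PfaffianSum.
Variable p : nat.
Hypothesis ep : ~~ odd p.
Local Notation q := p./2.

Definition pf_rho1 (s : 'S_p) (i : 'I_q) := s (pf_fst i).
Definition pf_rho2 (s : 'S_p) (i : 'I_q) := s (pf_snd i).
Local Notation pfs := (altsum pf_rho1 pf_rho2).

Lemma half_ord_lt (j : 'I_p) : (j./2 < q)%N.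
Proof. have := ltn_ord j; lia. Qed.

Definition half_ord (j : 'I_p) : 'I_q := Ordinal (half_ord_lt j).

Lemma half_fst (i : 'I_q) : half_ord (pf_fst i) = i.
Proof. by apply: val_inj => /=; lia. Qed.

Lemma half_snd (i : 'I_q) : half_ord (pf_snd i) = i.
Proof. by apply: val_inj => /=; lia. Qed.

Lemma odd_pf_fst (i : 'I_q) : odd (pf_fst i) = false. Proof. by rewrite /= odd_double. Qed.
Lemma odd_pf_snd (i : 'I_q) : odd (pf_snd i) = true. Proof. by rewrite /= odd_double. Qed.

Lemma pf_ordE (j : 'I_p) : j = if odd j then pf_snd (half_ord j) else pf_fst (half_ord j).
Proof. by apply: val_inj; case: ifP => /= oj; lia. Qed.

Lemma prod_pairs (R : comPzRingType) (F : 'I_p -> R) :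
  \prod_j F j = \prod_(i < q) (F (pf_fst i) * F (pf_snd i)).
Proof.
rewrite big_split /= (bigID (fun j : 'I_p => odd j)) /= mulrC; congr (_ * _).
  rewrite (reindex (@pf_fst p)) /=; first by apply: eq_bigl => i; rewrite odd_double.
  exists half_ord => i; first by move=> _; apply: half_fst.
  by rewrite inE => oi; rewrite [RHS]pf_ordE ifN.
rewrite (reindex (@pf_snd p)) /=; first by apply: eq_bigl => i; rewrite odd_double.
exists half_ord => i; first by move=> _; apply: half_snd.
by rewrite inE => oi; rewrite [RHS]pf_ordE oi.
Qed.

Section Congruence.
Variable R : comNzRingType.
Implicit Types X M : 'M[R]_p.

Lemma det_row_select X (phi : {ffun 'I_p -> 'I_p}) :
  \sum_(s : 'S_p) (-1) ^+ odd_perm s * \prod_j X (phi j) (s j) =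
  \det (\matrix_(i, j) X (phi i) j).
Proof. by apply: eq_bigr => s _; congr (_ * _); apply: eq_bigr => j _; rewrite mxE. Qed.

(** As for multiplicativity of the determinant: expand over all maps phi of the indices. The sum
    over permutations becomes the determinant of the rows of X selected by phi, which is 0 unless
    phi is a permutation and else its sign times det X. *)
Lemma pfs_congr X M : pfs (X^T *m M *m X) = \det X * pfs M.
Proof.
pose t (phi : {ffun 'I_p -> 'I_p}) := \prod_(i < q) M (phi (pf_fst i)) (phi (pf_snd i)).
transitivity (\sum_(phi : {ffun 'I_p -> 'I_p}) t phi * \det (\matrix_(i, j) X (phi i) j)).
  under [RHS]eq_bigr => phi _ do rewrite -det_row_select big_distrr /=.
  rewrite exchange_big; apply: eq_bigr => s _ /=.
  under [RHS]eq_bigr => phi _ do rewrite mulrCA.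
  rewrite -big_distrr /=; congr (_ * _).
  pose Y i (ab : 'I_p * 'I_p) := M ab.1 ab.2 * (X ab.1 (s (pf_fst i)) * X ab.2 (s (pf_snd i))).
  transitivity (\prod_(i < q) \sum_(ab : 'I_p * 'I_p) Y i ab).
    apply: eq_bigr => i _; rewrite -(pair_bigA _ (fun a b => Y i (a, b))) /= /pf_rho1 /pf_rho2 !mxE.
    rewrite exchange_big; apply: eq_bigr => b _; rewrite mxE big_distrl /=.
    by apply: eq_bigr => a _; rewrite !mxE /Y /=; ring.
  rewrite bigA_distr_bigA /=.
  (* Since p = 2q, a choice of a pair of indices for each i < q is the same as a map on all p
     indices. *)
  rewrite (reindex (fun phi : {ffun 'I_p -> 'I_p} => [ffun i => (phi (pf_fst i), phi (pf_snd i))])) /=; last first.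
    exists (fun f : {ffun 'I_q -> 'I_p * 'I_p} =>
       [ffun j : 'I_p => if odd j then (f (half_ord j)).2 else (f (half_ord j)).1]) => f _.
      by apply/ffunP => j; rewrite ffunE !ffunE /= [in RHS](pf_ordE j); case: ifP.
    apply/ffunP => i; rewrite ffunE [in LHS]ffunE odd_pf_fst [in LHS]ffunE odd_pf_snd.
    by rewrite half_fst half_snd -surjective_pairing.
  apply: eq_bigr => phi _; rewrite /t prod_pairs -big_split /=.
  by apply: eq_bigr => i _; rewrite ffunE.
rewrite (bigID (fun f : {ffun 'I_p -> 'I_p} => injectiveb f)) /= addrC big1 ?add0r => [|f Uf]; last first.
  have [i1 [i2 [Di12 Ef12]]] : exists i1 i2, i1 != i2 /\ f i1 = f i2.
    have /injectivePn[i1 [i2 Ei12 Df12]] := Uf; by exists i1, i2.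
  rewrite (determinant_alternate Di12) ?mulr0 // => j.
  by rewrite -!/(fun_of_matrix _ _ _) !mxE Ef12.
rewrite (reindex (@pval _)) /=; last first.
  pose in_Sn := insubd (1%g : 'S_p).
  by exists in_Sn => /= f Uf; first apply: val_inj; apply: insubdK.
rewrite big_distrr /=; apply: eq_big => [s|s _]; first by rewrite (valP s).
have -> : \matrix_(i, j) X (pval s i) j = row_perm s X by apply/matrixP => i j; rewrite !mxE pvalE.
rewrite row_permE det_mulmx det_perm.
have -> : t (pval s) = \prod_(i < q) M (pf_rho1 s i) (pf_rho2 s i).
  by apply: eq_bigr => i _; rewrite !pvalE.
by rewrite mulrC -mulrA mulrCA.
Qed.

End Congruence.

Definition partner (j : 'I_p) : 'I_p := if odd j then pf_fst (half_ord j) else pf_snd (half_ord j).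

Lemma partnerK : involutive partner.
Proof.
move=> j; rewrite {2}/partner; case: ifP => oj; rewrite /partner ?odd_pf_fst ?odd_pf_snd.
  by rewrite half_fst [RHS]pf_ordE oj.
by rewrite half_snd [RHS]pf_ordE oj.
Qed.

Lemma odd_partner j : odd (partner j) = ~~ odd j.
Proof. by rewrite /partner; case: ifP => oj; rewrite ?odd_pf_fst ?odd_pf_snd. Qed.

(* Such a permutation is a product [a * b], with [a] acting on the even and [b] on the
   odd positions, and [partner] conjugates [a] into [b]. *)
Lemma pair_perm_even (s : 'S_p) :
  (forall j, odd (s j) = odd j) -> (forall j, s (partner j) = partner (s j)) -> odd_perm s = false.
Proof.
move=> so sp.
have inj_a : injective (fun j : 'I_p => if odd j then j else s j).
  move=> i j; case: ifP => oi; case: ifP => oj // E; last exact: perm_inj E.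
    by move: oi; rewrite E so oj.
  by move: oj; rewrite -E so oi.
have inj_b : injective (fun j : 'I_p => if odd j then s j else j).
  move=> i j; case: ifP => oi; case: ifP => oj // E; first exact: perm_inj E.
    by move: oj; rewrite -E so oi.
  by move: oi; rewrite E so oj.
have -> : s = (perm inj_a * perm inj_b)%g.
  by apply/permP => j; rewrite permM !permE; case oj: (odd j); rewrite ?so oj.
have -> : perm inj_b = (perm inj_a ^ perm (inv_inj partnerK))%g.
  rewrite -(mulKg (perm (inv_inj partnerK)) (perm inj_b)) conjgE; congr (_ * _)%g.
  apply/permP => j; rewrite !permM !permE odd_partner.
  by case: (odd j); rewrite ?sp.
by rewrite odd_permM odd_permJ addbb.
Qed.

Section Skew.
Variable K : fieldType.

(** Block diagonal with blocks (0, a; -a, 0) on the indices 2i and 2i + 1; the difference of the two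
    comparisons supplies the sign. *)
Definition skewmx n (a : nat -> K) : 'M[K]_n :=
  \matrix_(i, j) (if i./2 == j./2 then a i./2 * ((i < j)%N%:R - (j < i)%N%:R) else 0).
Local Notation J := (skewmx p (fun=> 1)).

Lemma skewT n a : (skewmx n a)^T = -1 *: skewmx n a.
Proof.
apply/matrixP => i j; rewrite !mxE eq_sym; case: eqP => [->|_]; last by rewrite mulr0.
ring.
Qed.

Lemma J_partner i j : J i j != 0 -> j = partner i /\ J i j = if odd i then -1 else 1.
Proof.
rewrite mxE; have [Eh|_] := eqVneq i./2 j./2; last by rewrite eqxx.
case: (ltngtP i j) => [lt|lt|E]; last by rewrite subrr mulr0 eqxx.
  have oi : odd i = false by lia.
  move=> _; rewrite oi subr0 mulr1; split=> //.
  by apply: val_inj; rewrite /partner oi /=; lia.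
have oi : odd i by lia.
move=> _; rewrite oi sub0r mulrN1; split=> //.
by apply: val_inj; rewrite /partner oi /=; lia.
Qed.

Lemma J_skew i j : J j i = - J i j.
Proof. by rewrite !mxE eq_sym; case: eqP => _; [ring|rewrite oppr0]. Qed.

Let pf_prod (s : 'S_p) := \prod_(i < q) J (pf_rho1 s i) (pf_rho2 s i).

(** Induction on the number of pairs that s reverses. Composing with the transposition of such a
    pair changes both the sign and the product; when none is left, the product is 1 and s is
    even. *)
Lemma pf_term s : pf_prod s != 0 -> (-1) ^+ odd_perm s * pf_prod s = 1.
Proof.
have [n] := ubnP #|[pred i : 'I_q | odd (s (pf_fst i))]|.
elim: n s => // n IH s; rewrite ltnS => le ps.
have good i : s (pf_snd i) = partner (s (pf_fst i)) /\
    J (pf_rho1 s i) (pf_rho2 s i) = if odd (s (pf_fst i)) then -1 else 1.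
  by apply: J_partner; have /prodf_neq0 := ps; apply.
have [/existsP[i oi]|/existsPn ne] := boolP [exists i : 'I_q, odd (s (pf_fst i))].
  pose s1 := (tperm (pf_fst i) (pf_snd i) * s)%g.
  have s1i : s1 (pf_fst i) = s (pf_snd i) /\ s1 (pf_snd i) = s (pf_fst i).
    by rewrite !permM tpermL tpermR.
  have s1k k : k != i -> s1 (pf_fst k) = s (pf_fst k) /\ s1 (pf_snd k) = s (pf_snd k).
    by move=> ki; split; rewrite permM tpermD // -val_eqE /=; move: ki; rewrite -val_eqE /=; lia.
  have E : pf_prod s1 = - pf_prod s.
    rewrite /pf_prod (bigD1 i) //= [in RHS](bigD1 i) //= -mulNr; congr (_ * _).
      by rewrite /pf_rho1 /pf_rho2 s1i.1 s1i.2 J_skew.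
    by apply: eq_bigr => k /s1k[e1 e2]; rewrite /pf_rho1 /pf_rho2 e1 e2.
  have neq : pf_fst i != pf_snd i by rewrite -val_eqE /=; lia.
  suff lt : (#|[pred i : 'I_q | odd (s1 (pf_fst i))]| < n)%N.
    have := IH s1 lt; rewrite E oppr_eq0 ps odd_mul_tperm neq => /(_ isT).
    by case: (odd_perm s); rewrite /= ?expr0 ?expr1 ?mul1r ?mulN1r ?opprK.
  apply: leq_trans le; apply: proper_card; apply/properP; split; last first.
    exists i; rewrite ?inE //= s1i.1 (good i).1 odd_partner oi //.
  apply/subsetP => k; rewrite !inE /=; have [->|/s1k[-> //]] := eqVneq k i.
  by rewrite s1i.1 (good i).1 odd_partner oi.
have -> : pf_prod s = 1 by apply: big1 => i _; rewrite (good i).2 (negbTE (ne i)).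
have sp j : s (partner j) = partner (s j).
  rewrite {2}[j]pf_ordE /partner; case: (odd j); last exact: (good _).1.
  by rewrite (good _).1 -/(partner _) partnerK.
rewrite pair_perm_even ?expr0 ?mulr1 // => j.
rewrite {1}[j]pf_ordE; case: ifP => oj; last exact: negbTE (ne _).
by rewrite (good _).1 odd_partner ne.
Qed.

(** All nonzero terms are 1, so the sum counts permutations, the identity among them. *)
Lemma pfs_J_neq0 : [pchar K] =i pred0 -> pfs J != 0.
Proof.
move=> charK0; have -> : pfs J = (#|[pred s | pf_prod s != 0]|)%:R.
  rewrite -sum1_card natr_sum big_mkcond /=; apply: eq_bigr => s _.
  by case: ifP => [/pf_term //|/negbFE/eqP E]; rewrite -/(pf_prod s) E mulr0.
rewrite (pcharf0P K).1 // -lt0n; apply/card_gt0P; exists 1%g; rewrite inE.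
apply/prodf_neq0 => i _; rewrite /pf_rho1 /pf_rho2 !perm1 mxE /=.
rewrite ifT; last by apply/eqP; lia.
by rewrite ltnSn ltnNge leqnSn subr0 mulr1 oner_neq0.
Qed.

End Skew.

Section SkewScaling.
Variable R : comNzRingType.

Definition pair_diag (y : nat -> R) : 'M[R]_p := diag_mx (\row_j (if odd j then 1 else y j./2)).
(** The form J over any ring, as it is also needed over [{poly K}]. *)
Definition pair_form : 'M[R]_p :=
  \matrix_(i, j) (if i./2 == j./2 then (i < j)%N%:R - (j < i)%N%:R else 0).

Lemma pair_diag_form y : pair_diag y *m pair_form *m pair_diag y =
  diag_mx (\row_j y j./2) *m pair_form.
Proof.
apply/matrixP => i j; rewrite /pair_diag mul_mx_diag !mul_diag_mx !mxE.
have [Eh|_] := eqVneq i./2 j./2; last by rewrite !mulr0 mul0r.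
case: (ltngtP i j) => [lt|lt|E]; last by rewrite subrr !mulr0 mul0r.
  have -> : odd i = false by lia.
  have -> : odd j by lia.
  by rewrite mulr1.
have -> : odd i by lia.
have -> : odd j = false by lia.
by rewrite mul1r mulrC Eh.
Qed.

Lemma det_pair_diag y : \det (pair_diag y) = \prod_(i < q) y i.
Proof.
rewrite det_diag prod_pairs; apply: eq_bigr => i _.
by rewrite !mxE odd_pf_fst odd_pf_snd mulr1 /= doubleK.
Qed.

Lemma pfs_pair_diag y : pfs (diag_mx (\row_j y j./2) *m pair_form) = \prod_(i < q) y i * pfs pair_form.
Proof.
by rewrite -pair_diag_form -det_pair_diag -pfs_congr tr_diag_mx.
Qed.

End SkewScaling.

Section SymplecticForms.
Variable K : closedFieldType.
Hypothesis charK0 : [pchar K] =i pred0.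
Definition oneS : pred 'I_p := fun j => odd j.
Definition blkS (j : 'I_p) : nat := j./2.
Local Notation J := (pair_form K).
Local Notation D := (dmx blkS oneS).

Lemma pair_formE : J = skewmx p (fun=> 1).
Proof. by apply/matrixP => i j; rewrite !mxE; case: ifP => _; rewrite ?mul1r. Qed.

Lemma map_pair_form : map_mx polyC J = pair_form {poly K}.
Proof.
apply/matrixP => i j; rewrite !mxE; case: ifP => _; last by rewrite polyC0.
by rewrite rmorphB !rmorph_nat.
Qed.

Lemma skewmx_diag a : skewmx p a = diag_mx (\row_j a j./2) *m J.
Proof.
apply/matrixP => i j; rewrite mul_diag_mx !mxE; case: ifP => _ //.
by rewrite mulr0.
Qed.

Lemma DJD_skew (r : nat -> K) : D r *m J *m D r = skewmx p r.
Proof. by rewrite skewmx_diag -pair_diag_form. Qed.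

Lemma pair_formT : J^T = -1 *: J.
Proof. by rewrite pair_formE skewT. Qed.

Lemma pfs_pair_form : pfs J != 0.
Proof. by rewrite pair_formE; apply: pfs_J_neq0. Qed.

Lemma pair_form_unit : J \in unitmx.
Proof.
suff: J *m J = (-1)%:M.
  move=> E; rewrite unitmxE; have := congr1 determinant E; rewrite det_mulmx det_scalar => E'.
  rewrite unitfE; apply/negP => /eqP d0; move/eqP: E'.
  by rewrite d0 mul0r eq_sym expf_eq0 oppr_eq0 oner_eq0 andbF.
apply/matrixP => i j; rewrite !mxE (bigD1 (partner i)) //= big1 => [|k ne]; last first.
  have [-> |/eqP] := eqVneq (J i k) 0; first by rewrite mul0r.
  by rewrite pair_formE => /eqP /J_partner[E _]; rewrite E eqxx in ne.
have JP k : J k (partner k) = if odd k then -1 else 1.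
  have : J k (partner k) != 0.
    rewrite mxE /partner; case ok : (odd k) => /=.
      rewrite ifT; last by apply/eqP; lia.
      have -> : (k < k./2.*2)%N = false by lia.
      have -> : (k./2.*2 < k)%N by lia.
      by rewrite sub0r oppr_eq0 oner_neq0.
    rewrite ifT; last by apply/eqP; lia.
    have -> : (k < k./2.*2.+1)%N by lia.
    have -> : (k./2.*2.+1 < k)%N = false by lia.
    by rewrite subr0 oner_neq0.
  by rewrite pair_formE => /J_partner[].
rewrite addr0; have [<-|ne] := eqVneq i j.
  rewrite JP; have := JP (partner i); rewrite partnerK odd_partner => ->.
  by case: (odd i); rewrite /= ?mulN1r ?mul1r ?mulr1 mulr1n.
rewrite mulr0n; apply/eqP; rewrite mulf_eq0; apply/orP; right.
apply: contraNT ne; rewrite pair_formE => /J_partner[-> _]; by rewrite partnerK.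
Qed.

(** In the normal form a zero Pfaffian makes some a_i vanish, and then both basis vectors of that
    block lie in the kernel. *)
Lemma skew_kernel (M : 'M[K]_p) g a : g \in unitmx -> g *m M *m g^T = skewmx p a -> pfs M = 0 ->
  exists i : 'I_q, row (pf_fst i) g *m M = 0 /\ row (pf_snd i) g *m M = 0.
Proof.
move=> ug E pM.
have : pfs (g^T^T *m M *m g^T) = 0 by rewrite pfs_congr pM mulr0.
rewrite trmxK E skewmx_diag pfs_pair_diag => /eqP.
rewrite mulf_eq0 (negbTE pfs_pair_form) orbF => /prodf_eq0[i _ /eqP ai].
have H (k : 'I_p) : k./2 = i -> row k g *m M = 0.
  move=> Ek; have ugT : g^T \in unitmx by rewrite unitmx_tr.
  apply: (can_inj (mulmxK ugT)); rewrite -!row_mul mul0mx E.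
  apply/rowP => j; rewrite !mxE Ek; case: ifP => _ //; by rewrite ai mul0r.
by exists i; split; apply: H => /=; lia.
Qed.

End SymplecticForms.
End PfaffianSum.

(** If M i j is nonzero, e_i and e_j span a nondegenerate plane; split it off and continue on its
    complement. *)
Lemma skew_normal (K : closedFieldType) n (M : 'M[K]_n) : [pchar K] =i pred0 -> ~~ odd n ->
  M^T = -1 *: M -> exists2 g, g \in unitmx & exists a, g *m M *m g^T = skewmx n a.
Proof.
move=> charK0; have [m] := ubnP n; elim: m n M => // m IH [|[|n]] M lt en MT //.
  by exists 1%:M; [apply: unitmx1|exists (fun=> 0); apply/matrixP => -[]].
have [->|/matrix0Pn[i [j Mij]]] := eqVneq M 0.
  exists 1%:M; first exact: unitmx1; exists (fun=> 0); rewrite mulmx0 mul0mx.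
  by apply/matrixP => i j; rewrite !mxE mul0r if_same.
have skew a b : M a b = - M b a by have /matrixP/(_ b a) := MT; rewrite !mxE mulN1r => ->.
have diag0 a : M a a = 0 by apply: (eqN0 charK0); apply: skew.
pose A : 'M[K]_(2, n.+2) := \matrix_k delta_mx 0 (if k == 0 then i else j).
have EA k l : (A *m M *m A^T) k l = M (if k == 0 then i else j) (if l == 0 then i else j).
  have -> : (A *m M *m A^T) k l = (col l (row k (A *m M *m A^T))) 0 0 by rewrite !mxE.
  by rewrite !row_mul colE -mulmxA -colE -tr_row !rowK bilinear_delta.
set x := M i j in Mij.
have uA : A *m M *m A^T \in unitmx.
  (* The Gram matrix of e_i, e_j is x times (0, 1; -1, 0), so its square is -x^2. *)
  have : (A *m M *m A^T) *m (- (x ^+ 2)^-1 *: (A *m M *m A^T)) = 1%:M.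
    apply/matrixP => k l; rewrite mxE !big_ord_recl big_ord0 [_ 0 l]mxE [_ (lift _ _) l]mxE !EA /=.
    rewrite mxE; case: k => [[|[|k]] hk] //; case: l => [[|[|l]] hl] //=;
    rewrite ?diag0 -?/x ?(skew j i) -?/x; field; exact: Mij.
  by case/mulmx1_unit.
have [|g [C [ug Eg [a Ea]]]] := @split_form_ind K 2 n M (-1) A (fun C => exists a, C = skewmx n a) MT uA.
  move=> C CT; have [||h uh [a Eh]] := IH n C _ _ CT.
  - by rewrite ltnS in lt; apply: leq_trans lt.
  - by move: en; rewrite /= negbK.
  - by exists h => //; exists a.
exists g => //; exists (fun k => if k is k'.+1 then a k' else x); rewrite Eg Ea.
apply/matrixP => k l; rewrite [RHS]mxE.
case: (split_ordP (k : 'I_(2 + n))) => k' ->; case: (split_ordP (l : 'I_(2 + n))) => l' ->.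
- refine (etrans (@block_mxEul _ 2 n 2 n _ _ _ _ k' l') _); rewrite EA.
  case: k' => [[|[|k']] hk] //; case: l' => [[|[|l']] hl] //=;
  rewrite ?diag0 -?/x ?(skew j i) -?/x; ring.
- refine (etrans (@block_mxEur _ 2 n 2 n _ _ _ _ k' l') _); rewrite mxE.
  by case: k' => [[|[|k']] hk].
- refine (etrans (@block_mxEdl _ 2 n 2 n _ _ _ _ k' l') _); rewrite mxE.
  by case: l' => [[|[|l']] hl].
- refine (etrans (@block_mxEdr _ 2 n 2 n _ _ _ _ k' l') _); rewrite mxE.
  by [].
Qed.

(** * The symplectic case *)

Section Symplectic.
Variables (K : closedFieldType) (p' : nat).
Local Notation p := p'.+2.
Local Notation q := p./2.
Hypotheses (charK0 : [pchar K] =i pred0) (ep : ~~ odd p).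

Local Notation J := (pair_form p K).
Local Notation D := (dmx (@blkS p) (@oneS p)).
Local Notation pfs := (altsum (@pf_rho1 p) (@pf_rho2 p)).

Lemma symplectic_basis (M : 'M[K]_p) : M^T = -1 *: M -> M \in unitmx ->
  exists2 P : 'M[K]_p, P \in unitmx & M = P^T *m J *m P.
Proof.
move=> MT uM; have [g ug [a Eg]] := skew_normal charK0 ep MT.
have E : g *m M *m g^T = D a *m J *m D a by rewrite DJD_skew.
have uD : D a \in unitmx.
  have : g *m M *m g^T \in unitmx by rewrite !unitmx_mul unitmx_tr ug uM.
  by rewrite E !unitmx_mul => /andP[].
exists (D a *m (invmx g)^T); first by rewrite unitmx_mul uD unitmx_tr unitmx_inv.
rewrite trmx_mul trmxK dmxT !mulmxA -(mulmxA _ (D a) J) -(mulmxA _ _ (D a)) -E.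
by rewrite !mulmxA mulVmx // mul1mx -mulmxA -trmx_mul mulVmx // trmx1 mulmx1.
Qed.

Let congr_pf (R : comNzRingType) (X M : 'M[R]_p) : pfs (X^T *m M *m X) = \det X ^+ 1 * pfs M.
Proof. by rewrite pfs_congr. Qed.

Let pf_blk (y : nat -> {poly K}) :
  pfs (diag_mx (\row_j y (blkS j)) *m map_mx polyC J) = \prod_(i < q) y i * (pfs J)%:P.
Proof. by rewrite -map_altsum map_pair_form -pfs_pair_diag. Qed.

Let form_D (r : nat -> K) : D r *m J *m D r = diag_mx (\row_j r (blkS j) ^+ 1) *m J.
Proof. exact: pair_diag_form. Qed.

Let det_D (r : nat -> K) : \det (D r) = \prod_(i < q) r i.
Proof. exact: det_pair_diag. Qed.

Let blk_lt (j : 'I_p) : (blkS j < q)%N. Proof. exact: half_ord_lt. Qed.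

Let kernel_S (M : 'M[K]_p) : M^T = -1 *: M -> pfs M = 0 -> forall i, (i < q)%N ->
  exists N : 'I_p -> 'rV[K]_p, (forall j, N j *m M = 0) /\
   forall u : 'rV[K]_p, (forall j, blkS j != i -> u 0 j = 0) -> \sum_j u 0 j *: N j = 0 -> u = 0.
Proof.
move=> MT pM i hi; have [g ug [a Eg]] := skew_normal charK0 ep MT.
have [k [k1 k2]] := skew_kernel ep charK0 ug Eg pM.
(* The two kernel vectors, found in block k, serve every block i, one for the even and one for the
   odd index. They are independent as rows of the invertible g. *)
exists (fun j => if odd j then row (pf_snd k) g else row (pf_fst k) g); split=> [j|u hu].
  by case: ifP.
pose i0 := Ordinal hi.
rewrite (bigD1 (pf_fst i0)) //= (bigD1 (pf_snd i0)) /=; last by rewrite -val_eqE /=; lia.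
rewrite big1 => [|j /andP[n1 n2]]; last first.
  rewrite hu ?scale0r //; apply: contraNneq n1 => E; move: n2; rewrite -!val_eqE /= /blkS in E *; lia.
rewrite !odd_double /= addr0 !rowE !scalemxAl -mulmxDl.
rewrite -[X in _ = X -> _](mul0mx _ g) => /(can_inj (mulmxK ug))/rowP E.
have Ef := E (pf_fst k); have Es := E (pf_snd k).
have n1 : (pf_fst k == pf_snd k :> 'I_p) = false by rewrite -val_eqE /=; lia.
have n2 : (pf_snd k == pf_fst k :> 'I_p) = false by rewrite -val_eqE /=; lia.
move: Ef Es; rewrite !mxE !eqxx n1 n2 /= !mulr1 !mulr0 addr0 add0r => u1 u2.
apply/rowP => j; rewrite mxE; have [E'|] := eqVneq (blkS j) i; last exact: hu.
rewrite [j](pf_ordE ep); have -> : half_ord ep j = i0 by apply: val_inj.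
by case: ifP.
Qed.

Let form_S (M : 'M[K]_p) : M^T = -1 *: M ->
  (forall i j, blkS i != blkS j -> M i j = 0) -> exists t, M = D t *m J *m D t.
Proof.
move=> MT hM.
have skew a b : M a b = - M b a by have /matrixP/(_ b a) := MT; rewrite !mxE mulN1r => ->.
have diag0 a : M a a = 0 by apply: (eqN0 charK0); apply: skew.
exists (fun k => M (inord k.*2) (inord k.*2.+1)); rewrite DJD_skew //.
apply/matrixP => i j; rewrite mxE; have [Eh|ne] := eqVneq i./2 j./2; last exact: hM.
have hi := ltn_ord i; have hj := ltn_ord j.
case: (ltngtP i j) => [lt|lt|/val_inj ->]; last by rewrite diag0 subrr mulr0.
  rewrite subr0 mulr1; congr (M _ _); apply: val_inj; rewrite /= inordK //; lia.
rewrite sub0r mulrN1 skew; congr (- M _ _); apply: val_inj; rewrite /= inordK //; lia.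
Qed.

Let Sp_form (M h : 'M[K]_p) : Spm M h -> h^T *m M *m h = M. Proof. by []. Qed.

(** Taking Pfaffians in h^T M h = M gives det h * pf M = pf M with pf M nonzero. *)
Lemma Sp_det (M h : 'M[K]_p) : M^T = -1 *: M -> M \in unitmx -> Spm M h -> \det h = 1.
Proof.
move=> MT uM Eh; have [P uP EM] := symplectic_basis MT uM.
have pM : pfs M != 0.
  rewrite EM pfs_congr // mulf_neq0 ?pfs_pair_form //.
  by rewrite -unitfE -unitmxE.
by apply: (mulIf pM); rewrite -pfs_congr // mul1r Eh.
Qed.

Let Sp_conj (M P N : 'M[K]_p) : M = P^T *m J *m P -> P \in unitmx ->
  N^T *m J *m N = J -> \det N = 1 -> Spm M (invmx P *m N *m P).
Proof. by move=> EM uP EN _; apply: conj_form EM uP EN. Qed.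

Let Sp_fix (M P h X : 'M[K]_p) r : M = P^T *m J *m P -> P \in unitmx ->
  h^T *m M *m h = M -> h *m X = invmx P *m D r ->
  exists h' r', Spm M h' /\ h' *m X = invmx P *m D r'.
Proof. by move=> _ _ Eh EX; exists h, r. Qed.

Let perm_S i j : (i < q)%N -> (j < q)%N -> exists N : 'M[K]_p,
  [/\ \det N = 1, N^T *m J *m N = J & forall r, N *m D r = D (fun k => r (transp i j k)) *m N].
Proof.
move=> hi hj; pose a := Ordinal hi; pose b := Ordinal hj.
(* Exchanging two blocks takes two transpositions, so no sign correction is needed. *)
pose t := (tperm (pf_fst a) (pf_fst b) * tperm (pf_snd a) (pf_snd b))%g : 'S_p.
have tE (x : 'I_p) : t x = (transp i j x./2).*2 + odd x :> nat.
  have tL : transp i j i = j by rewrite /transp eqxx.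
  have tR : transp i j j = i by rewrite /transp eqxx; case: eqP.
  have h0 k : (k.*2)./2 = k by lia.
  rewrite /t permM; case: (tpermP (pf_fst a) (pf_fst b) x) => [->|->|/eqP n1 /eqP n2].
  - rewrite tpermD -?val_eqE /= ?h0 ?tL ?odd_double ?addn0 //; lia.
  - rewrite tpermD -?val_eqE /= ?h0 ?tR ?odd_double ?addn0 //; lia.
  - move: n1 n2; rewrite -!val_eqE /= => n1 n2.
    case: (tpermP (pf_snd a) (pf_snd b) x) => [->|->|/eqP n3 /eqP n4].
    + by rewrite odd_pf_snd (_ : (pf_snd a)./2 = i) ?tL ?addn1 //=; lia.
    + by rewrite odd_pf_snd (_ : (pf_snd b)./2 = j) ?tR ?addn1 //=; lia.
    + move: n3 n4; rewrite -!val_eqE /= => n3 n4.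
      rewrite /transp !ifN; lia.
have th (x : 'I_p) : (t x)./2 = transp i j x./2 by rewrite tE; lia.
have to (x : 'I_p) : odd (t x) = odd x by rewrite tE; lia.
have Jt x y : J (t x) (t y) = J x y.
  rewrite !mxE !th (inj_eq (can_inj (transpK i j))); case: eqP => // Eh.
  rewrite !tE Eh !ltn_add2l.
  have -> : (x < y)%N = (odd x < odd y)%N by lia.
  by have -> : (y < x)%N = (odd y < odd x)%N by lia.
exists (perm_mx t); split=> [||r].
- rewrite det_perm odd_permM !odd_tperm -!val_eqE /=.
  by rewrite eqSS; case: (_ == _); rewrite expr0.
- rewrite tr_perm_mx -row_permE -{2}(invgK t) -col_permE.
  by apply/matrixP => x y; rewrite mxE [LHS]mxE -Jt !permKV.
- apply/matrixP => x y; rewrite /dmx mul_mx_diag mul_diag_mx !mxE /oneS /blkS.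
  have [E|_] := eqVneq (t x) y; last by rewrite mul0r mulr0.
  by rewrite mul1r mulr1 -E to th.
Qed.

Definition pf_coef (MX MY : 'M[K]_p) i (U W : 'M[K]_p) : K :=
  (pfs (upencil (W^T *m MX *m W) (U^T *m MY *m U)))`_i.

Lemma Sp_path_gens (MX MY : 'M[K]_p) : MX^T = -1 *: MX -> MY^T = -1 *: MY ->
  MX \in unitmx -> MY \in unitmx ->
  forall kh lh (f : Rep K p kh.+1 lh.+1 -> K),
  (polyfun f /\ si_invariant (Spm MX) (Spm MY) f) <->
  gen_alg (path_gens (pf_coef MX MY) (kh := kh.+1) (lh := lh.+1)) f.
Proof.
move=> MXT MYT uMX uMY kh lh f.
have [PX uPX EMX] := symplectic_basis MXT uMX.
have [PY uPY EMY] := symplectic_basis MYT uMY.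
have Sp1 (M : 'M[K]_p) : Spm M 1%:M by rewrite /Spm trmx1 mul1mx mulmx1.
have detX h : Spm MX h -> \det h = 1 by apply: Sp_det.
have detY h : Spm MY h -> \det h = 1 by apply: Sp_det.
split=> [[pf invf]|hf]; last first.
  split.
    by apply: (gen_alg_comp (phi := id) _ hf) => g; apply: (@path_gens_polyfun K p q (@pf_rho1 p) (@pf_rho2 p)).
  move=> gx gy hG V; apply: (gen_alg_invariant _ hf) => g hg.
  have H := @path_gens_inv K p q 1 (@pf_rho1 p) (@pf_rho2 p) (@Spm K p) congr_pf MX MY Sp_form detX detY kh.+1 lh.+1 g isT isT hg.
  exact: H gx gy hG V.
move: kh lh f pf invf.
have hp : (0 < p)%N by [].
suff: si_generated (Spm MX) (Spm MY) (pf_coef MX MY) 1 1.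
  by move=> H kh lh; apply: (generated_all charK0 hp (Sp1 _) (Sp1 _) detX detY H).
move=> f pf invf.
have N1 : (-1 : K) != 0 by rewrite oppr_eq0 oner_neq0.
apply: (slice_generated (G := @Spm K p) (SG := @esym_gen K 1 q) charK0 hp (isT : (0 < 1)%N) blk_lt N1 (pair_formT p K)
  (pair_form_unit ep K) congr_pf (pfs_pair_form ep charK0) pf_blk form_D det_D kernel_S form_S
  EMX EMY uPX uPY Sp_form detX detY Sp_fix pf invf).
  apply: (torus_symmetric_generated charK0).
  - exact: slice_polyfun.
  - exact: (slice_torus det_D EMX EMY uPX uPY Sp_conj invf).
  - exact: (slice_symmetric EMX EMY uPX uPY Sp_conj perm_S invf).
move=> g [i ->].
exists (fun V => (pfs J)^-1 * pf_coef MX MY i (pathmx V.1) (pathmx V.2)).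
  by apply: gen_algZ; apply: alg_gen; right; right; exists i.
move=> x; rewrite !pathmx1; have := pencil_coef_slice pf_blk form_D EMX EMY uPX uPY i x.
rewrite -/(pf_coef _ _ _ _ _) => E; rewrite [pf_coef _ _ _ _ _]E mulrA mulVf ?mul1r //.
exact: pfs_pair_form.
Qed.

End Symplectic.

(** * Passage to the generators of the statement *)

Lemma gen_alg_mono (K : fieldType) T (G H : (T -> K) -> Prop) f :
  (forall g, G g -> gen_alg H g) -> gen_alg G f -> gen_alg H f.
Proof. by move=> h; apply: (gen_alg_comp (phi := id) h). Qed.

Lemma si_invariant_iff (K : fieldType) p kh lh (GX GX' GY GY' : 'M[K]_p -> Prop)
    (f : Rep K p kh lh -> K) : (forall A, GX A <-> GX' A) -> (forall A, GY A <-> GY' A) ->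
  si_invariant GX GY f <-> si_invariant GX' GY' f.
Proof.
by move=> hX hY; split=> hf gx gy [h1 [h2 [/hX h3 /hY h4]]]; apply: hf; split.
Qed.

Lemma form_scale (K : fieldType) p (c : K) (M A : 'M[K]_p) : c != 0 ->
  A^T *m (c *: M) *m A = c *: M <-> A^T *m M *m A = M.
Proof.
by move=> c0; rewrite -scalemxAr -scalemxAl; split=> [/(scalerI c0)|->].
Qed.

Lemma quad_scale (K : fieldType) p (c : K) (M W : 'M[K]_p) :
  c *: (W^T *m M *m W) = W^T *m (c *: M) *m W.
Proof. by rewrite -scalemxAr -scalemxAl. Qed.

Section Final.
Variable K : closedFieldType.
Hypothesis charK0 : [pchar K] =i pred0.

(** The signs of the path matrices are absorbed into the forms, and indices above the degree give
    the zero function. *)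
Lemma O_gens_iff p kh lh (MX MY : 'M[K]_p.+1) (f : Rep K p.+1 kh lh -> K) :
  gen_alg (path_gens (det_coef ((-1) ^+ lh *: MX) ((-1) ^+ kh *: MY)) (kh := kh) (lh := lh)) f <->
  gen_alg (O_gens MX MY) f.
Proof.
have E i V : (i <= p.+1)%N -> c_det MX MY i V =
    det_coef ((-1) ^+ lh *: MX) ((-1) ^+ kh *: MY) i (pathmx V.1) (pathmx (V : Rep K p.+1 kh lh).2).
  move=> le; rewrite /c_det /det_coef -!quad_scale.
  exact: (@bicoef_altsum K p.+1 p.+1 (fun _ i => i) (fun s i => s i)).
split; apply: gen_alg_mono => g [|[|[i]]].
- by move=> h; apply: alg_gen; left.
- by move=> h; apply: alg_gen; right; left.
- move=> ->; case: (leqP i p.+1) => le.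
    apply: alg_gen; right; right; exists i; split=> //.
    by apply: functional_extensionality => V; rewrite E.
  apply: gen_alg_ext (alg_const _ 0) _ => V; rewrite /det_coef nth_default //.
  apply: leq_trans le.
  exact: (@size_altsum_upencil K p.+1 p.+1 (fun _ i => i) (fun s i => s i)).
- by move=> h; apply: alg_gen; left.
- by move=> h; apply: alg_gen; right; left.
- move=> [le ->]; apply: alg_gen; right; right; exists i.
  by apply: functional_extensionality => V; rewrite E.
Qed.

Lemma Sp_gens_iff p kh lh (MX MY : 'M[K]_p.+2) (f : Rep K p.+2 kh lh -> K) :
  gen_alg (path_gens (pf_coef ((-1) ^+ lh *: MX) ((-1) ^+ kh *: MY)) (kh := kh) (lh := lh)) f <->
  gen_alg (Sp_gens MX MY) f.
Proof.
(* The normalising constant of [pfaff], invertible in characteristic 0; its inverse in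
   [{poly {poly K}}] is a constant. *)
pose N := (2 ^ (p.+2)./2 * ((p.+2)./2)`!)%N.
have N0 : N%:R != 0 :> K.
  by rewrite (pcharf0P K).1 // -lt0n muln_gt0 expn_gt0 fact_gt0.
have E i V : (i <= (p.+2)./2)%N -> c_pf MX MY i V =
    N%:R^-1 * pf_coef ((-1) ^+ lh *: MX) ((-1) ^+ kh *: MY) i (pathmx V.1) (pathmx (V : Rep K p.+2 kh lh).2).
  move=> le; rewrite /c_pf /pf_coef -!quad_scale -bicoef_altsum // /pfaff -/N /bicoef.
  have -> : (N%:R : {poly {poly K}})^-1 = ((N%:R^-1)%:P)%:P.
    have uN : (N%:R : K) \is a GRing.unit by rewrite unitfE.
    by rewrite !rmorphV ?rmorph_unit //= !rmorph_nat.
  by rewrite !coefCM.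
split; apply: gen_alg_mono => g [|[|[i]]].
- by move=> h; apply: alg_gen; left.
- by move=> h; apply: alg_gen; right; left.
- move=> ->; case: (leqP i (p.+2)./2) => le.
    apply: (@gen_alg_ext _ _ _ (fun V => N%:R * c_pf MX MY i V)).
      by apply: gen_algZ; apply: alg_gen; right; right; exists i.
    by move=> V; rewrite E // mulVKf.
  apply: gen_alg_ext (alg_const _ 0) _ => V; rewrite /pf_coef nth_default //.
  by apply: leq_trans le; apply: size_altsum_upencil.
- by move=> h; apply: alg_gen; left.
- by move=> h; apply: alg_gen; right; left.
- move=> [le ->]; apply: gen_alg_ext (fun V => E i V le).
  by apply: gen_algZ; apply: alg_gen; right; right; exists i.
Qed.

Lemma skew_odd_singular p (M : 'M[K]_p) : odd p -> M^T = - M -> M \notin unitmx.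
Proof.
move=> op MT; rewrite unitmxE unitfE negbK; apply/eqP; apply: (eqN0 charK0).
by rewrite -{1}det_tr MT -scaleN1r detZ -signr_odd op expr1 mulN1r.
Qed.

End Final.

Theorem theorem3p3 (K : closedFieldType) (charK0 : [pchar K] =i pred0)
  (k l p : nat) (hk : (2 <= k)%N) (hl : (2 <= l)%N)
  (ek : ~~ odd k) (el : ~~ odd l) (hp : (1 <= p)%N) :
  (* (O): orthogonal case, forms MX, MY at X, Y nondegenerate symmetric *)
  (forall MX MY : 'M[K]_p, MX^T = MX -> MY^T = MY ->
     MX \in unitmx -> MY \in unitmx ->
     forall f : Rep K p k./2 l./2 -> K,
       (polyfun f /\ si_invariant (SOm MX) (SOm MY) f) <-> gen_alg (O_gens MX MY) f)
  /\
  (* (Sp): symplectic case, forms MX, MY at X, Y nondegenerate skew-symmetric *)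
  (forall MX MY : 'M[K]_p, MX^T = - MX -> MY^T = - MY ->
     MX \in unitmx -> MY \in unitmx ->
     (~~ odd p ->
       forall f : Rep K p k./2 l./2 -> K,
         (polyfun f /\ si_invariant (Spm MX) (Spm MY) f) <-> gen_alg (Sp_gens MX MY) f)
     /\
     (odd p ->
       forall f : Rep K p k./2 l./2 -> K,
         (polyfun f /\ si_invariant (Spm MX) (Spm MY) f) <-> exists c : K, f = fun _ => c)).
Proof.
have [kh Ek] : exists kh, k./2 = kh.+1 by case: k hk {ek} => [|[|k]] // _; exists k./2.
have [lh El] : exists lh, l./2 = lh.+1 by case: l hl {el} => [|[|l]] // _; exists l./2.
rewrite {}Ek {}El; clear k l hk hl ek el.
have s0 n : (-1) ^+ n != 0 :> K by rewrite signr_eq0.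
split=> MX MY MXT MYT uX uY; last split=> [ep|op] f.
- case: p hp MX MY MXT MYT uX uY => // p _ MX MY MXT MYT uX uY f.
  rewrite -O_gens_iff -O_path_gens //; try by rewrite linearZ /= ?MXT ?MYT.
  + have iX (M : 'M[K]_p.+1) n A : SOm M A <-> SOm ((-1) ^+ n *: M) A.
      have [h1 h2] := form_scale M A (s0 n).
      by split=> -[h dA]; split=> //; [apply: h2|apply: h1].
    by rewrite (si_invariant_iff f (iX MX lh.+1) (iX MY kh.+1)).
  + by rewrite unitmxZ // unitfE.
  + by rewrite unitmxZ // unitfE.
- case: p hp ep MX MY MXT MYT uX uY f => [|[|p]] // _ ep MX MY MXT MYT uX uY f.
  have skewS M n : M^T = - M -> ((-1) ^+ n *: M)^T = -1 *: ((-1) ^+ n *: M) :> 'M[K]_p.+2.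
    by move=> MT; rewrite linearZ /= MT scalerN scaleN1r.
  rewrite -Sp_gens_iff // -Sp_path_gens //; try exact: skewS.
  + have iX (M : 'M[K]_p.+2) n A : Spm M A <-> Spm ((-1) ^+ n *: M) A.
      by have [h1 h2] := form_scale M A (s0 n); split=> [/h2|/h1].
    by rewrite (si_invariant_iff f (iX MX lh.+1) (iX MY kh.+1)).
  + by rewrite unitmxZ // unitfE.
  + by rewrite unitmxZ // unitfE.
(* In odd dimension a skew-symmetric matrix is singular, against [uX]. *)
- by have := skew_odd_singular charK0 op MXT; rewrite uX.
Qed.
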